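(* Let $R$ be a normal quantum solvable algebra (NQS-algebra) over $C$ obeying Conditions CN1 and CN2, and let $\varepsilon$ be a primitive $l$-th root of unity at which $C$ can be specialised, such that $l$ is relatively prime with all $s_i,s_i'$ ($1\le i\le M$) and $l\ge N$. Then any prime $\mathcal D$-stable ideal of $R_\varepsilon$ is completely prime.
   Context: Ground ring. $K$ is an algebraically closed field of characteristic zero, $q$ an indeterminate, $C$ a localization of $K[q,q^{-1}]$ at a finitely generated multiplicative set. A skew extension $A[x;\tau,\delta]$ ($\tau$ an automorphism, $\delta$ a $\tau$-derivation: $\delta(ab)=\delta(a)b+\tau(a)\delta(b)$) is generated by $A$ and $x$ with $xa=\tau(a)x+\delta(a)$, and its elements are uniquely of the form $\sum r_ix^i$, $r_i\in A$. NQS-algebra. Let $\mathbb S=(s_{ij})$ be an $M\times M$ integer skew-symmetric matrix, $q_{ij}=q^{s_{ij}}$, and $\kappa\subset\{1,\dots,M\}$ a (distinguished) subset. A $C$-algebra $R$ ($C$ central) is an NQS-algebra if it is generated over $C$ by $x_1,\dots,x_M$ and $x_j^{-1}$ ($j\in\kappa$); the monomials $x_1^{t_1}\cdots x_M^{t_M}$ ($t_j\in\mathbb Z$ for $j\in\kappa$, $t_j\in\mathbb N$ for $j\notin\kappa$) form a free $C$-basis; $x_ix_j=q_{ij}x_jx_i$ for all $i$ and all $j\in\kappa$; and for $i<j$, $x_ix_j=q_{ij}x_jx_i+r_{ij}$ with $r_{ij}$ a sum of monomials $c\,x_{i+1}^{t_{i+1}}\cdots x_{j-1}^{t_{j-1}}$,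 $c\in C$. Let $R_i$ (resp. $R'_i$) be the subalgebra generated by $C$, the $x_j$ with $j\ge i$ (resp. $j\le i$) and their inverses for $j\in\kappa$. Then $R_i=R_{i+1}[x_i;\tau_i,\delta_i]$ and $R'_i=R'_{i-1}[x_i;\tau'_i,\delta'_i]$ (with $x_i$ inverted and $\delta_i=\delta'_i=0$ if $i\in\kappa$), where $\tau_i(x_j)=q_{ij}x_j$, $\delta_i(x_j)=r_{ij}$ for $j>i$, and $\tau_i'(x_j)=q_{ij}x_j$ for $j<i$. Condition CN1: $\tau_i\delta_i=q^{s_i}\delta_i\tau_i$ and $\tau'_i\delta'_i=q^{s'_i}\delta'_i\tau'_i$ for some integers $s_i,s_i'$, with $s_i\ne0$ if $\delta_i\neq0$ and $s'_i\ne0$ if $\delta'_i\ne0$. Condition CN2: all $\tau_i$ and $\tau_i'$ extend to diagonal automorphisms of $R$ (every $x_j$ is an eigenvector) and generate commutative diagonal groups $H$ and $H'$. $N_\alpha$ is a positive integer with $\delta_\alpha^{N_\alpha}(x_j)=0$ for $j>\alpha$ and $(\delta'_\alpha)^{N_\alpha}(x_j)=0$ for $j<\alpha$; $N=\max_\alpha N_\alpha$. Specialisation. $R_\varepsilon=R/(q-\varepsilon)R$, $a_\varepsilon=a\bmod(q-\varepsilon)$, $Z_\varepsilon$ is the center of $R_\varepsilon$. If $u\in R$ and $u_\varepsilon\in Z_\varepsilon$, then $\mathcal D_u(a)=\frac{u\underline a-\underline a u}{q-\varepsilon}\bmod(q-\varepsilon)$ ($\underline a\in R$ any preimage of $a\in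 R_\varepsilon$) is a derivation of $R_\varepsilon$. An ideal is $\mathcal D$-stable if it is stable under all $\mathcal D_u$. An ideal is completely prime if the quotient is a domain. *)

(* Defs.v *)
From HB Require Import structures.
From mathcomp Require Import all_boot all_order all_algebra.

Set Implicit Arguments.
Unset Strict Implicit.
Unset Printing Implicit Defensive.

Import Order.TTheory GRing.Theory Num.Theory.
Local Open Scope ring_scope.

(** * Ground ring *)

(* Multiplicative set of K[q] generated by q ('X) and the polynomials fs. *)
Inductive mult_set (K : comNzRingType) (fs : seq {poly K}) : {poly K} -> Prop :=
| MultSet1 : mult_set fs 1
| MultSetX : mult_set fs 'X
| MultSetGen f : f \in fs -> mult_set fs f
| MultSetM f g : mult_set fs f -> mult_set fs g -> mult_set fs (f * g).

(* [phi : K[q] -> C] makes C the localization of K[q, q^-1] at the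
   multiplicative set generated by fs.  Inverting q together with fs in K[q] is
   the same as inverting fs in K[q, q^-1], and a finite set of Laurent
   polynomials can be replaced by polynomials, since q is inverted. *)
Record localization (K : comNzRingType) (C : comUnitRingType)
    (fs : seq {poly K}) (phi : {rmorphism {poly K} -> C}) : Prop := {
  loc_unit : forall s, mult_set fs s -> phi s \is a GRing.unit;
  loc_frac : forall c : C, exists p s, mult_set fs s /\ c = phi p / phi s;
  loc_ker  : forall p, phi p = 0 -> exists2 s, mult_set fs s & s * p = 0 }.

(* The specialisation q |-> eps is defined on C. *)
Definition specialisable (K : comNzRingType) (C : comUnitRingType)
    (phi : {rmorphism {poly K} -> C}) (eps : K) : Prop :=
  exists ev : {rmorphism C -> K}, forall p, ev (phi p) = p.[eps].

(** * Skew extensions inside an algebra *)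

Section Skew.
Variables (C : comUnitRingType) (R : unitAlgType C).

Inductive subalg (G : R -> Prop) : R -> Prop :=
| SubalgGen y : G y -> subalg G y
| SubalgC c : subalg G c%:A
| SubalgD y z : subalg G y -> subalg G z -> subalg G (y + z)
| SubalgM y z : subalg G y -> subalg G z -> subalg G (y * z).

(* C-algebra automorphism of the subalgebra A; values outside A are irrelevant. *)
Record automorphism_on (A : R -> Prop) (f : R -> R) : Prop := {
  aut_stable : forall a, A a -> A (f a);
  aut_linear : forall c a b, A a -> A b -> f (c *: a + b) = c *: f a + f b;
  aut_mul    : forall a b, A a -> A b -> f (a * b) = f a * f b;
  aut_one    : f 1 = 1;
  aut_inj    : forall a b, A a -> A b -> f a = f b -> a = b;
  aut_surj   : forall b, A b -> exists2 a, A a & f a = b }.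

Record skew_derivation_on (A : R -> Prop) (tau delta : R -> R) : Prop := {
  skd_stable : forall a, A a -> A (delta a);
  skd_linear : forall c a b, A a -> A b ->
    delta (c *: a + b) = c *: delta a + delta b;
  skd_mul    : forall a b, A a -> A b ->
    delta (a * b) = delta a * b + tau a * delta b }.

(* B = A[x; tau, delta], or B = A[x, x^-1; tau] (and then delta = 0) when
   [inverted] is true.  The last two fields say that the elements of B are
   uniquely of the form \sum_t r_t x^t with r_t in A. *)
Record skew_extension (inverted : bool) (A B : R -> Prop) (x : R)
    (tau delta : R -> R) : Prop := {
  skew_aut  : automorphism_on A tau;
  skew_der  : skew_derivation_on A tau delta;
  skew_comm : forall a, A a -> x * a = tau a * x + delta a;
  skew_inv  : inverted ->
    x \is a GRing.unit /\ (forall a, A a -> delta a = 0);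
  skew_span : forall b, B b <->
    exists (s : seq int) (r : int -> R),
      [/\ forall t, t \in s -> inverted || (0 <= t),
          forall t, t \in s -> A (r t)
        & b = \sum_(t <- s) r t * x ^ t];
  skew_free : forall (s : seq int) (r : int -> R), uniq s ->
      (forall t, t \in s -> inverted || (0 <= t)) ->
      (forall t, t \in s -> A (r t)) ->
      \sum_(t <- s) r t * x ^ t = 0 -> forall t, t \in s -> r t = 0 }.

(** * NQS-algebras *)

Section NQS.
Variables (q : C) (M : nat) (S : 'M[int]_M) (kappa : {set 'I_M}) (x : 'I_M -> R).

Definition qcoef (i j : 'I_M) : C := q ^ (S i j).

Definition exponent := {ffun 'I_M -> int}.

(* Only the x_j with j in kappa may have negative exponents. *)
Definition admissible (t : exponent) : Prop :=
  forall j, j \notin kappa -> 0 <= t j.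

Definition monomial (t : exponent) : R := \prod_(i < M) x i ^ t i.

Definition remainder (i j : 'I_M) : R := x i * x j - qcoef i j *: (x j * x i).

(* Subalgebra generated by the x_j with j in P, and by x_j^-1 for those j
   that also lie in kappa. *)
Definition subalg_on (P : pred 'I_M) : R -> Prop :=
  subalg (fun y => exists2 j, P j & y = x j \/ (j \in kappa /\ y = (x j)^-1)).

(* R_i, R_{i+1}, R'_i and R'_{i-1} *)
Definition upper_ge (i : 'I_M) := subalg_on (fun j => (i <= j)%N).
Definition upper_gt (i : 'I_M) := subalg_on (fun j => (i < j)%N).
Definition lower_le (i : 'I_M) := subalg_on (fun j => (j <= i)%N).
Definition lower_lt (i : 'I_M) := subalg_on (fun j => (j < i)%N).

Record NQS_algebra : Prop := {
  nqs_skew  : S^T = - S;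
  nqs_unit  : forall j, j \in kappa -> x j \is a GRing.unit;
  nqs_gen   : forall y, subalg_on predT y;
  nqs_span  : forall y, exists (s : seq exponent) (c : exponent -> C),
    (forall t, t \in s -> admissible t) /\
    y = \sum_(t <- s) c t *: monomial t;
  nqs_free  : forall (s : seq exponent) (c : exponent -> C), uniq s ->
    (forall t, t \in s -> admissible t) ->
    \sum_(t <- s) c t *: monomial t = 0 -> forall t, t \in s -> c t = 0;
  nqs_kappa : forall i j, j \in kappa -> x i * x j = qcoef i j *: (x j * x i);
  nqs_rem   : forall i j : 'I_M, (i < j)%N ->
    exists (s : seq exponent) (c : exponent -> C),
      (forall t, t \in s ->
         admissible t /\ (forall k : 'I_M, t k != 0 -> (i < k < j)%N)) /\
      remainder i j = \sum_(t <- s) c t *: monomial t }.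

(* R_i = R_{i+1}[x_i; tau_i, delta_i] and R'_i = R'_{i-1}[x_i; tau'_i, delta'_i].
   The relation x_i a = tau_i(a) x_i + delta_i(a) determines tau_i and delta_i
   on R_{i+1}, and tau'_i and delta'_i on R'_{i-1}; their values elsewhere are
   never used. *)
Record NQS_skew_maps (tau delta tau' delta' : 'I_M -> R -> R) : Prop := {
  nqs_upper : forall i, skew_extension (i \in kappa)
    (upper_gt i) (upper_ge i) (x i) (tau i) (delta i);
  nqs_lower : forall i, skew_extension (i \in kappa)
    (lower_lt i) (lower_le i) (x i) (tau' i) (delta' i);
  nqs_tau   : forall i j : 'I_M, (i < j)%N -> tau i (x j) = qcoef i j *: x j;
  nqs_delta : forall i j : 'I_M, (i < j)%N -> delta i (x j) = remainder i j;
  nqs_tau'  : forall i j : 'I_M, (j < i)%N -> tau' i (x j) = qcoef i j *: x j }.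

Definition q_commuting_on (A : R -> Prop) (tau delta : R -> R) (s : int) : Prop :=
  (forall a, A a -> tau (delta a) = q ^ s *: delta (tau a)) /\
  ((exists2 a, A a & delta a != 0) -> s != 0).

Definition CN1 (tau delta tau' delta' : 'I_M -> R -> R) (s s' : 'I_M -> int) :=
  forall i, q_commuting_on (upper_gt i) (tau i) (delta i) (s i) /\
            q_commuting_on (lower_lt i) (tau' i) (delta' i) (s' i).

Definition diagonal_automorphism (h : R -> R) : Prop :=
  automorphism_on (fun _ => True) h /\
  forall j, exists c : C, h (x j) = c *: x j.

(* Group of bijections of R generated by the family h. *)
Inductive generated_group (h : 'I_M -> R -> R) : (R -> R) -> Prop :=
| GenGroup1 : generated_group h id
| GenGroupGen i : generated_group h (h i)
| GenGroupM f g : generated_group h f -> generated_group h g ->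
    generated_group h (f \o g)
| GenGroupV f g : generated_group h f -> cancel f g -> cancel g f ->
    generated_group h g.

Definition commutative_diagonal_group (H : (R -> R) -> Prop) : Prop :=
  (forall f, H f -> diagonal_automorphism f) /\
  (forall f g, H f -> H g -> f \o g =1 g \o f).

(* Each tau_i, defined on A i, extends to a diagonal automorphism h_i of R, and
   the h_i generate a commutative diagonal group. *)
Definition extends_diagonally (A : 'I_M -> R -> Prop) (tau : 'I_M -> R -> R) :=
  exists h : 'I_M -> R -> R,
    [/\ forall i, diagonal_automorphism (h i),
        forall i a, A i a -> h i a = tau i a
      & commutative_diagonal_group (generated_group h)].

Definition CN2 (tau tau' : 'I_M -> R -> R) : Prop :=
  extends_diagonally upper_gt tau /\ extends_diagonally lower_lt tau'.

Definition nilpotency_bound (delta delta' : 'I_M -> R -> R) (N_ : 'I_M -> nat) :=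
  forall a : 'I_M,
    [/\ (0 < N_ a)%N,
        forall j : 'I_M, (a < j)%N -> iter (N_ a) (delta a) (x j) = 0
      & forall j : 'I_M, (j < a)%N -> iter (N_ a) (delta' a) (x j) = 0].

End NQS.

(** * Specialisation and D-stable ideals *)

(* pi : R -> Re is the quotient of R by its ideal (q - eps)R; h is q - eps. *)
Definition quotient_by (h : C) (Re : nzRingType) (pi : {rmorphism R -> Re}) : Prop :=
  (forall a, exists u, pi u = a) /\
  (forall u, pi u = 0 <-> exists w, u = h *: w).

(* Graph of D_u : b = D_u(a), where a = pi v, u v - v u = h w and b = pi w. *)
Definition quantum_derivation (h : C) (Re : nzRingType) (pi : {rmorphism R -> Re})
    (u : R) (a b : Re) : Prop :=
  exists v w, [/\ pi v = a, u * v - v * u = h *: w & pi w = b].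

Definition central (A : nzRingType) (z : A) : Prop := forall a, z * a = a * z.

Definition D_stable (h : C) (Re : nzRingType) (pi : {rmorphism R -> Re})
    (I : Re -> Prop) : Prop :=
  forall u, central (pi u) ->
  forall a b, I a -> quantum_derivation h pi u a b -> I b.

End Skew.

Section Ideals.
Variable A : nzRingType.

Record two_sided_ideal (I : A -> Prop) : Prop := {
  ideal0  : I 0;
  idealD  : forall a b, I a -> I b -> I (a + b);
  idealMl : forall r a, I a -> I (r * a);
  idealMr : forall r a, I a -> I (a * r) }.

(* Noncommutative prime ideals: J J' <= I implies J <= I or J' <= I. *)
Definition prime_ideal (I : A -> Prop) : Prop :=
  [/\ two_sided_ideal I, ~ I 1
    & forall J J' : A -> Prop, two_sided_ideal J -> two_sided_ideal J' ->
      (forall a b, J a -> J' b -> I (a * b)) ->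
      (forall a, J a -> I a) \/ (forall b, J' b -> I b)].

(* A / I is a domain, expressed on representatives. *)
Definition completely_prime (I : A -> Prop) : Prop :=
  [/\ two_sided_ideal I, ~ I 1 & forall a b, I (a * b) -> I a \/ I b].

End Ideals.

(* Main.v *)
Require Import Defs.
From HB Require Import structures.
From mathcomp Require Import all_boot all_order all_algebra.
From mathcomp Require Import zify ring.
From mathcomp Require Import generic_quotient boolp.
Set Implicit Arguments.
Unset Strict Implicit.
Unset Printing Implicit Defensive.
Import Order.TTheory GRing.Theory Num.Theory.
Local Open Scope ring_scope.

(** Let [B] be the quotient of the specialised algebra by the ideal: a prime ring.  A
    prime ring has no nonzero nilpotent ideal, and it is a domain as soon as it has no
    nonzero nilpotent element ([prime_nilpotent_ideal], [prime_reduced_domain]).  So it is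
    enough to put every nilpotent element of [B] into a nilpotent ideal.

    The tools are the powers [x i ^+ l].  Moving [x i ^+ l] across [x j] produces
    Gaussian binomials of [l] times the iterates of the skew derivation at [x j]
    ([chain_comm]).  Since [l] is prime to the exponents of condition CN1, these
    binomials vanish at [eps], except the two extreme ones ([qbin_dvd]), and the last
    iterate is zero because the nilpotency bound is at most [l].  Hence [x i ^+ l] is
    central modulo q - eps and defines one of the derivations of D-stability.  It acts
    on [B], and extends to the ring [Q] of central fractions of [B]
    ([central_fractions], [extend_derivation]), in which every nonzero central element
    is invertible.

    The variables are then deleted one after the other inside [Q].  A [stage] [k]
    consists of images [X j] of the [x j] with [k <= j], of derivations [D j] attached
    to the central elements [X j ^+ l], of invertible elements [y i], for some [i < k],
    which commute with each other and with the [X j] up to powers of [eps], and of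
    derivations [E i] having the [y j] and the [X j] as eigenvectors.  The property
    proved by descending induction on [k] is [nil_prop k]: in the algebra generated by
    the [X j], the [y i] and their available inverses, a nilpotent homogeneous element
    lies in a nilpotent ideal.

    - For [k = M] only the [y i] remain.  The degree of an element determines how it
      commutes with them, so a nonzero homogeneous element is the product of a unit and
      of a central element ([nil_prop_torus]).

    - If z = [X k ^+ l] is not zero, it is invertible.  The normalised derivation
      z^-1 * [D k] acts on the iterates of the skew derivation of [x k] by a triangular
      matrix with distinct integral eigenvalues ([chain_Ek]), so that in
      characteristic 0 each [X j] is a sum of eigenvectors ([chain_filt]).  The lowest
      ones satisfy the relations of the [X j] and commute with [X k] up to a power of
      [eps]; together with [y k := X k] they form a stage [k.+1] ([stage_next]).  The
      lowest component of a nilpotent element is nilpotent, which brings the property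
      down to stage [k] ([nilpotent_new_galg]).

    - If [X k ^+ l = 0], then [D k] kills the [X j ^+ l], and comparing coefficients in
      the divided powers of the skew derivation shows that its iterates of positive
      order at [X j] lie in nilpotent ideals ([wordQ_vanish], [chain_nil]).  Modulo
      these, [X k] is normal and nilpotent, and can be set to zero
      ([nil_prop_vanish]).

    At stage 0 there is no [y], every element is homogeneous and the algebra is the
    image of [B] ([prime_quotient_domain]). *)

(** * Quotient rings *)
Section QuotientRing.
Variables (A : nzRingType) (I : A -> Prop).
Hypotheses (idI : two_sided_ideal I) (I1 : ~ I 1).

Lemma idealB a b : I a -> I b -> I (a - b).
Proof. by move=> Ia Ib; apply: idealD => //; rewrite -mulN1r; apply: idealMl. Qed.

Definition ideal_pred : {pred A} := fun a => `[< I a >].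

Lemma ideal_pred_zmod : zmod_closed ideal_pred.
Proof.
split=> [|a b /asboolP Ia /asboolP Ib]; apply/asboolP; first exact: ideal0.
exact: idealB.
Qed.
HB.instance Definition _ := GRing.isZmodClosed.Build A ideal_pred ideal_pred_zmod.

Definition quo := Quotient.quot ideal_pred.
HB.instance Definition _ := GRing.Zmodule.on quo.
HB.instance Definition _ := EqQuotient.on quo.

Local Open Scope quotient_scope.
Let pr (a : A) : quo := \pi_quo a.

Let prP a b : pr a = pr b <-> I (a - b).
Proof.
split=> [/eqP|Iab]; rewrite /pr; last by apply/eqP; rewrite -Quotient.idealrBE; apply/asboolP.
by rewrite -Quotient.idealrBE => /asboolP.
Qed.

Let prK q : pr (repr q) = q. Proof. exact: reprK. Qed.

Let prD a b : pr (a + b) = pr a + pr b. Proof. exact: raddfD. Qed.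

Definition quo_mul (p q : quo) : quo := pr (repr p * repr q).

Let prM a b : quo_mul (pr a) (pr b) = pr (a * b).
Proof.
apply/prP; set a' := repr (pr a); set b' := repr (pr b).
have Ha : I (a' - a) by apply/prP; rewrite prK.
have Hb : I (b' - b) by apply/prP; rewrite prK.
have -> : a' * b' - a * b = a' * (b' - b) + (a' - a) * b.
  by rewrite mulrBr mulrBl addrA subrK.
by apply: (idealD idI); [apply: (idealMl idI) | apply: (Defs.idealMr idI)].
Qed.

Let mulA : associative quo_mul.
Proof. by move=> p q r; rewrite -[p]prK -[q]prK -[r]prK !prM mulrA. Qed.
Let mul1 : left_id (pr 1) quo_mul.
Proof. by move=> p; rewrite -[p]prK prM mul1r. Qed.
Let mulr1 : right_id (pr 1) quo_mul.
Proof. by move=> p; rewrite -[p]prK prM mulr1. Qed.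
Let mulDl : left_distributive quo_mul +%R.
Proof. by move=> p q r; rewrite -[p]prK -[q]prK -[r]prK -prD !prM mulrDl prD. Qed.
Let mulDr : right_distributive quo_mul +%R.
Proof. by move=> p q r; rewrite -[p]prK -[q]prK -[r]prK -prD !prM mulrDr prD. Qed.
Let one_neq0 : pr 1 != 0.
Proof.
apply/eqP => e; apply: I1.
have : pr 1 = pr 0 by rewrite e /pr raddf0.
by move/prP; rewrite subr0.
Qed.
HB.instance Definition _ := GRing.Zmodule_isNzRing.Build quo mulA mul1 mulr1 mulDl mulDr one_neq0.

Let prmor : monoid_morphism pr. Proof. by split=> // a b; rewrite -prM. Qed.
Let pradd : zmod_morphism pr. Proof. by move=> a b; rewrite /pr raddfB. Qed.

Lemma quotient_ring_exists :
  exists (B : nzRingType) (rho : {rmorphism A -> B}),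
    (forall b, exists a, rho a = b) /\ (forall a, rho a = 0 <-> I a).
Proof.
pose r1 := GRing.isZmodMorphism.Build A quo pr pradd.
pose r2 := GRing.isMonoidMorphism.Build A quo pr prmor.
pose rho : {rmorphism A -> quo} := HB.pack pr r1 r2.
exists quo, rho; split=> [b|a]; first by exists (repr b); exact: prK.
have -> : (0 : quo) = pr 0 by rewrite /pr raddf0.
by rewrite (prP a 0) subr0.
Qed.

End QuotientRing.

(** * Rings of central fractions *)
Section CentralFractions.
Variables (K : fieldType) (B : nzRingType) (kap : {rmorphism K -> B}).
Hypothesis kapC : forall k, central (kap k).
Hypothesis regC : forall c a : B, central c -> c * a = 0 -> c = 0 \/ a = 0.

Definition den_pred (c : B) := `[< central c >] && (c != 0).
Definition den := {c : B | den_pred c}.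

Lemma denC (c : den) : central (val c).
Proof. by case: c => c /= /andP[/asboolP]. Qed.
Lemma den_neq0 (c : den) : val c != 0.
Proof. by case: c => c /= /andP[]. Qed.
Lemma den_inj (c : den) a b : a * val c = b * val c -> a = b.
Proof.
move=> e; apply/eqP; rewrite -subr_eq0; apply/eqP.
have : val c * (a - b) = 0 by rewrite denC mulrBl e subrr.
by case/(regC (denC c)) => // c0; have := den_neq0 c; rewrite c0 eqxx.
Qed.

Lemma den1_subproof : den_pred 1.
Proof. by rewrite /den_pred oner_neq0 andbT; apply/asboolP=> a; rewrite mul1r mulr1. Qed.
Definition den1 : den := Sub 1 den1_subproof.
Lemma denM_subproof (c d : den) : den_pred (val c * val d).
Proof.
apply/andP; split; first by apply/asboolP => a; rewrite -mulrA (denC d a) mulrA (denC c a) -mulrA.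
apply/eqP => /(regC (denC c))[] e; [have := den_neq0 c|have := den_neq0 d]; by rewrite e eqxx.
Qed.
Definition denM (c d : den) : den := Sub (val c * val d) (denM_subproof c d).

(** As denominators are central, cross-multiplication compares fractions without any Ore
    condition. *)
Definition fr_eq : rel (B * den) := fun p q => p.1 * val q.2 == q.1 * val p.2.
Lemma denCA (c : den) a b : a * val c * b = a * b * val c.
Proof. by rewrite -!mulrA (denC c). Qed.

Lemma fr_eq_equiv : equiv_class_of fr_eq.
Proof.
split=> [p|p q|q p r]; rewrite /fr_eq; [exact: eqxx|exact: eq_sym|].
move=> /eqP e1 /eqP e2; apply/eqP.
by apply: (@den_inj q.2); rewrite denCA e1 denCA e2 denCA.
Qed.
Canonical fr_equiv := EquivRelPack fr_eq_equiv.
Canonical fr_encModRel := defaultEncModRel fr_eq.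

Local Open Scope quotient_scope.
Definition frac := {eq_quot fr_eq}.
HB.instance Definition _ := Choice.on frac.
HB.instance Definition _ := EqQuotient.on frac.

Definition fr (a : B) (c : den) : frac := \pi_frac (a, c).

Lemma frP a c b d : fr a c = fr b d <-> a * val d = b * val c.
Proof.
split=> [/eqP|e]; first by rewrite /fr eqmodE => /eqP.
by apply/eqP; rewrite /fr eqmodE; apply/eqP.
Qed.

Lemma fr_scale a c d : fr (a * val d) (denM c d) = fr a c.
Proof. by apply/frP; rewrite /= mulrA denCA. Qed.

Lemma fr_scalel a c d : fr (a * val c) (denM c d) = fr a d.
Proof. by apply/frP; rewrite /= mulrA. Qed.

Lemma fr_repr p : fr (repr p).1 (repr p).2 = p.
Proof. by rewrite /fr -surjective_pairing reprK. Qed.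

Lemma fr_ex q : exists a c, q = fr a c.
Proof. by exists (repr q).1, (repr q).2; rewrite fr_repr. Qed.

Lemma fr_ex2 p q : exists a b c, p = fr a c /\ q = fr b c.
Proof.
have [a [c ->]] := fr_ex p; have [b [d ->]] := fr_ex q.
by exists (a * val d), (b * val c), (denM c d); rewrite fr_scale fr_scalel.
Qed.

Lemma fr_ex3 p q r : exists a b e c, [/\ p = fr a c, q = fr b c & r = fr e c].
Proof.
have [a [b [c [-> ->]]]] := fr_ex2 p q; have [e [d ->]] := fr_ex r.
exists (a * val d), (b * val d), (e * val c), (denM c d).
by rewrite !fr_scale fr_scalel.
Qed.

Definition fr_add (p q : frac) :=
  fr ((repr p).1 * val (repr q).2 + (repr q).1 * val (repr p).2)
     (denM (repr p).2 (repr q).2).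
Definition fr_opp (p : frac) := fr (- (repr p).1) (repr p).2.
Definition fr_mul (p q : frac) :=
  fr ((repr p).1 * (repr q).1) (denM (repr p).2 (repr q).2).

Lemma fr_addE a b c : fr_add (fr a c) (fr b c) = fr (a + b) c.
Proof.
rewrite /fr_add.
move: (fr_repr (fr a c)) (fr_repr (fr b c)) => /frP ea /frP eb.
apply/frP; rewrite /= !mulrDl !mulrA.
by congr (_ + _); rewrite denCA ?ea ?eb // denCA; congr (_ * _); rewrite denCA.
Qed.

Lemma fr_oppE a c : fr_opp (fr a c) = fr (- a) c.
Proof.
by rewrite /fr_opp; move: (fr_repr (fr a c)) => /frP ea; apply/frP; rewrite !mulNr ea.
Qed.

Lemma fr_mulE a c b d : fr_mul (fr a c) (fr b d) = fr (a * b) (denM c d).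
Proof.
rewrite /fr_mul.
move: (fr_repr (fr a c)) (fr_repr (fr b d)) => /frP ea /frP eb.
apply/frP; rewrite /= !mulrA -(denCA c) ea (denCA _ a) (denCA _ _ (val d)).
by rewrite -(mulrA a) eb mulrA (denCA (repr (fr b d)).2).
Qed.

Lemma fr0E c d : fr 0 c = fr 0 d. Proof. by apply/frP; rewrite !mul0r. Qed.

Let addA : associative fr_add.
Proof. by move=> p q r; have [a [b [e [c [-> -> ->]]]]] := fr_ex3 p q r; rewrite !fr_addE addrA. Qed.
Let addC : commutative fr_add.
Proof. by move=> p q; have [a [b [c [-> ->]]]] := fr_ex2 p q; rewrite !fr_addE addrC. Qed.
Let add0 : left_id (fr 0 den1) fr_add.
Proof. by move=> p; have [a [c ->]] := fr_ex p; rewrite (fr0E _ c) fr_addE add0r. Qed.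
Let addN : left_inverse (fr 0 den1) fr_opp fr_add.
Proof. by move=> p; have [a [c ->]] := fr_ex p; rewrite (fr0E _ c) fr_oppE fr_addE addNr. Qed.
HB.instance Definition _ := GRing.isZmodule.Build frac addA addC add0 addN.

Lemma frD a b c : fr a c + fr b c = fr (a + b) c. Proof. exact: fr_addE. Qed.

Let mulA : associative fr_mul.
Proof.
move=> p q r; have [a [b [e [c [-> -> ->]]]]] := fr_ex3 p q r.
by rewrite !fr_mulE; apply/frP; rewrite /= !mulrA.
Qed.
Let mul1 : left_id (fr 1 den1) fr_mul.
Proof.
by move=> p; have [a [c ->]] := fr_ex p; rewrite fr_mulE; apply/frP; rewrite /= !mul1r.
Qed.
Let fmulr1 : right_id (fr 1 den1) fr_mul.
Proof.
by move=> p; have [a [c ->]] := fr_ex p; rewrite fr_mulE; apply/frP; rewrite /= !mulr1.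
Qed.
Let mulDl : left_distributive fr_mul +%R.
Proof.
move=> p q r; have [a [b [e [c [-> -> ->]]]]] := fr_ex3 p q r.
by rewrite frD !fr_mulE frD mulrDl.
Qed.
Let mulDr : right_distributive fr_mul +%R.
Proof.
move=> p q r; have [a [b [e [c [-> -> ->]]]]] := fr_ex3 p q r.
by rewrite frD !fr_mulE frD mulrDr.
Qed.
Let one_neq0 : fr 1 den1 != 0.
Proof. by apply/eqP => /frP/eqP; rewrite /= mul0r mulr1 oner_eq0. Qed.
HB.instance Definition _ :=
  GRing.Zmodule_isNzRing.Build frac mulA mul1 fmulr1 mulDl mulDr one_neq0.

Lemma frM a c b d : fr a c * fr b d = fr (a * b) (denM c d).
Proof. exact: fr_mulE. Qed.

Definition fr_scaleK (k : K) (p : frac) : frac := fr (kap k) den1 * p.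

Lemma fr_kapC k p : fr (kap k) den1 * p = p * fr (kap k) den1.
Proof.
have [a [c ->]] := fr_ex p; rewrite !frM kapC.
by apply/frP; rewrite /= mul1r mulr1.
Qed.

Let scA a b v : fr_scaleK a (fr_scaleK b v) = fr_scaleK (a * b) v.
Proof. by rewrite /fr_scaleK mulrA frM rmorphM; congr (_ * _); apply/frP; rewrite /= !mulr1. Qed.
Let sc1 : left_id 1 fr_scaleK.
Proof. by move=> v; rewrite /fr_scaleK rmorph1 mul1r. Qed.
Let scDr : right_distributive fr_scaleK +%R.
Proof. by move=> k u v; rewrite /fr_scaleK mulrDr. Qed.
Let scDl v : {morph fr_scaleK^~ v : a b / a + b}.
Proof. by move=> a b; rewrite /fr_scaleK rmorphD -frD mulrDl. Qed.
HB.instance Definition _ := GRing.Zmodule_isLmodule.Build K frac scA sc1 scDr scDl.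
Let scAl (k : K) (u v : frac) : k *: (u * v) = k *: u * v.
Proof. exact: mulrA. Qed.
HB.instance Definition _ := GRing.Lmodule_isLalgebra.Build K frac scAl.
Let scAr (k : K) (u v : frac) : k *: (u * v) = u * (k *: v).
Proof. by rewrite /GRing.scale /= /fr_scaleK mulrA fr_kapC -mulrA. Qed.
HB.instance Definition _ := GRing.Lalgebra_isAlgebra.Build K frac scAr.

Definition fr_in (b : B) : frac := fr b den1.
Let inB : zmod_morphism fr_in.
Proof.
move=> a b; rewrite /fr_in -mulN1r -[- fr b _]mulN1r -frD; congr (_ + _).
by rewrite /GRing.opp /= fr_oppE frM; apply/frP; rewrite /= mulr1.
Qed.
Let inM : monoid_morphism fr_in.
Proof. by split=> // a b; rewrite /fr_in frM; apply/frP; rewrite /= mulr1. Qed.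

(** Inverting all the nonzero central elements, and not only the powers of one of them,
    makes every nonzero central element of [Q] invertible as well ([frac_inv]). *)
Lemma central_fractions :
  exists (Q : algType K) (j : {rmorphism B -> Q}),
  [/\ forall b, j b = 0 -> b = 0,
      forall k, j (kap k) = k%:A,
      forall c, central c -> c != 0 -> exists c' : Q, [/\ central c', j c * c' = 1 & c' * j c = 1]
    & forall q : Q, exists b c, [/\ central c, c != 0 & q * j c = j b]].
Proof.
pose r1 := GRing.isZmodMorphism.Build B frac fr_in inB.
pose r2 := GRing.isMonoidMorphism.Build B frac fr_in inM.
pose j : {rmorphism B -> frac} := HB.pack fr_in r1 r2.
exists frac, j; split.
- by move=> b /frP/=; rewrite mul0r mulr1.
- by move=> k; rewrite /GRing.scale /= /fr_scaleK mulr1.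
- move=> c Cc c0; have dc : den_pred c by apply/andP; split=> //; apply/asboolP.
  exists (fr 1 (Sub c dc)); split.
  + move=> p; have [a [d ->]] := fr_ex p; rewrite !frM mul1r mulr1.
    by apply/frP; rewrite /=; congr (_ * _); rewrite -Cc.
  + by rewrite /= /fr_in frM; apply/frP; rewrite /= !mul1r !mulr1.
  + by rewrite /= /fr_in frM; apply/frP; rewrite /= !mul1r !mulr1.
- move=> q; have [a [c ->]] := fr_ex q; exists a, (val c); split.
  + exact: denC.
  + exact: den_neq0.
  by rewrite /= /fr_in frM; apply/frP; rewrite /= !mulr1.
Qed.
End CentralFractions.

(** * Nilpotent ideals of a subring *)
Section NilIdeals.
Variable Q : nzRingType.

(** Subrings are predicates on [Q], because the induction changes the subring inside a
    fixed ring. *)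
Record subring (A : Q -> Prop) : Prop := {
  subr_1 : A 1;
  subr_B : forall a b, A a -> A b -> A (a - b);
  subr_M : forall a b, A a -> A b -> A (a * b) }.

Lemma subr_0 A : subring A -> A 0.
Proof. by move=> sA; rewrite -(subrr 1); apply: subr_B => //; apply: subr_1. Qed.
Lemma subr_N A a : subring A -> A a -> A (- a).
Proof. by move=> sA Aa; rewrite -sub0r; apply: subr_B => //; apply: subr_0. Qed.
Lemma subr_D A a b : subring A -> A a -> A b -> A (a + b).
Proof. by move=> sA Aa Ab; rewrite -[b]opprK; apply: subr_B => //; apply: subr_N. Qed.

Record ideal_of (A J : Q -> Prop) : Prop := {
  id_sub : forall a, J a -> A a;
  id_0 : J 0;
  id_D : forall a b, J a -> J b -> J (a + b);
  id_Ml : forall a b, A a -> J b -> J (a * b);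
  id_Mr : forall a b, J a -> A b -> J (a * b) }.

Definition all_in (J : Q -> Prop) (t : seq Q) := forall a, a \in t -> J a.

Definition nilpotent_set (J : Q -> Prop) :=
  exists r, forall t, size t = r -> all_in J t -> \prod_(a <- t) a = 0.

Definition nil_ideal A J := ideal_of A J /\ nilpotent_set J.

Definition strongly_nil A b := exists J, nil_ideal A J /\ J b.

Lemma all_in_cons J a t : all_in J (a :: t) <-> J a /\ all_in J t.
Proof.
split=> [H|[Ja Jt] b]; first by split=> [|b bt]; apply: H; rewrite inE ?eqxx ?bt ?orbT.
by rewrite inE => /orP[/eqP->//|/Jt].
Qed.

Lemma all_in_cat J t u : all_in J (t ++ u) <-> all_in J t /\ all_in J u.
Proof.
split=> [H|[Jt Ju] b]; first by split=> b bt; apply: H; rewrite mem_cat bt ?orbT.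
by rewrite mem_cat => /orP[/Jt|/Ju].
Qed.

Variables (A : Q -> Prop) (sA : subring A).

Lemma id_N J a : ideal_of A J -> J a -> J (- a).
Proof. by move=> iJ Ja; rewrite -mulN1r; apply: (id_Ml iJ) => //; apply: subr_N (subr_1 sA). Qed.

(** A product of [r * s] factors is a product of [r] blocks of length [s]. *)
Lemma nilpotent_set_ext J (L : Q -> Prop) s :
  nilpotent_set J -> (forall t, size t = s -> all_in L t -> J (\prod_(a <- t) a)) ->
  nilpotent_set L.
Proof.
move=> [r Hr] Hs; exists (r * s)%N => t.
have : forall n t, size t = (n * s)%N -> all_in L t ->
    exists u, [/\ size u = n, all_in J u & \prod_(a <- u) a = \prod_(a <- t) a].
  elim=> [|n IH] {}t szt Lt; first by exists [::]; rewrite (size0nil szt).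
  have := Lt; rewrite -(cat_take_drop s t) => /all_in_cat[L1 L2].
  have sz1 : size (take s t) = s by rewrite size_takel // szt mulSn leq_addr.
  have [|u [szu Ju eu]] := IH (drop s t) _ L2; first by rewrite size_drop szt mulSn addKn.
  exists ((\prod_(a <- take s t) a) :: u); split; first by rewrite /= szu.
  - by apply/all_in_cons; split=> //; apply: Hs.
  - by rewrite big_cons big_cat eu.
by move=> H szt Lt; have [u [szu Ju <-]] := H r t szt Lt; apply: Hr.
Qed.

Lemma nilpotent_set_exp J a : nilpotent_set J -> J a -> exists n, a ^+ n = 0.
Proof.
move=> [r Hr] Ja; exists r; rewrite -(Hr (nseq r a)) ?size_nseq //.
  by rewrite big_nseq; elim: r {Hr} => //= r <-; rewrite exprS.
by move=> b; rewrite mem_nseq => /andP[_ /eqP->].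
Qed.

(** Replacing the factors one at a time changes the product by elements of [J]. *)
Lemma prod_modulo J (P L : Q -> Prop) t :
  ideal_of A J -> (forall a, P a -> A a) ->
  (forall a, L a -> exists2 b, P b & J (a - b)) -> all_in L t ->
  exists u, [/\ size u = size t, all_in P u, A (\prod_(a <- u) a) &
    J (\prod_(a <- t) a - \prod_(a <- u) a)].
Proof.
move=> iJ PA LP; elim: t => [|a t IH].
  by exists [::]; split=> //; rewrite !big_nil ?subrr; [apply: subr_1 | apply: id_0 iJ].
move=> /all_in_cons[La Lt]; have [u [su Pu Au Ju]] := IH Lt; have [b Pb Jab] := LP _ La.
exists (b :: u); rewrite !big_cons; split.
- by rewrite /= su.
- exact/all_in_cons.
- by apply: subr_M => //; apply: PA.
set p := \prod_(a <- t) a in Ju *; set q := \prod_(a <- u) a in Au Ju *.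
have -> : a * p - b * q = (a - b) * (p - q) + (a - b) * q + b * (p - q).
  by rewrite -mulrDr subrK mulrBl mulrBr addrA subrK.
have AP := PA _ Pb.
apply: (id_D iJ); first apply: (id_D iJ).
- by apply: (id_Mr iJ) => //; apply: (id_sub iJ).
- exact: (id_Mr iJ).
- exact: (id_Ml iJ).
Qed.

(** If products of [r] elements of [J] and of [s] elements of [P] vanish, a product of [s]
    sums lies in [J], and one of [r * s] sums vanishes. *)
Lemma nil_ideal_sum J (P : Q -> Prop) : nil_ideal A J -> (forall a, P a -> A a) ->
  nilpotent_set P -> nilpotent_set (fun b => exists a j, [/\ P a, J j & b = a + j]).
Proof.
move=> [iJ nJ] PA [s Hs]; apply: (nilpotent_set_ext (s := s) nJ) => t szt Lt.
have [|u [szu Pu Au Ju]] := prod_modulo (P := P) iJ PA _ Lt.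
  by move=> a [b [j [Pb Jj ->]]]; exists b => //; rewrite addrC addKr.
by move: Ju; rewrite (Hs u) ?subr0 // szu.
Qed.

Lemma strongly_nil0 : strongly_nil A 0.
Proof.
exists (fun b => b = 0); split=> //; split; last first.
  exists 1%N => t; case: t => [|a []] // _ H; rewrite big_seq1.
  by apply: H; rewrite inE.
split=> //.
- by move=> a ->; apply: subr_0.
- by move=> a b -> ->; rewrite addr0.
- by move=> a b _ ->; rewrite mulr0.
- by move=> a b -> _; rewrite mul0r.
Qed.

Lemma nil_ideal_add J L : nil_ideal A J -> nil_ideal A L ->
  nil_ideal A (fun c => exists u v, [/\ L u, J v & c = u + v]).
Proof.
move=> [iJ nJ] [iL nL]; split; last by apply: nil_ideal_sum => // u; apply: id_sub.
split.
- by move=> _ [u [v [Lu Jv ->]]]; apply: subr_D => //; [apply: id_sub iL _ _ | apply: id_sub iJ _ _].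
- by exists 0, 0; rewrite addr0; split=> //; [apply: id_0 iL | apply: id_0 iJ].
- move=> _ _ [u [v [Lu Jv ->]]] [u' [v' [Lu' Jv' ->]]].
  by exists (u + u'), (v + v'); rewrite addrACA; split=> //; [apply: id_D iL _ _ _ _ | apply: id_D iJ _ _ _ _].
- move=> c _ Ac [u [v [Lu Jv ->]]]; exists (c * u), (c * v); rewrite mulrDr.
  by split=> //; [apply: id_Ml iL _ _ _ _ | apply: id_Ml iJ _ _ _ _].
- move=> _ c [u [v [Lu Jv ->]]] Ac; exists (u * c), (v * c); rewrite mulrDl.
  by split=> //; [apply: id_Mr iL _ _ _ _ | apply: id_Mr iJ _ _ _ _].
Qed.

Lemma strongly_nilD a b : strongly_nil A a -> strongly_nil A b -> strongly_nil A (a + b).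
Proof.
move=> [J [nJ Ja]] [L [nL Lb]].
exists (fun c => exists u v, [/\ L u, J v & c = u + v]); split; first exact: nil_ideal_add.
by exists b, a; rewrite addrC.
Qed.

(** A finite sum of nilpotent ideals is nilpotent. *)
Lemma strongly_nil_common (t : seq Q) : (forall b, b \in t -> strongly_nil A b) ->
  exists J, nil_ideal A J /\ forall b, b \in t -> J b.
Proof.
elim: t => [|b t IH] H; first by have [J [nJ _]] := strongly_nil0; exists J.
have [|J [nJ HJ]] := IH; first by move=> c ct; apply: H; rewrite inE ct orbT.
have [L [nL Lb]] := H b (mem_head _ _).
exists (fun c => exists u v, [/\ L u, J v & c = u + v]); split; first exact: nil_ideal_add.
move=> c; rewrite inE => /orP[/eqP->|ct].
  by exists b, 0; rewrite addr0; split=> //; apply: id_0 nJ.1.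
by exists 0, c; rewrite add0r; split=> //; [apply: id_0 nL.1 | apply: HJ].
Qed.

Lemma strongly_nilMl a b : A a -> strongly_nil A b -> strongly_nil A (a * b).
Proof. by move=> Aa [J [nJ Jb]]; exists J; split=> //; apply: (id_Ml nJ.1). Qed.

Lemma strongly_nilMr a b : strongly_nil A a -> A b -> strongly_nil A (a * b).
Proof. by move=> [J [nJ Jb]] Aa; exists J; split=> //; apply: (id_Mr nJ.1). Qed.

Lemma strongly_nilP b : strongly_nil A b -> exists n, b ^+ n = 0.
Proof. by move=> [J [[_ nJ] Jb]]; apply: nilpotent_set_exp nJ Jb. Qed.

Lemma ideal_exp_sub J a b n : ideal_of A J -> A a -> A b -> J (a - b) -> J (a ^+ n - b ^+ n).
Proof.
move=> iJ Aa Ab Jab; elim: n => [|n IH]; first by rewrite subrr; apply: id_0 iJ.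
have AX : A (b ^+ n) by elim: n {IH} => [|n IH]; rewrite ?exprS; [apply: subr_1 | apply: subr_M].
have -> : a ^+ n.+1 - b ^+ n.+1 = a * (a ^+ n - b ^+ n) + (a - b) * b ^+ n.
  by rewrite !exprS mulrBr mulrBl addrA subrK.
by apply: (id_D iJ); [apply: id_Ml iJ _ _ _ _ | apply: id_Mr iJ _ _ _ _].
Qed.

(** A power of [a] lies in the nilpotent ideal that contains [a - b]. *)
Lemma nilpotent_modulo a b : A a -> A b -> strongly_nil A (a - b) ->
  (exists n, b ^+ n = 0) -> exists n, a ^+ n = 0.
Proof.
move=> Aa Ab [J [[iJ nJ] Jab]] [n bn0].
have : J (a ^+ n) by rewrite -[_ ^+ _]subr0 -bn0; apply: ideal_exp_sub.
by case/(nilpotent_set_exp nJ) => m am0; exists (n * m)%N; rewrite exprM.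
Qed.

(** Nilpotent ideals restrict to smaller subrings; for this reason the induction may
    enlarge the algebra that contains a given nilpotent element. *)
Lemma strongly_nil_sub (A' : Q -> Prop) b : (forall a, A a -> A' a) -> A b ->
  strongly_nil A' b -> strongly_nil A b.
Proof.
move=> AA' Ab [J [[iJ [r Hr]] Jb]]; exists (fun c => A c /\ J c); split=> //.
split; last by exists r => t st Ht; apply: Hr => // c /Ht[].
split.
- by move=> a [].
- by split; [apply: subr_0 | apply: id_0 iJ].
- by move=> c d [Ac Jc] [Ad Jd]; split; [apply: subr_D | apply: (id_D iJ)].
- by move=> c d Ac [Ad Jd]; split; [apply: subr_M | apply: (id_Ml iJ) => //; apply: AA'].
- by move=> c d [Ac Jc] Ad; split; [apply: subr_M | apply: (id_Mr iJ) => //; apply: AA'].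
Qed.

End NilIdeals.

(** * Quantum integers at a root of unity *)
Section QuantumIntegers.
Variable C : comNzRingType.
Implicit Types (rho la : C).

Definition qint rho n := \sum_(i < n) rho ^+ i.

Lemma qintS rho n : qint rho n.+1 = qint rho n + rho ^+ n.
Proof. by rewrite /qint big_ord_recr. Qed.

Lemma qintD rho m n : qint rho (m + n) = qint rho m + rho ^+ m * qint rho n.
Proof.
elim: n => [|n IH]; first by rewrite addn0 /qint big_ord0 mulr0 addr0.
by rewrite addnS !qintS IH exprD mulrDr addrA.
Qed.

Definition qfact rho n := \prod_(i < n) qint rho i.+1.

Lemma qfactS rho n : qfact rho n.+1 = qfact rho n * qint rho n.+1.
Proof. by rewrite /qfact big_ord_recr. Qed.

(** Gaussian binomials weighted by [la ^+ (n - m)], as they come out of moving a power of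
    a variable across an element of weight [la]. *)
Fixpoint qbin la rho n m : C :=
  match n, m with
  | 0, 0 => 1
  | 0, _.+1 => 0
  | n'.+1, 0 => la * qbin la rho n' 0
  | n'.+1, m'.+1 => la * rho ^+ m * qbin la rho n' m + qbin la rho n' m'
  end.

Lemma qbin_gt la rho n m : (n < m)%N -> qbin la rho n m = 0.
Proof.
elim: n m => [|n IH] [|m] //= lt_nm.
by rewrite !IH ?mulr0 ?addr0 //; apply: ltnW.
Qed.

Lemma qbin0 la rho n : qbin la rho n 0 = la ^+ n.
Proof. by elim: n => //= n ->; rewrite exprS. Qed.

Lemma qbinn la rho n : qbin la rho n n = 1.
Proof. by elim: n => //= n ->; rewrite qbin_gt // mulr0 add0r. Qed.

(** The product formula for binomials, without denominators: it is used over a ring in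
    which quantum integers specialise to zero. *)
Lemma qbin_fact la rho n m : (m <= n)%N ->
  qbin la rho n m * qfact rho m * qfact rho (n - m) = la ^+ (n - m) * qfact rho n.
Proof.
elim: n m => [|n IH] [|m] // le_mn.
- by rewrite /qfact /= !big_ord0 !mulr1.
- by rewrite qbin0 subn0 [X in _ * X * _]/qfact big_ord0 mulr1.
rewrite /= subSS; have [lt_mn|] := ltnP m n; last first.
  move=> le_nm; have -> : m = n by lia.
  by rewrite qbin_gt // qbinn mulr0 add0r subnn !mul1r [qfact rho 0]big_ord0 mulr1.
have e1 := IH m.+1 lt_mn; have e2 := IH m (ltnW lt_mn).
have en : (n - m = (n - m.+1).+1)%N by lia.
rewrite en in e2 *; set p := (n - m.+1)%N in en e1 e2 *.
have -> : qfact rho n.+1 = qfact rho n * (qint rho m.+1 + rho ^+ m.+1 * qint rho p.+1).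
  by rewrite qfactS -qintD; congr (_ * qint _ _); rewrite -en; lia.
set A := qbin _ _ _ _ in e1 *; set B := qbin _ _ _ _ in e2 *.
rewrite !(qfactS _ m) !(qfactS _ p) !exprS in e1 e2 *.
move: e1 e2; move: (qfact rho m) (qfact rho p) (qfact rho n) => fm fp fn.
move: (qint rho m.+1) (qint rho p.+1) (rho ^+ m) (la ^+ p) => im ip rm lp e1 e2.
have -> : (la * (rho * rm) * A + B) * (fm * im) * (fp * ip) =
   la * rho * rm * ip * (A * (fm * im) * fp) + im * (B * fm * (fp * ip)) by ring.
rewrite e1 e2; ring.
Qed.

End QuantumIntegers.

(** [h] plays the part of q - eps, a generator of the kernel of the evaluation [ev].  The
    last two fields say that [q] has infinite order, and that [q ^+ l - 1] has a simple
    zero at [eps]. *)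
Record specialised (K : fieldType) (C : comUnitRingType) (q h : C)
    (ev : {rmorphism C -> K}) (eps : K) (l : nat) : Prop := {
  sp_char : [pchar K] =i pred0;
  sp_prim : l.-primitive_root eps;
  sp_unit : q \is a GRing.unit;
  sp_evq : ev q = eps;
  sp_h : ev h = 0;
  sp_ker : forall c, ev c = 0 -> exists d, c = h * d;
  sp_hreg : forall c, h * c = 0 -> c = 0;
  sp_qreg : forall (n : int) c, n != 0 -> (q ^ n - 1) * c = 0 -> c = 0;
  sp_der : exists th, q ^+ l - 1 = h * th /\ ev th = l%:R / eps }.

Section Specialised.
Variables (K : fieldType) (C : comUnitRingType) (q h : C) (ev : {rmorphism C -> K}).
Variables (eps : K) (l : nat).
Hypothesis sp : specialised q h ev eps l.

Let qU := sp_unit sp.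
Let l0 : (0 < l)%N := prim_order_gt0 (sp_prim sp).

Lemma char0_int (d : int) : d != 0 -> d%:~R != 0 :> K.
Proof.
have ch := (pcharf0P K).1 (sp_char sp).
case: d => n dn; first by rewrite -pmulrn ch.
by rewrite NegzE mulrNz oppr_eq0 -pmulrn ch.
Qed.

Lemma eps_neq0 : eps != 0.
Proof.
apply/eqP => e0; have := prim_expr_order (sp_prim sp).
by rewrite e0 expr0n eqn0Ngt l0 => /eqP; rewrite eq_sym oner_eq0.
Qed.

(** The derivative of q^l at [eps], where [eps ^+ l = 1]. *)
Definition dconst : K := l%:R / eps.

Lemma dconst_neq0 : dconst != 0.
Proof.
have ch := (pcharf0P K).1 (sp_char sp).
by rewrite /dconst mulf_neq0 ?invr_eq0 ?eps_neq0 // ch -lt0n.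
Qed.

Lemma ev_qX (d : int) : ev (q ^ d) = eps ^ d.
Proof. by rewrite rmorphXz // (sp_evq sp). Qed.

Lemma eps_expz_eq1 (d : int) : (eps ^ d == 1) = (l %| `|d|)%N.
Proof.
have H n : (eps ^ n%:Z == 1) = (l %| n)%N by rewrite -exprnP (prim_order_dvd (sp_prim sp)).
case: d => n; first by rewrite -H.
by rewrite NegzE -invr_expz invr_eq1 abszN -H.
Qed.

Lemma theta_ex (d : int) :
  exists th, q ^ (l%:Z * d) - 1 = h * th /\ ev th = dconst * d%:~R.
Proof.
have [t1 [e1 ev1]] := sp_der sp.
have evl : eps ^ l%:Z = 1 by rewrite -exprnP prim_expr_order ?(sp_prim sp).
have H n : exists th, q ^ (l%:Z * n%:Z) - 1 = h * th /\ ev th = dconst * n%:R.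
  elim: n => [|n [th [e evt]]].
    by exists 0; rewrite mulr0 expr0z subrr mulr0 rmorph0 mulr0.
  exists (q ^ l%:Z * th + t1); split.
    rewrite mulrDr -e1 (_ : l%:Z * n.+1%:Z = l%:Z + l%:Z * n%:Z); last by lia.
    rewrite exprzDr // mulrCA -e exprnP; ring.
  by rewrite rmorphD rmorphM ev_qX evl mul1r evt ev1 -/dconst -natr1 mulrDr mulr1.
case: d => n; first exact: H.
have [th [e evt]] := H n.+1.
pose Q := q ^ (- (l%:Z * n.+1%:Z)).
have eQ : Q * q ^ (l%:Z * n.+1%:Z) = 1 by rewrite -exprzDr // addNr expr0z.
exists (- (Q * th)); rewrite NegzE mulrN; split.
  have -> : h * - (Q * th) = - (Q * (h * th)) by ring.
  by rewrite -e mulrBr eQ mulr1 opprB.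
have evQ : ev Q = 1 by rewrite ev_qX -mulrN -exprz_exp evl exp1rz.
rewrite rmorphN rmorphM evt evQ mul1r.
by rewrite mulrNz mulrN.
Qed.

Section Sigma.
Variable (sg : int).
Hypotheses (cop : coprime l `|sg|) (l1 : (1 < l)%N).
Let rho := q ^ sg.

Let sg0 : sg != 0.
Proof. by apply/eqP => e; move: cop; rewrite e /coprime gcdn0 => /eqP e1; move: l1; rewrite e1. Qed.

Let rho1 : ev (rho - 1) != 0.
Proof.
rewrite rmorphB rmorph1 ev_qX subr_eq0 eps_expz_eq1; apply/negP => dv.
have : (l %| gcdn l `|sg|)%N by rewrite dvdn_gcd dvdnn.
by rewrite (eqP cop) dvdn1 => /eqP e; move: l1; rewrite e.
Qed.

Let geom n : (rho - 1) * qint rho n = q ^ (sg * n%:Z) - 1.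
Proof. by rewrite -exprz_exp -exprnP subrX1. Qed.

Lemma qint_ev_neq0 n : ~~ (l %| n)%N -> ev (qint rho n) != 0.
Proof.
move=> ndv; have := congr1 ev (geom n).
rewrite rmorphM (rmorphB ev (q ^ (sg * n%:Z))) rmorph1 ev_qX => e; apply/eqP => e0; move: e.
rewrite e0 mulr0 => /esym/eqP; rewrite subr_eq0 eps_expz_eq1 abszM absz_nat.
by rewrite Gauss_dvdr // (negPf ndv).
Qed.

(** The geometric sum [qint rho (l * r)] vanishes at [eps] to the first order only,
    because in characteristic 0 its numerator does. *)
Lemma qint_mult r : (0 < r)%N -> exists g, qint rho (l * r) = h * g /\ ev g != 0.
Proof.
move=> r0; have [th [e evt]] := theta_ex (sg * r%:Z).
have := geom (l * r); rewrite (_ : sg * (l * r)%:Z = l%:Z * (sg * r%:Z)); last by lia.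
rewrite e => e2.
have [|g eg] := sp_ker sp (c := qint rho (l * r)).
  apply/eqP; have /eqP := congr1 ev e2; rewrite !rmorphM (sp_h sp) mul0r mulf_eq0.
  by rewrite (negPf rho1).
exists g; split=> //.
have : (rho - 1) * g = th.
  apply/eqP; rewrite -subr_eq0; apply/eqP; apply: (sp_hreg sp).
  by rewrite mulrBr mulrCA -eg e2 subrr.
move/(congr1 ev); rewrite rmorphM evt => eg2; apply/eqP => eg0; move: eg2.
rewrite eg0 mulr0 => /esym/eqP; rewrite mulf_eq0 (negPf dconst_neq0) /= => /eqP c0.
suff : (sg * r%:Z)%:~R != 0 :> K by rewrite c0 eqxx.
by apply: char0_int; rewrite mulf_neq0 // -lt0n.
Qed.

Lemma qfact_ev_neq0 n : (n < l)%N -> ev (qfact rho n) != 0.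
Proof.
move=> nl; rewrite rmorph_prod; apply/prodf_neq0 => i _; apply: qint_ev_neq0.
by apply/negP => /dvdn_leq -/(_ isT); rewrite leqNgt (leq_ltn_trans (ltn_ord i)).
Qed.

Lemma qfact_ev_eq0 : ev (qfact rho l) = 0.
Proof.
have [g [e _]] := qint_mult (r := 1) isT; rewrite muln1 in e.
by case: l l0 e => // l' _ e; rewrite qfactS e !rmorphM (sp_h sp) mul0r mulr0.
Qed.
End Sigma.

(** The factorial of [l] vanishes at [eps], those of [m] and [l - m] do not. *)
Lemma qbin_dvd (d sg : int) m : coprime l `|sg| -> (0 < m < l)%N ->
  exists b, qbin (q ^ d) (q ^ sg) l m = h * b.
Proof.
move=> cop /andP[m0 ml]; have l1 : (1 < l)%N by apply: leq_ltn_trans m0 ml.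
apply: (sp_ker sp); apply/eqP.
have /(congr1 ev)/eqP := qbin_fact (q ^ d) (q ^ sg) (ltnW ml).
rewrite !rmorphM (qfact_ev_eq0 cop l1) mulr0 !mulf_eq0.
rewrite (negPf (qfact_ev_neq0 cop ml)) orbF.
have lt : (l - m < l)%N by rewrite ltn_subrL m0 l0.
by rewrite (negPf (qfact_ev_neq0 cop lt)) orbF.
Qed.

End Specialised.

(** * Commutation chains *)
Section Chains.
Variables (C : comNzRingType) (R : algType C).

(** [X] commutes with the [m]-th term of the chain up to the next term and to the scalar
    [la * rho ^+ m]: this is how a skew derivation and its iterates behave when they
    q-commute with the automorphism. *)
Lemma chain_expand (la rho : C) (X : R) (a : nat -> R) :
  (forall m, X * a m = (la * rho ^+ m) *: (a m * X) + a m.+1) ->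
  forall n, X ^+ n * a 0%N = \sum_(m < n.+1) qbin la rho n m *: (a m * X ^+ (n - m)).
Proof.
move=> H; elim=> [|n IH]; first by rewrite big_ord1 /= subnn !expr0 mul1r mulr1 scale1r.
rewrite exprS -mulrA IH mulr_sumr.
under eq_bigr => m _ do rewrite -scalerAr mulrA H mulrDl -scalerAl -mulrA -exprS
   -subSn -1?ltnS // scalerDr scalerA mulrC.
rewrite big_split /= [in RHS]big_ord_recl /= [X in X + _ = _]big_ord_recl /= expr0 mulr1 -!addrA.
congr (_ + _).
rewrite [in RHS](eq_bigr (fun i : 'I_n.+1 =>
   (la * rho ^+ i.+1 * qbin la rho n i.+1) *: (a i.+1 * X ^+ (n - i)) +
   qbin la rho n i *: (a i.+1 * X ^+ (n - i)))); last first.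
  by move=> i _; rewrite /= subSS scalerDl.
rewrite big_split /=; congr (_ + _).
rewrite [in RHS]big_ord_recr /= qbin_gt // mulr0 scale0r addr0.
by apply: eq_bigr => i _; rewrite /= subSS.
Qed.
End Chains.

Section ChainComm.
Variables (K : fieldType) (C : comUnitRingType) (q h : C) (ev : {rmorphism C -> K}).
Variables (eps : K) (l : nat).
Hypothesis sp : specialised q h ev eps l.
Variable R : algType C.

(** The two extreme binomials are the only ones that do not vanish modulo [h].  The
    coefficients [th] and [be] depend on the weights only, and not on [X] and [a]. *)
Lemma chain_comm (d sg : int) : coprime l `|sg| ->
  exists (th : C) (be : nat -> C), ev th = dconst eps l * d%:~R /\
  forall (X : R) (a : nat -> R),
    (forall m : nat, X * a m = q ^ (d + sg * m%:Z) *: (a m * X) + a m.+1) ->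
    X ^+ l * a 0%N - a 0%N * X ^+ l =
    h *: (th *: (a 0%N * X ^+ l) + \sum_(1 <= m < l) be m *: (a m * X ^+ (l - m))) + a l.
Proof.
move=> cop; have qU := sp_unit sp.
have [th [eth evth]] := theta_ex sp d.
have /choice[be Hbe] : forall m, exists b, (0 < m < l)%N -> qbin (q ^ d) (q ^ sg) l m = h * b.
  move=> m; have [lm|] := boolP (0 < m < l)%N; last by exists 0.
  by have [b e] := qbin_dvd sp d cop lm; exists b.
exists th, be; split=> // X a Ha.
rewrite (@chain_expand _ _ (q ^ d) (q ^ sg)); last first.
  by move=> m; rewrite Ha exprzDr // -exprz_exp -exprnP.
have l0 : (0 < l)%N := prim_order_gt0 (sp_prim sp).
rewrite -(big_mkord xpredT (fun m => qbin _ _ _ m *: (a m * X ^+ (l - m)))).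
rewrite big_nat_recr //= big_ltn // subn0 qbin0 subnn expr0 mulr1 qbinn scale1r.
rewrite (eq_big_nat _ _ (F2 := fun m => h *: (be m *: (a m * X ^+ (l - m))))); last first.
  by move=> m Hm; rewrite Hbe // scalerA.
rewrite -scaler_sumr scalerDr scalerA -eth [LHS]addrAC; congr (_ + _).
by rewrite scalerBl scale1r exprnP exprz_exp [d * _]mulrC [RHS]addrAC.
Qed.
End ChainComm.

(** * Homogeneous elements and iterated skew derivations *)
Section Homogeneous.
Variables (C : comUnitRingType) (R : unitAlgType C).
Variables (M : nat) (S : 'M[int]_M) (kappa : {set 'I_M}) (x : 'I_M -> R).

(** Homogeneous elements of the subalgebra generated by the [x j] with [lo <= j < hi].
    The degree [v i] tells how an element q-commutes with [x i] for [i < lo]; the other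
    values of [v] are not constrained. *)
Inductive hsub (lo hi : nat) : ('I_M -> int) -> R -> Prop :=
| hs_gen (j : 'I_M) v : (lo <= j)%N -> (j < hi)%N ->
    (forall i : 'I_M, (i < lo)%N -> v i = S i j) -> hsub lo hi v (x j)
| hs_inv (j : 'I_M) v : (lo <= j)%N -> (j < hi)%N -> j \in kappa ->
    (forall i : 'I_M, (i < lo)%N -> v i = - S i j) -> hsub lo hi v (x j)^-1
| hs_sc c v : (forall i : 'I_M, (i < lo)%N -> v i = 0) -> hsub lo hi v c%:A
| hs_add v a b : hsub lo hi v a -> hsub lo hi v b -> hsub lo hi v (a + b)
| hs_mul v w u a b : hsub lo hi v a -> hsub lo hi w b ->
    (forall i : 'I_M, (i < lo)%N -> u i = v i + w i) -> hsub lo hi u (a * b)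
| hs_0 v : hsub lo hi v 0.

Lemma hs_mono lo hi lo' hi' v w a : (lo' <= lo)%N -> (hi <= hi')%N ->
  (forall i : 'I_M, (i < lo')%N -> v i = w i) -> hsub lo hi v a -> hsub lo' hi' w a.
Proof.
move=> ll hh e H; elim: H w e => {v a}.
- move=> j v lj jh Hv w e; apply: hs_gen; [exact: leq_trans lj|exact: leq_trans hh|].
  by move=> i il; rewrite -e // Hv // (leq_trans il).
- move=> j v lj jh kj Hv w e; apply: hs_inv => //; [exact: leq_trans lj|exact: leq_trans hh|].
  by move=> i il; rewrite -e // Hv // (leq_trans il).
- by move=> c v Hv w e; apply: hs_sc => i il; rewrite -e // Hv // (leq_trans il).
- by move=> v a b _ IHa _ IHb w e; apply: hs_add; [apply: IHa | apply: IHb].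
- move=> v w u a b _ IHa _ IHb Hu w' e.
  apply: (hs_mul (IHa _ (fun _ _ => erefl)) (IHb _ (fun _ _ => erefl))) => i il.
  by rewrite -e // Hu // (leq_trans il).
- by move=> v w e; apply: hs_0.
Qed.

Lemma hs_ext lo hi v w a : (forall i : 'I_M, (i < lo)%N -> v i = w i) ->
  hsub lo hi v a -> hsub lo hi w a.
Proof. exact: hs_mono. Qed.

Lemma hs_weak lo hi lo' hi' v a : (lo' <= lo)%N -> (hi <= hi')%N ->
  hsub lo hi v a -> hsub lo' hi' v a.
Proof. by move=> ll hh; apply: hs_mono. Qed.

Lemma hs_scale lo hi v c a : hsub lo hi v a -> hsub lo hi v (c *: a).
Proof.
move=> Ha; rewrite -[c *: a]mul1r -scalerAr scalerAl; apply: (hs_mul (v := fun=> 0) _ Ha).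
  exact: hs_sc.
by move=> i _; rewrite add0r.
Qed.

Lemma hs_opp lo hi v a : hsub lo hi v a -> hsub lo hi v (- a).
Proof. by move=> Ha; rewrite -scaleN1r; apply: hs_scale. Qed.

Lemma hs_1 lo hi v : (forall i : 'I_M, (i < lo)%N -> v i = 0) -> hsub lo hi v 1.
Proof. by move=> e; rewrite -[1]scale1r; apply: hs_sc. Qed.

Lemma hs_exp lo hi v a n : hsub lo hi v a -> hsub lo hi (fun i => v i *+ n) (a ^+ n).
Proof.
move=> Ha; elim: n => [|n IH]; first by apply: hs_1.
by rewrite exprS; apply: hs_mul Ha IH _ => i _; rewrite mulrS.
Qed.

Lemma hs_sum lo hi v (I : eqType) (r : seq I) (F : I -> R) :
  (forall i, i \in r -> hsub lo hi v (F i)) -> hsub lo hi v (\sum_(i <- r) F i).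
Proof.
elim: r => [|i r IH] H; first by rewrite big_nil; apply: hs_0.
rewrite big_cons; apply: hs_add; first by apply: H; rewrite mem_head.
by apply: IH => j jr; apply: H; rewrite inE jr orbT.
Qed.

End Homogeneous.

Section ChainData.
Variables (C : comUnitRingType) (q : C) (l : nat).
Variables (R : unitAlgType C) (M : nat) (S : 'M[int]_M) (kappa : {set 'I_M}) (x : 'I_M -> R).

(** [hc_upper] and [hc_lower] describe the iterates of delta_k at [x j] and of delta'_i at
    [x k].  One application of delta_k adds to the degree that of [x k], and [sg k] along
    [k] itself: this is condition CN1 read on degrees. *)
Record homogeneous_chains (sg sg' : 'I_M -> int) : Prop := {
  hc_skew : forall i j, S i j = - S j i;
  hc_unit : forall j, j \in kappa -> x j \is a GRing.unit;
  hc_gen : forall y, subalg_on kappa x predT y;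
  hc_kappa : forall i j, j \in kappa -> x i * x j = q ^ S i j *: (x j * x i);
  hc_sg0 : forall i, sg i != 0;
  hc_cop : forall i, coprime l `|sg i|;
  hc_cop' : forall i, coprime l `|sg' i|;
  hc_upper : forall k j : 'I_M, (k < j)%N -> exists a : nat -> R,
    [/\ a 0%N = x j,
        forall m : nat, x k * a m = q ^ (S k j + sg k * m%:Z) *: (a m * x k) + a m.+1,
        forall m, (l <= m)%N -> a m = 0
      & forall m : nat, hsub S kappa x k.+1 M
          (fun i => S i j + m%:Z * (S i k + (i == k)%:Z * sg k)) (a m)];
  hc_lower : forall k i : 'I_M, (k < i)%N -> exists b : nat -> R,
    [/\ b 0%N = x k,
        forall m : nat, x i * b m = q ^ (S i k + sg' i * m%:Z) *: (b m * x i) + b m.+1,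
        forall m, (l <= m)%N -> b m = 0
      & forall m, (0 < m)%N -> hsub S kappa x k.+1 M
          (fun a => S a k + m%:Z * S a i + (a == k)%:Z * sg k) (b m)] }.
End ChainData.

Section FromNQS.
Variables (K : fieldType) (C : comUnitRingType) (q h : C) (ev : {rmorphism C -> K}).
Variables (eps : K) (l : nat).
Hypothesis sp : specialised q h ev eps l.
Variables (R : unitAlgType C) (M : nat) (S : 'M[int]_M) (kappa : {set 'I_M}) (x : 'I_M -> R).
Hypothesis nqsR : NQS_algebra q S kappa x.
Variables (tau delta tau' delta' : 'I_M -> R -> R).
Hypothesis skewR : NQS_skew_maps q S kappa x tau delta tau' delta'.
Variables s s' : 'I_M -> int.
Hypothesis cn1 : CN1 q kappa x tau delta tau' delta' s s'.
Variable N_ : 'I_M -> nat.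
Hypothesis nilN : nilpotency_bound x delta delta' N_.
Hypothesis coprime_l : forall i, coprime l `|s i|%N /\ coprime l `|s' i|%N.
Hypothesis leNl : (\max_(a < M) N_ a <= l)%N.

Let qU := sp_unit sp.
Local Notation hs := (hsub S kappa x).
Local Notation up := (upper_gt kappa x).
Local Notation dn := (lower_lt kappa x).

Let Sskew i j : S i j = - S j i.
Proof. by have /matrixP/(_ j i) := nqs_skew nqsR; rewrite !mxE. Qed.
Let Sdiag i : S i i = 0. Proof. by have := Sskew i i; lia. Qed.

Lemma subalg_1 (G : R -> Prop) : subalg G 1.
Proof. by rewrite -[1]scale1r; apply: SubalgC. Qed.
Lemma subalg_0 (G : R -> Prop) : subalg G 0.
Proof. by rewrite -[0](scale0r 1); apply: SubalgC. Qed.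

Lemma hs_subalg (T : pred 'I_M) lo hi v a : (forall j : 'I_M, (lo <= j)%N -> (j < hi)%N -> T j) ->
  hs lo hi v a -> subalg_on kappa x T a.
Proof.
move=> HT; elim=> {v a}.
- by move=> j v lj jh _; apply: SubalgGen; exists j; [apply: HT | left].
- by move=> j v lj jh kj _; apply: SubalgGen; exists j; [apply: HT | right].
- by move=> c v _; apply: SubalgC.
- by move=> v a b _ Ha _ Hb; apply: SubalgD.
- by move=> v w u a b _ Ha _ Hb _; apply: SubalgM.
- by move=> v; apply: subalg_0.
Qed.

Lemma hs_upper (i : 'I_M) lo hi v a : (i < lo)%N -> hs lo hi v a -> up i a.
Proof. by move=> il; apply: hs_subalg => j lj _; apply: leq_trans lj. Qed.

Lemma hs_lower (i : 'I_M) lo v a : hs lo i v a -> dn i a.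
Proof. exact: hs_subalg. Qed.

Lemma lin_0 (A : R -> Prop) (f : R -> R) :
  (forall c a b, A a -> A b -> f (c *: a + b) = c *: f a + f b) -> A 0 -> f 0 = 0.
Proof.
move=> lf A0; have := lf (-1) 0 0 A0 A0; rewrite scaler0 addr0 => e.
by rewrite e scaleN1r addNr.
Qed.

Section Maps.
Variables (A : R -> Prop) (f d : R -> R).
Hypotheses (af : automorphism_on A f) (sd : skew_derivation_on A f d).
Hypotheses (A1 : A 1) (A0 : A 0).

Lemma aut0 : f 0 = 0. Proof. exact: lin_0 (aut_linear af) A0. Qed.
Lemma autZ c a : A a -> f (c *: a) = c *: f a.
Proof. by move=> Aa; rewrite -[c *: a]addr0 (aut_linear af) // aut0 addr0. Qed.
Lemma autD a b : A a -> A b -> f (a + b) = f a + f b.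
Proof. by move=> Aa Ab; rewrite -[a in LHS]scale1r (aut_linear af) // scale1r. Qed.
Lemma skd0 : d 0 = 0. Proof. exact: lin_0 (skd_linear sd) A0. Qed.
Lemma skdZ c a : A a -> d (c *: a) = c *: d a.
Proof. by move=> Aa; rewrite -[c *: a]addr0 (skd_linear sd) // skd0 addr0. Qed.
Lemma skdD a b : A a -> A b -> d (a + b) = d a + d b.
Proof. by move=> Aa Ab; rewrite -[a in LHS]scale1r (skd_linear sd) // scale1r. Qed.
Lemma skd1 : d 1 = 0.
Proof.
have := skd_mul sd A1 A1; rewrite !mulr1 (aut_one af) mul1r => /eqP.
by rewrite -[X in X == _]addr0 (inj_eq (addrI _)) eq_sym => /eqP.
Qed.
Lemma aut_inv a : A a -> A a^-1 -> a \is a GRing.unit -> f a \is a GRing.unit /\ f a^-1 = (f a)^-1.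
Proof.
move=> Aa Ai ua; have e1 : f a * f a^-1 = 1 by rewrite -(aut_mul af) // divrr // (aut_one af).
have e2 : f a^-1 * f a = 1 by rewrite -(aut_mul af) // mulVr // (aut_one af).
have ufa : f a \is a GRing.unit by apply/unitrP; exists (f a^-1).
by split=> //; apply: (mulrI ufa); rewrite e1 divrr.
Qed.
Lemma skd_inv a : A a -> A a^-1 -> a \is a GRing.unit -> d a = 0 -> d a^-1 = 0.
Proof.
move=> Aa Ai ua da0; have [ufa _] := aut_inv Aa Ai ua.
have := skd_mul sd Aa Ai; rewrite divrr // skd1 da0 mul0r add0r => e.
by apply: (mulrI ufa); rewrite -e mulr0.
Qed.

(** The Leibniz rule propagates a common shift [w] of the degree from the generators. *)
Lemma skd_hs lo hi (w : 'I_M -> int) :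
  (forall v a, hs lo hi v a -> A a /\ hs lo hi v (f a)) ->
  (forall j : 'I_M, (lo <= j)%N -> (j < hi)%N ->
     hs lo hi (fun b => S b j + w b) (d (x j)) /\ (j \in kappa -> d (x j) = 0)) ->
  forall v a, hs lo hi v a -> hs lo hi (fun b => v b + w b) (d a).
Proof.
move=> Hf Hx v a; elim=> {v a}.
- move=> j v lj jh Hv; have [H _] := Hx j lj jh.
  by apply: hs_ext H => b bl; rewrite Hv.
- move=> j v lj jh kj Hv; have [_ /(_ kj) dx] := Hx j lj jh.
  have Hj : hs lo hi (fun b => S b j) (x j) by apply: hs_gen.
  have Hi : hs lo hi (fun b => - S b j) (x j)^-1 by apply: hs_inv.
  have [[Aj _] [Ai _]] := (Hf _ _ Hj, Hf _ _ Hi).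
  by rewrite skd_inv ?(nqs_unit nqsR) //; apply: hs_0.
- by move=> c v _; rewrite skdZ // skd1 scaler0; apply: hs_0.
- move=> v a b /Hf[Aa _] Da /Hf[Ab _] Db; rewrite skdD //; exact: hs_add.
- move=> v w' u a b Ha Da Hb Db Hu; have [Aa fa] := Hf _ _ Ha; have [Ab _] := Hf _ _ Hb.
  rewrite (skd_mul sd) //; apply: hs_add.
    by apply: hs_mul Da Hb _ => c ci; rewrite Hu //; ring.
  by apply: hs_mul fa Db _ => c ci; rewrite Hu //; ring.
- by move=> v; rewrite skd0; apply: hs_0.
Qed.
End Maps.

Let afu i := skew_aut (nqs_upper skewR i).
Let sdu i := skew_der (nqs_upper skewR i).
Let afl i := skew_aut (nqs_lower skewR i).
Let sdl i := skew_der (nqs_lower skewR i).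

Lemma tau_hs (i : 'I_M) lo hi v a : (i < lo)%N -> hs lo hi v a ->
  tau i a = q ^ v i *: a.
Proof.
move=> il; elim=> {v a}.
- by move=> j v lj _ Hv; rewrite (nqs_tau skewR) ?(leq_trans il) // Hv.
- move=> j v lj jh kj Hv; have ij := leq_trans il lj.
  have uj := nqs_unit nqsR kj.
  have Aj : up i (x j) by apply: SubalgGen; exists j => //; left.
  have Ai : up i (x j)^-1 by apply: SubalgGen; exists j => //; right.
  have [_ ->] := aut_inv (afu i) Aj Ai uj.
  rewrite (nqs_tau skewR) // /qcoef invrZ ?unitrXz // Hv // -invr_expz //.
- by move=> c v Hv; rewrite (autZ (afu i) (subalg_0 _)) ?(aut_one (afu i)) ?Hv ?expr0z ?scale1r //; apply: subalg_1.
- move=> v a b Ha ea Hb eb; rewrite (autD (afu i)) ?ea ?eb ?scalerDr //.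
  + exact: hs_upper Ha.
  + exact: hs_upper Hb.
- move=> v w u a b Ha ea Hb eb Hu; rewrite (aut_mul (afu i)) ?ea ?eb.
  + by rewrite -scalerAl -scalerAr scalerA -exprzDr // Hu.
  + exact: hs_upper Ha.
  + exact: hs_upper Hb.
- by move=> v; rewrite (aut0 (afu i) (subalg_0 _)) scaler0.
Qed.

Lemma hs_prod lo hi (r : seq 'I_M) (F : 'I_M -> R) (v : 'I_M -> 'I_M -> int) :
  (forall b, hs lo hi (v b) (F b)) ->
  hs lo hi (fun a => \sum_(b <- r) v b a) (\prod_(b <- r) F b).
Proof.
move=> H; elim: r => [|b r IH].
  by rewrite big_nil; apply: hs_1 => i _; rewrite big_nil.
by rewrite big_cons; apply: hs_mul (H b) IH _ => i _; rewrite big_cons.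
Qed.

Lemma monomial_hs (i j : 'I_M) t : admissible kappa t ->
  (forall k : 'I_M, t k != 0 -> (i < k < j)%N) ->
  hs i.+1 j (fun a => \sum_b S a b * t b) (monomial x t).
Proof.
move=> adm supp; apply: hs_prod => b.
have [t0|/supp/andP[ib bj]] := eqVneq (t b) 0.
  by rewrite t0 expr0z; apply: hs_1 => a _; rewrite mulr0.
have gen n : hs i.+1 j (fun a => S a b * n%:Z) (x b ^+ n).
  apply: (hs_ext (v := fun a => S a b *+ n)); first by move=> a _; rewrite -mulr_natr natz.
  by apply: hs_exp; apply: hs_gen.
case: (t b) (adm b) => n Hn; first exact: gen.
have kb : b \in kappa by apply: contraT => /Hn; rewrite NegzE.
rewrite NegzE -invr_expz -exprnP -exprVn.
apply: (hs_ext (v := fun a => (- S a b) *+ n.+1)).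
  by move=> a _; rewrite -mulr_natr natz mulrN mulNr.
by apply: hs_exp; apply: hs_inv.
Qed.

(* If [s i = 0] then delta_i vanishes, and any nonzero exponent prime to [l] will do. *)
Let sg i := if s i == 0 then 1 else s i.
Let rem_deg (i j : 'I_M) a := S a i + S a j + (a == i)%:Z * sg i.

Let up_x (i j : 'I_M) : (i < j)%N -> up i (x j).
Proof. by move=> ij; apply: SubalgGen; exists j; [|left]. Qed.

Lemma delta_x (i j : 'I_M) : (i < j)%N -> delta i (x j) = remainder q S x i j.
Proof. exact: nqs_delta skewR i j. Qed.

(** For [a < i] this is the weight of [x i * x j]; for [a = i] it is condition CN1. *)
Lemma tau_remainder (i j a : 'I_M) : (i < j)%N -> (a <= i)%N ->
  remainder q S x i j != 0 ->
  tau a (remainder q S x i j) = q ^ rem_deg i j a *: remainder q S x i j.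
Proof.
move=> ij ai r0; rewrite /rem_deg; have [->|neq_ai] := eqVneq a i.
  have [c1 c2] := (cn1 i).1; rewrite -delta_x // c1; last exact: up_x.
  rewrite (nqs_tau skewR) // (skdZ (sdu i) (subalg_0 _)); last exact: up_x.
  rewrite scalerA /qcoef -exprzDr // Sdiag add0r mul1r addrC /sg.
  by rewrite (negPf (c2 _)) //; exists (x j); [apply: up_x | rewrite delta_x].
have lt_ai : (a < i)%N by rewrite ltn_neqAle neq_ai ai.
rewrite (tau_hs (lo := i) (hi := M) (v := fun b => S b i + S b j)) ?mul0r ?addr0 //.
have gi : hs i M (fun b => S b i) (x i) by apply: hs_gen.
have gj : hs i M (fun b => S b j) (x j) by apply: hs_gen => //; apply: ltnW.
apply: hs_add; first by apply: hs_mul gi gj _.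
by apply: hs_opp; apply: hs_scale; apply: hs_mul gj gi _ => b _; rewrite addrC.
Qed.

(** tau_a is diagonal on monomials and [q] has infinite order, so freeness of the monomials
    forces all those of the remainder to have the weight of [tau_remainder]. *)
Lemma remainder_hs (i j : 'I_M) : (i < j)%N ->
  hs i.+1 j (rem_deg i j) (remainder q S x i j).
Proof.
move=> ij; have [->|r0] := eqVneq (remainder q S x i j) 0; first exact: hs_0.
have [t [f [Ht er]]] := nqs_rem nqsR ij.
pose f' u := f u *+ count_mem u t.
have eu : remainder q S x i j = \sum_(u <- undup t) f' u *: monomial x u.
  rewrite er -big_undup_iterop_count /=; apply: eq_bigr => u _.
  by rewrite /f' -scalerMnl Monoid.iteropE /= -Monoid.iteropE.
have hm u : u \in undup t -> hs i.+1 j (fun a => \sum_b S a b * u b) (monomial x u).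
  by rewrite mem_undup => /Ht[adm supp]; apply: monomial_hs.
rewrite eu; apply: hs_sum => u ut.
have [->|fu0] := eqVneq (f' u) 0; first by rewrite scale0r; apply: hs_0.
apply: hs_scale; apply: (hs_ext _ (hm u ut)) => a ai; apply/eqP; apply: contraNT fu0 => ne.
set d := rem_deg i j a in ne *.
suff H : (q ^ (\sum_b S a b * u b - d) - 1) * f' u = 0.
  by apply/eqP; apply: (sp_qreg sp _ H); rewrite subr_eq0.
have H : (q ^ (\sum_b S a b * u b) - q ^ d) * f' u = 0.
  apply: (nqs_free nqsR (s := undup t)
     (c := fun u => (q ^ (\sum_b S a b * u b) - q ^ d) * f' u)) => //.
  - exact: undup_uniq.
  - by move=> w; rewrite mem_undup => /Ht[].
  (* compare the two sides of [tau_remainder], expanding tau_a term by term *)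
  have := tau_remainder ij ai r0; rewrite -/d {2}eu eu => e.
  have -> : \sum_(w <- undup t) ((q ^ (\sum_b S a b * w b) - q ^ d) * f' w) *: monomial x w
     = tau a (\sum_(w <- undup t) f' w *: monomial x w) - q ^ d *: (\sum_(w <- undup t) f' w *: monomial x w).
    rewrite scaler_sumr (_ : tau a _ = \sum_(w <- undup t) (q ^ (\sum_b S a b * w b) * f' w) *: monomial x w).
      by rewrite -sumrB; apply: eq_bigr => w _; rewrite scalerA -scalerBl -mulrBl.
    elim: (undup t) hm => [|w r IH] hmr; first by rewrite !big_nil (aut0 (afu a) (subalg_0 _)).
    have hr v : v \in r -> up a (f' v *: monomial x v).
      move=> vr; apply: (hs_upper (lo := i.+1) (hi := j)) => //.
      by apply: hs_scale; apply: hmr; rewrite inE vr orbT.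
    have uw : hs i.+1 j (fun a => \sum_b S a b * w b) (monomial x w).
      by apply: hmr; rewrite mem_head.
    rewrite !big_cons (autD (afu a)).
    + rewrite IH; last by move=> v vr; apply: hmr; rewrite inE vr orbT.
      rewrite (autZ (afu a) (subalg_0 _)); last by apply: hs_upper uw.
      by rewrite (tau_hs _ uw) // scalerA mulrC.
    + apply: (hs_upper (lo := i.+1)); last by apply: hs_scale; apply: uw.
      by [].
    + elim: (r) hr => [|v r' IH'] hr; first by rewrite big_nil; apply: subalg_0.
      rewrite big_cons; apply: SubalgD; first by apply: hr; rewrite mem_head.
      by apply: IH' => v' vr; apply: hr; rewrite inE vr orbT.
  by rewrite e subrr.
have -> : q ^ (\sum_b S a b * u b - d) - 1 = q ^ (- d) * (q ^ (\sum_b S a b * u b) - q ^ d).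
  by rewrite mulrBr -!exprzDr // addNr expr0z [- d + _]addrC.
by rewrite -mulrA H mulr0.
Qed.

Lemma delta_hs (i : 'I_M) hi v a : hs i.+1 hi v a ->
  hs i.+1 hi (fun b => v b + (S b i + (b == i)%:Z * sg i)) (delta i a).
Proof.
apply: (skd_hs (afu i) (sdu i) (subalg_1 _) (subalg_0 _)) => [{}v {}a Ha|j ij jh].
  by rewrite (tau_hs _ Ha) //; split; [apply: hs_upper Ha | apply: hs_scale].
rewrite delta_x //; split=> [|kj]; last by rewrite /remainder (nqs_kappa nqsR) // subrr.
apply: (hs_ext (v := rem_deg i j)); last by apply: hs_weak (remainder_hs ij) => //; apply: ltnW.
by move=> b bi; rewrite /rem_deg; ring.
Qed.

Lemma iter_delta0 (d : R -> R) n N a : d 0 = 0 -> (N <= n)%N -> iter N d a = 0 -> iter n d a = 0.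
Proof.
move=> d0 Nn e; rewrite -(subnK Nn) iterD e.
by elim: (n - N)%N => //= m ->.
Qed.

Lemma N_le i : (N_ i <= l)%N.
Proof. by apply: leq_trans leNl; apply: leq_bigmax. Qed.

Lemma upper_chain (k j : 'I_M) : (k < j)%N -> exists a : nat -> R,
    [/\ a 0%N = x j,
        forall m : nat, x k * a m = q ^ (S k j + sg k * m%:Z) *: (a m * x k) + a m.+1,
        forall m, (l <= m)%N -> a m = 0
      & forall m : nat, hs k.+1 M
          (fun i => S i j + m%:Z * (S i k + (i == k)%:Z * sg k)) (a m)].
Proof.
move=> kj; exists (fun m => iter m (delta k) (x j)).
have H m : hs k.+1 M (fun i => S i j + m%:Z * (S i k + (i == k)%:Z * sg k))
     (iter m (delta k) (x j)).
  elim: m => [|m IH] /=; first by apply: hs_gen => // i _; rewrite mul0r addr0.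
  by apply: (hs_ext _ (delta_hs IH)) => i _; rewrite intS; ring.
split=> // m.
- rewrite (skew_comm (nqs_upper skewR k)); last by apply: (hs_upper _ (H m)).
  rewrite (tau_hs _ (H m)) // -scalerAl /=; congr (q ^ _ *: _ + _).
  by rewrite eqxx Sdiag add0r mul1r [m%:Z * _]mulrC.
- move=> lm; apply: (@iter_delta0 _ _ (N_ k)); first exact: (skd0 (sdu k) (subalg_0 _)).
    by apply: leq_trans lm; apply: N_le.
  by have [_ ->] := nilN k.
Qed.

Lemma tau'_hs (i : 'I_M) lo v a : hs lo i v a -> hs lo i v (tau' i a).
Proof.
elim=> {v a}.
- by move=> j v lj ji Hv; rewrite (nqs_tau' skewR) //; apply: hs_scale; apply: hs_gen.
- move=> j v lj ji kj Hv; have uj := nqs_unit nqsR kj.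
  have Aj : dn i (x j) by apply: SubalgGen; exists j => //; left.
  have Ai : dn i (x j)^-1 by apply: SubalgGen; exists j => //; right.
  have [_ ->] := aut_inv (afl i) Aj Ai uj.
  rewrite (nqs_tau' skewR) // /qcoef invrZ ?unitrXz //.
  by apply: hs_scale; apply: hs_inv.
- move=> c v Hv; rewrite (autZ (afl i) (subalg_0 _)) ?(aut_one (afl i)); last exact: subalg_1.
  exact: hs_sc.
- move=> v a b Ha ea Hb eb; rewrite (autD (afl i)) ?ea ?eb; first exact: hs_add.
  + exact: hs_lower Ha.
  + exact: hs_lower Hb.
- move=> v w u a b Ha ea Hb eb Hu; rewrite (aut_mul (afl i)); first by apply: hs_mul ea eb Hu.
  + exact: hs_lower Ha.
  + exact: hs_lower Hb.
- by move=> v; rewrite (aut0 (afl i) (subalg_0 _)); apply: hs_0.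
Qed.

Let dn_x (i j : 'I_M) : (j < i)%N -> dn i (x j).
Proof. by move=> ij; apply: SubalgGen; exists j; [|left]. Qed.

Lemma delta'_x (i j : 'I_M) : (j < i)%N ->
  delta' i (x j) = - q ^ S i j *: remainder q S x j i.
Proof.
move=> ji; have := skew_comm (nqs_lower skewR i) (dn_x ji).
rewrite (nqs_tau' skewR) // -scalerAl => e.
rewrite /remainder /qcoef in e *; rewrite scalerBr scalerA mulNr -exprzDr // e.
by rewrite (Sskew j i) subrr expr0z scaleN1r opprK !scaleNr addrA addNr add0r.
Qed.

Lemma delta'_hs (i : 'I_M) lo v a : (lo <= i)%N -> hs lo i v a ->
  hs lo i (fun b => v b + S b i) (delta' i a).
Proof.
move=> li; apply: (skd_hs (afl i) (sdl i) (subalg_1 _) (subalg_0 _)) => [{}v {}a Ha|j lj ji].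
  by split; [apply: hs_lower Ha | apply: tau'_hs].
rewrite delta'_x //; split=> [|kj]; last first.
  rewrite /remainder /qcoef (nqs_kappa nqsR i) // scalerA -exprzDr //.
  by rewrite (Sskew j i) addNr expr0z scale1r subrr scaler0.
apply: hs_scale; apply: (hs_ext (v := rem_deg j i)); last first.
  by apply: hs_weak (remainder_hs ji) => //; apply: leqW.
move=> b bl; rewrite /rem_deg (_ : (b == j) = false) ?mul0r ?addr0 //.
by apply/eqP => e; move: lj; rewrite -e leqNgt bl.
Qed.

Lemma lower_chain (k i : 'I_M) : (k < i)%N -> exists b : nat -> R,
    [/\ b 0%N = x k,
        forall m : nat, x i * b m = q ^ (S i k + s' i * m%:Z) *: (b m * x i) + b m.+1,
        forall m, (l <= m)%N -> b m = 0
      & forall m, (0 < m)%N -> hs k.+1 M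
          (fun a => S a k + m%:Z * S a i + (a == k)%:Z * sg k) (b m)].
Proof.
move=> ki; exists (fun m => iter m (delta' i) (x k)).
have H m : hs k.+1 i (fun a => S a k + m.+1%:Z * S a i + (a == k)%:Z * sg k)
     (iter m.+1 (delta' i) (x k)).
  elim: m => [|m IH].
    rewrite /= delta'_x //; apply: hs_scale; apply: hs_ext (remainder_hs ki).
    by move=> a _; rewrite /rem_deg mul1r.
  by apply: (hs_ext _ (delta'_hs ki IH)) => a _; rewrite intS; ring.
have dk m : dn i (iter m (delta' i) (x k)).
  by case: m => [|m]; [apply: dn_x | apply: hs_lower (H m)].
split=> //.
- move=> m; rewrite (skew_comm (nqs_lower skewR i)) // /=; congr (_ + _).
  rewrite scalerAl; congr (_ * _).
  elim: m => [|m IH]; first by rewrite mulr0 addr0 (nqs_tau' skewR).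
  have [c1 _] := (cn1 i).2; rewrite /= c1 // IH (skdZ (sdl i) (subalg_0 _)) //.
  by rewrite scalerA -exprzDr //; congr (q ^ _ *: _); rewrite intS; ring.
- move=> m lm; apply: (@iter_delta0 _ _ (N_ i)); first exact: (skd0 (sdl i) (subalg_0 _)).
    by apply: leq_trans lm; apply: N_le.
  by have [_ _ ->] := nilN i.
- by case=> // m _; apply: hs_weak (H m) => //; apply: ltnW.
Qed.

Theorem nqs_chains : homogeneous_chains q l S kappa x sg s'.
Proof.
split=> //.
- exact: (nqs_unit nqsR).
- exact: (nqs_gen nqsR).
- exact: (nqs_kappa nqsR).
- by move=> i; rewrite /sg; have [|] := eqVneq (s i) 0.
- move=> i; have [c _] := coprime_l i; rewrite /sg; case: eqP => // _; exact: coprimen1.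
- by move=> i; have [_ c] := coprime_l i.
- exact: upper_chain.
- exact: lower_chain.
Qed.

End FromNQS.

(** * Filtrations by eigenvectors of a derivation *)
Section Filtration.
Variables (K : fieldType) (Q : algType K) (M : nat).
Hypothesis char0 : forall d : int, d != 0 -> d%:~R != 0 :> K.
Local Notation deg := ('I_M -> int).

Record derivation (D : Q -> Q) : Prop := {
  der_D : forall a b, D (a + b) = D a + D b;
  der_Z : forall c a, D (c *: a) = c *: D a;
  der_M : forall a b, D (a * b) = D a * b + a * D b }.

Lemma der_0 D : derivation D -> D 0 = 0.
Proof. by move=> dD; have := der_Z dD 0 0; rewrite !scale0r. Qed.
Lemma der_1 D : derivation D -> D 1 = 0.
Proof.
move=> dD; have := der_M dD 1 1; rewrite !mulr1 mul1r => e.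
by apply: (addrI (D 1)); rewrite addr0 -e.
Qed.
Lemma der_sc D c : derivation D -> D c%:A = 0.
Proof. by move=> dD; rewrite (der_Z dD) der_1 // scaler0. Qed.
Lemma der_N D a : derivation D -> D (- a) = - D a.
Proof. by move=> dD; rewrite -scaleN1r (der_Z dD) scaleN1r. Qed.
Lemma der_B D a b : derivation D -> D (a - b) = D a - D b.
Proof. by move=> dD; rewrite (der_D dD) der_N. Qed.
Lemma der_inv D a b : derivation D -> a * b = 1 -> b * a = 1 -> D b = - (b * D a * b).
Proof.
move=> dD ab ba; have := congr1 (fun c => b * D c) ab; rewrite /= der_1 // mulr0 (der_M dD).
rewrite mulrDr !mulrA ba mul1r => e; apply/eqP; rewrite -addr_eq0 addrC; exact/eqP.
Qed.
Lemma der_central D c : derivation D -> central c -> central (D c).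
Proof.
move=> dD Cc a; have := congr1 D (Cc a); rewrite !(der_M dD) Cc [RHS]addrC.
exact: addIr.
Qed.

Lemma der_comb D D' c : derivation D -> derivation D' ->
  derivation (fun b => D b + c *: D' b).
Proof.
move=> dD dD'; split=> [a b|k a|a b].
- by rewrite (der_D dD) (der_D dD') scalerDr addrACA.
- by rewrite (der_Z dD) (der_Z dD') scalerDr !scalerA [c * k]mulrC.
- rewrite (der_M dD) (der_M dD') mulrDl mulrDr scalerDr -scalerAl -scalerAr.
  by rewrite addrACA.
Qed.

Lemma der_bracket D D' : derivation D -> derivation D' ->
  derivation (fun b => D (D' b) - D' (D b)).
Proof.
move=> dD dD'; split=> [a b|k a|a b].
- by rewrite !(der_D dD, der_D dD') opprD addrACA.
- by rewrite !(der_Z dD, der_Z dD') scalerBr.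
- rewrite (der_M dD') (der_M dD) !(der_D dD, der_D dD', der_M dD, der_M dD').
  set u := D' a * D b; set v := D a * D' b; set p := D (D' a) * b; set r := a * D (D' b).
  rewrite mulrBl mulrBr -/p -/r; move: (D' (D a) * b) (a * D' (D b)) => p' r'.
  rewrite [v + r]addrC (addrACA p) [u + r']addrC (addrACA p') [v + u]addrC.
  by rewrite opprD [LHS]addrACA subrr addr0 opprD addrACA.
Qed.

Variables (E : Q -> Q) (dE : derivation E) (P : pred 'I_M).

(** Graded families of eigenvectors: [d] is the eigenvalue, and [v] stands for the degrees
    with respect to gradings indexed by [P]. *)
Record eigen_family (X : deg -> int -> Q -> Prop) : Prop := {
  fam_E : forall v d b, X v d b -> E b = d%:~R *: b;
  fam_ext : forall v w d b, (forall i, P i -> v i = w i) -> X v d b -> X w d b;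
  fam_0 : forall v d, X v d 0;
  fam_D : forall v d a b, X v d a -> X v d b -> X v d (a + b);
  fam_Z : forall v d c b, X v d b -> X v d (c *: b);
  fam_M : forall v d w e a b, X v d a -> X w e b ->
    X (fun i => v i + w i) (d + e) (a * b) }.

Section OneFamily.
Variables (X : deg -> int -> Q -> Prop) (fX : eigen_family X) (sg : int).

(** Sums of [n] eigenvectors for the eigenvalues [d], [d + sg], ..., [d + sg * (n - 1)].
    The length is recorded because the projection onto the first one is a polynomial of
    degree [n] in [E]. *)
Fixpoint eigensum n v d b : Prop :=
  match n with
  | 0 => b = 0
  | n'.+1 => exists b0 b1, [/\ b = b0 + b1, X v d b0 & eigensum n' v (d + sg) b1]
  end.

Definition filt v d b := exists n, eigensum n v d b.

Lemma eigensum_ext n v w d b : (forall i, P i -> v i = w i) -> eigensum n v d b -> eigensum n w d b.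
Proof.
move=> e; elim: n d b => //= n IH d b [b0 [b1 [-> X0 H]]].
by exists b0, b1; split=> //; [apply: fam_ext X0 | apply: IH].
Qed.

Lemma eigensum_0 n v d : eigensum n v d 0.
Proof.
by elim: n d => //= n IH d; exists 0, 0; rewrite addr0; split=> //; apply: fam_0.
Qed.

Lemma eigensum_S n v d b : eigensum n v d b -> eigensum n.+1 v d b.
Proof.
elim: n d b => [|n IH] d b; first by move=> ->; apply: eigensum_0.
by case=> b0 [b1 [-> X0 H]]; exists b0, b1; split=> //; apply: IH.
Qed.

Lemma eigensum_le n m v d b : (n <= m)%N -> eigensum n v d b -> eigensum m v d b.
Proof. by move=> /subnK <-; elim: (m - n)%N => //= p IH H; apply: eigensum_S; apply: IH. Qed.

Lemma eigensum_D n v d a b : eigensum n v d a -> eigensum n v d b -> eigensum n v d (a + b).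
Proof.
elim: n d a b => [|n IH] d a b /=; first by move=> -> ->; rewrite addr0.
move=> [a0 [a1 [-> Xa Ha]]] [b0 [b1 [-> Xb Hb]]]; exists (a0 + b0), (a1 + b1).
by split; [rewrite addrACA | apply: fam_D | apply: IH].
Qed.

Lemma eigensum_Z n v d c b : eigensum n v d b -> eigensum n v d (c *: b).
Proof.
elim: n d b => [|n IH] d b /=; first by move=> ->; rewrite scaler0.
move=> [b0 [b1 [-> Xb Hb]]]; exists (c *: b0), (c *: b1).
by split; [rewrite scalerDr | apply: fam_Z | apply: IH].
Qed.

Lemma eigensum_shift n v d b : eigensum n v (d + sg) b -> eigensum n.+1 v d b.
Proof. by move=> H; exists 0, b; rewrite add0r; split=> //; apply: fam_0. Qed.

Lemma eigensum_one v d b : X v d b -> eigensum 1 v d b.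
Proof. by move=> H; exists b, 0; rewrite addr0. Qed.

Lemma eigensum_Ml n v d w e a b : X v d a -> eigensum n w e b ->
  eigensum n (fun i => v i + w i) (d + e) (a * b).
Proof.
move=> Xa; elim: n e b => [|n IH] e b /=; first by move=> ->; rewrite mulr0.
move=> [b0 [b1 [-> Xb Hb]]]; exists (a * b0), (a * b1).
by split; [rewrite mulrDr | apply: fam_M | rewrite -addrA; apply: IH].
Qed.

Lemma eigensum_Mr n v d w e a b : eigensum n v d a -> X w e b ->
  eigensum n (fun i => v i + w i) (d + e) (a * b).
Proof.
move=> + Xb; elim: n d a => [|n IH] d a /=; first by move=> ->; rewrite mul0r.
move=> [a0 [a1 [-> Xa Ha]]]; exists (a0 * b), (a1 * b).
by split; [rewrite mulrDl | apply: fam_M | rewrite addrAC; apply: IH].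
Qed.

Lemma filt_ext v w d b : (forall i, P i -> v i = w i) -> filt v d b -> filt w d b.
Proof. by move=> e [n H]; exists n; apply: eigensum_ext H. Qed.
Lemma filt_0 v d : filt v d 0. Proof. by exists 0%N. Qed.
Lemma filt_X v d b : X v d b -> filt v d b.
Proof. by move=> H; exists 1%N; apply: eigensum_one. Qed.
Lemma filt_D v d a b : filt v d a -> filt v d b -> filt v d (a + b).
Proof.
move=> [n Hn] [m Hm]; exists (maxn n m); apply: eigensum_D.
  by apply: eigensum_le Hn; apply: leq_maxl.
by apply: eigensum_le Hm; apply: leq_maxr.
Qed.
Lemma filt_Z v d c b : filt v d b -> filt v d (c *: b).
Proof. by move=> [n H]; exists n; apply: eigensum_Z. Qed.
Lemma filt_N v d b : filt v d b -> filt v d (- b).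
Proof. by move=> H; rewrite -scaleN1r; apply: filt_Z. Qed.
Lemma filt_B v d a b : filt v d a -> filt v d b -> filt v d (a - b).
Proof. by move=> Ha Hb; apply: filt_D => //; apply: filt_N. Qed.
Lemma filt_shift v d b : filt v (d + sg) b -> filt v d b.
Proof. by move=> [n H]; exists n.+1; apply: eigensum_shift. Qed.
Lemma filt_shiftn (n : nat) v d b : filt v (d + sg * n%:Z) b -> filt v d b.
Proof.
elim: n => [|n IH]; first by rewrite mulr0 addr0.
move=> H; apply/IH/filt_shift; rewrite (_ : d + _ + _ = d + sg * n.+1%:Z) //.
by rewrite intS; ring.
Qed.
Lemma filt_sum v d (I : eqType) (r : seq I) (F : I -> Q) :
  (forall i, i \in r -> filt v d (F i)) -> filt v d (\sum_(i <- r) F i).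
Proof.
elim: r => [|i r IH] H; first by rewrite big_nil; apply: filt_0.
rewrite big_cons; apply: filt_D; first by apply: H; rewrite mem_head.
by apply: IH => j jr; apply: H; rewrite inE jr orbT.
Qed.
Lemma filt_M v d w e a b : filt v d a -> filt w e b ->
  filt (fun i => v i + w i) (d + e) (a * b).
Proof.
move=> [n Hn] [m Hm]; elim: n d a Hn => [|n IH] d a; first by move=> /= ->; rewrite mul0r; apply: filt_0.
move=> [a0 [a1 [-> X0 H1]]]; rewrite mulrDl; apply: filt_D; first by exists m; apply: eigensum_Ml.
by apply: filt_shift; rewrite addrAC; apply: IH.
Qed.
Lemma filt_split v d b : filt v d b -> exists b0 b1, [/\ b = b0 + b1, X v d b0 & filt v (d + sg) b1].
Proof.
case=> [[|n]]; first by move=> /= ->; exists 0, 0; rewrite addr0; split=> //; [apply: fam_0 | apply: filt_0].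
by case=> b0 [b1 [-> X0 H]]; exists b0, b1; split=> //; exists n.
Qed.

Lemma filt_ind (Y : Q -> Prop) v d b : Y 0 -> (forall a b, Y a -> Y b -> Y (a + b)) ->
  (forall (n : nat) c, X v (d + sg * n%:Z) c -> Y c) -> filt v d b -> Y b.
Proof.
move=> Y0 YD YX [n]; rewrite (_ : d = d + sg * 0%N%:Z); last by rewrite mulr0 addr0.
elim: n 0%N b => [|n IH] m b; first by move=> /= ->.
move=> [b0 [b1 [-> X0 H]]]; apply: YD; first exact: YX X0.
apply: (IH m.+1); rewrite (_ : d + _ = d + sg * m%:Z + sg) //.
by rewrite intS; ring.
Qed.

Lemma eigensum_Esub n v e b (mu : K) : eigensum n v e b -> eigensum n v e (E b - mu *: b).
Proof.
elim: n e b => [|n IH] e b /=; first by move=> ->; rewrite (der_0 dE) scaler0 subr0.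
move=> [b0 [b1 [-> X0 H]]]; exists (E b0 - mu *: b0), (E b1 - mu *: b1); split.
- by rewrite (der_D dE) scalerDr opprD addrACA.
- by rewrite (fam_E fX X0) -scalerBl; apply: fam_Z.
- exact: IH.
Qed.

(** Eigenvectors for distinct eigenvalues are independent. *)
Lemma eigensum_eigen0 n v e b (d : int) : eigensum n v e b ->
  (forall m, (m < n)%N -> d != e + sg * m%:Z) -> E b = d%:~R *: b -> b = 0.
Proof.
elim: n e b => [|n IH] e b; first by [].
move=> [b0 [b1 [eb X0 H1]]] dn Eb.
have de : d - e != 0 by rewrite subr_eq0; have := dn 0%N isT; rewrite mulr0 addr0.
suff : (d - e)%:~R *: b = 0.
  by move/eqP; rewrite scaler_eq0 (negPf (char0 de)) => /eqP.
apply: (IH (e + sg)).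
- have -> : (d - e)%:~R *: b = E b1 - e%:~R *: b1.
    rewrite rmorphB /= scalerBl -Eb eb (der_D dE) (fam_E fX X0) scalerDr opprD addrACA.
    by rewrite subrr add0r.
  exact: eigensum_Esub.
- move=> m mn; have := dn m.+1 mn; rewrite intS mulrDr mulr1 addrA //.
- by rewrite (der_Z dE) Eb !scalerA mulrC.
Qed.

Hypothesis sg0 : sg != 0.

Lemma filt_eigen0 v d b : filt v (d + sg) b -> E b = d%:~R *: b -> b = 0.
Proof.
move=> [n Hn]; apply: (eigensum_eigen0 Hn) => m _.
rewrite -addrA -{1}[d]addr0 (inj_eq (addrI _)) eq_sym -{1}[sg]mulr1 -mulrDr mulf_neq0 //.
Qed.

Lemma filt_lowest v d a b b' : X v d b -> X v d b' -> filt v (d + sg) (a - b) ->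
  filt v (d + sg) (a - b') -> b = b'.
Proof.
move=> Xb Xb' H H'; apply/eqP; rewrite -subr_eq0; apply/eqP.
apply: (@filt_eigen0 v d).
  have -> : b - b' = (a - b') - (a - b) by rewrite opprB [RHS]addrC addrA subrK.
  exact: filt_B.
by rewrite (der_B _ _ dE) (fam_E fX Xb) (fam_E fX Xb') scalerBr.
Qed.

(** [E - d] acts on each component by a nonzero scalar. *)
Lemma eigensum_solve n v e c (d : int) : eigensum n v e c ->
  (forall m, (m < n)%N -> d != e + sg * m%:Z) ->
  exists b, eigensum n v e b /\ E b - d%:~R *: b = c.
Proof.
elim: n e c => [|n IH] e c.
  by move=> /= -> _; exists 0; rewrite (der_0 dE) scaler0 subrr.
move=> [c0 [c1 [-> X0 H1]]] dn.
have de : e - d != 0 by rewrite subr_eq0 eq_sym; have := dn 0%N isT; rewrite mulr0 addr0.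
have [|b1 [Hb1 eb1]] := IH _ _ H1.
  by move=> m mn; have := dn m.+1 mn; rewrite intS mulrDr mulr1 addrA.
exists ((e - d)%:~R^-1 *: c0 + b1); split.
  by exists ((e - d)%:~R^-1 *: c0), b1; split=> //; apply: fam_Z.
rewrite (der_D dE) scalerDr opprD addrACA eb1; congr (_ + _).
rewrite (der_Z dE) (fam_E fX X0) !scalerA -scalerBl mulrC -mulrBl.
by rewrite -rmorphB /= mulfV ?char0 // scale1r.
Qed.

Lemma filt_solve v d c : filt v (d + sg) c ->
  exists b, filt v (d + sg) b /\ E b - d%:~R *: b = c.
Proof.
move=> [n Hn]; have [|b [Hb e]] := @eigensum_solve n v (d + sg) c d Hn.
  move=> m _.
  rewrite -addrA -{1}[d]addr0 (inj_eq (addrI _)) eq_sym -{1}[sg]mulr1 -mulrDr mulf_neq0 //.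
by exists b; split=> //; exists n.
Qed.

(** ** Projection onto the lowest eigenvector *)

(** [proj n 1 d] is the product of the operators 1 - (E - d) / (sg * lo) for [1 <= lo <= n]: it
    fixes the eigenvectors for [d] and kills those for [d + sg * lo].  Being a polynomial in
    the derivation [E], it preserves central elements. *)
Definition pstep (lo : nat) (d : int) b : Q :=
  b - (sg * lo%:Z)%:~R^-1 *: (E b - d%:~R *: b).
Fixpoint proj n lo d b : Q :=
  match n with 0 => b | n'.+1 => proj n' lo.+1 d (pstep lo d b) end.

Lemma pstepD lo d a b : pstep lo d (a + b) = pstep lo d a + pstep lo d b.
Proof.
rewrite /pstep (der_D dE) [d%:~R *: _]scalerDr opprD addrACA scalerDr opprD addrACA //.
Qed.
Lemma projD n lo d a b : proj n lo d (a + b) = proj n lo d a + proj n lo d b.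
Proof. by elim: n lo a b => //= n IH lo a b; rewrite pstepD IH. Qed.
Lemma proj0 n lo d : proj n lo d 0 = 0.
Proof.
elim: n lo => //= n IH lo.
by rewrite /pstep (der_0 dE) scaler0 subrr scaler0 subr0 IH.
Qed.

Lemma pstep_eigen lo d e b : E b = e%:~R *: b ->
  pstep lo d b = (1 - (sg * lo%:Z)%:~R^-1 * (e - d)%:~R) *: b.
Proof. by move=> Eb; rewrite /pstep Eb -scalerBl scalerA scalerBl scale1r rmorphB. Qed.

Lemma proj_eigen n lo d b : E b = d%:~R *: b -> proj n lo d b = b.
Proof.
move=> Eb; elim: n lo => //= n IH lo.
by rewrite (pstep_eigen _ _ Eb) subrr mulr0 subr0 scale1r IH.
Qed.

Lemma eigensum_pstep n v e lo d b : eigensum n v e b -> eigensum n v e (pstep lo d b).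
Proof.
by move=> H; apply: eigensum_D => //; rewrite -scaleNr; apply: eigensum_Z; apply: eigensum_Esub.
Qed.

Lemma proj_eigensum0 n v lo d b : (0 < lo)%N -> eigensum n v (d + sg * lo%:Z) b -> proj n lo d b = 0.
Proof.
elim: n lo b => [|n IH] lo b lo0; first by [].
move=> [b0 [b1 [-> X0 H1]]] /=; rewrite pstepD projD.
rewrite (pstep_eigen _ _ (fam_E fX X0)) [d + _]addrC addrK mulVf; last first.
  by apply: char0; rewrite mulf_neq0 // -lt0n.
rewrite subrr scale0r proj0 add0r; apply: IH => //.
by apply: eigensum_pstep; rewrite intS mulrDr mulr1 [sg + _]addrC addrA.
Qed.

Lemma proj_lowest n v d b c : eigensum n.+1 v d b -> X v d c -> filt v (d + sg) (b - c) ->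
  proj n 1 d b = c.
Proof.
move=> [b0 [b1 [eb X0 H1]]] Xc Hc.
have <- : b0 = c.
  apply: (@filt_lowest v d b) => //; first by rewrite eb [b0 + _]addrC addrK; exists n.
rewrite eb projD (proj_eigen _ _ (fam_E fX X0)) (@proj_eigensum0 n v) ?addr0 ?mulr1 //.
Qed.

Lemma proj_central n lo d c : central c -> central (proj n lo d c).
Proof.
elim: n lo c => //= n IH lo c Cc; apply: IH => a.
have CE := der_central dE Cc.
by rewrite /pstep mulrBl mulrBr -scalerAl -scalerAr mulrBl mulrBr -scalerAl -scalerAr CE Cc.
Qed.

End OneFamily.

Lemma filt_sub (X Y : deg -> int -> Q -> Prop) sg v d b :
  (forall v d b, X v d b -> Y v d b) -> filt X sg v d b -> filt Y sg v d b.
Proof.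
move=> XY [n H]; exists n; elim: n d b H => //= n IH d b [b0 [b1 [-> X0 H]]].
by exists b0, b1; split=> //; [apply: XY | apply: IH].
Qed.

(** The same projection for the adjoint action of [E], which preserves derivations. *)
Section DerProj.
Variable sg : int.

Definition dstep (lo : nat) (d : int) (D : Q -> Q) : Q -> Q := fun b =>
  D b + (- (sg * lo%:Z)%:~R^-1) *: ((E (D b) - D (E b)) + (- d%:~R) *: D b).
Fixpoint dproj n lo d D : Q -> Q :=
  match n with 0 => D | n'.+1 => dproj n' lo.+1 d (dstep lo d D) end.

Lemma dproj_der n lo d D : derivation D -> derivation (dproj n lo d D).
Proof.
elim: n lo D => //= n IH lo D dD; apply: IH; apply: der_comb => //.
by apply: der_comb => //; apply: der_bracket.
Qed.

Lemma dproj_eigen n lo d D (e : int) b : derivation D -> E b = e%:~R *: b ->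
  dproj n lo d D b = proj sg n lo (e + d) (D b).
Proof.
move=> dD Eb; elim: n lo D dD => //= n IH lo D dD; rewrite IH; last first.
  apply: der_comb => //; by apply: der_comb => //; apply: der_bracket.
congr (proj _ _ _ _ _); rewrite /dstep /pstep Eb (der_Z dD) scaleNr; congr (_ - _ *: _).
by rewrite scaleNr -addrA -opprD -scalerDl -rmorphD.
Qed.
End DerProj.
End Filtration.

(** * Specialised commutators *)
Section Commutators.
Variables (K : fieldType) (C : comUnitRingType) (q h : C) (ev : {rmorphism C -> K}).
Variables (eps : K) (l : nat).
Hypothesis sp : specialised q h ev eps l.
Variables (R : unitAlgType C) (M : nat) (S : 'M[int]_M) (kappa : {set 'I_M}) (x : 'I_M -> R).
Variables sg sg' : 'I_M -> int.
Hypothesis hc : homogeneous_chains q l S kappa x sg sg'.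

Local Notation hs := (hsub S kappa x).
Let l0 : (0 < l)%N := prim_order_gt0 (sp_prim sp).

Lemma S_diag i : S i i = 0. Proof. by have := hc_skew hc i i; lia. Qed.

Lemma hsx lo (j : 'I_M) n : (lo <= j)%N -> hs lo M (fun a => n%:Z * S a j) (x j ^+ n).
Proof.
move=> lj; apply: (hs_ext (v := fun a => S a j *+ n)).
  by move=> a _; rewrite -mulr_natr natz mulrC.
by apply: hs_exp; apply: hs_gen.
Qed.

(** The leading coefficient [th] and the degree along [k] of the rest are needed to follow
    the action of D_i on a deleted variable ([D_xk_eq]). *)
Lemma comm_lower (k i : 'I_M) : (k < i)%N -> exists th w,
  [/\ ev th = dconst eps l * (S i k)%:~R,
      hs k.+1 M (fun a => S a k + l%:Z * S a i + (a == k)%:Z * sg k) w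
    & x i ^+ l * x k - x k * x i ^+ l = h *: (th *: (x k * x i ^+ l) + w)].
Proof.
move=> ki; have [b [b0 Hb bl Hh]] := hc_lower hc ki.
have [th [be [evth H]]] := chain_comm sp R (S i k) (hc_cop' hc i).
exists th, (\sum_(1 <= m < l) be m *: (b m * x i ^+ (l - m))); split=> //.
  apply: hs_sum => m; rewrite mem_index_iota => /andP[m1 ml]; apply: hs_scale.
  apply: hs_mul (Hh m m1) (hsx (l - m) ki) _ => a _ /=.
  have -> : (l - m)%:Z = l%:Z - m%:Z by lia.
  by ring.
by have := H _ _ Hb; rewrite (bl l) // addr0 b0.
Qed.

(** By [chain_comm] the commutators of [x i ^+ l] with the generators are divisible by [h],
    and the quotient is homogeneous. *)
Lemma comm_exists lo v a (i : 'I_M) : (lo <= i)%N -> hs lo M v a ->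
  exists w, hs lo M (fun b => v b + l%:Z * S b i) w /\
    x i ^+ l * a - a * x i ^+ l = h *: w.
Proof.
move=> li; set X := x i ^+ l.
have gen (j : 'I_M) : (lo <= j)%N -> exists w, hs lo M (fun b => S b j + l%:Z * S b i) w /\
    X * x j - x j * X = h *: w.
  move=> lj; have [ij|ji|eij] := ltngtP i j.
  - have [a' [a0 Ha al Hh]] := hc_upper hc ij.
    have [th [be [evth H]]] := chain_comm sp R (S i j) (hc_cop hc i).
    exists (th *: (x j * X) + \sum_(1 <= m < l) be m *: (a' m * x i ^+ (l - m))); split.
      apply: hs_add.
        by apply: hs_scale; apply: hs_mul (hs_gen _ _ _ _ _) (hsx l li) _.
      apply: hs_sum => m; rewrite mem_index_iota => /andP[m1 ml]; apply: hs_scale.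
      have H1 : hs lo M (fun b => S b j + m%:Z * S b i) (a' m).
        apply: (hs_ext (v := fun b => S b j + m%:Z * (S b i + (b == i)%:Z * sg i))).
          move=> b bl; rewrite (_ : (b == i) = false) ?mul0r ?addr0 //.
          by apply/eqP => e; move: li; rewrite -e leqNgt bl.
        by apply: hs_weak (Hh m) => //; apply: leqW.
      apply: hs_mul H1 (hsx (l - m) li) _ => b _ /=.
      have -> : (l - m)%:Z = l%:Z - m%:Z by lia.
      by ring.
    by have := H _ _ Ha; rewrite (al l) // addr0 a0.
  - have [th [w [_ Hw e]]] := comm_lower ji.
    exists (th *: (x j * X) + w); split=> //; apply: hs_add.
      by apply: hs_scale; apply: hs_mul (hs_gen _ _ _ _ _) (hsx l li) _.
    apply: (hs_ext (v := fun a => S a j + l%:Z * S a i + (a == j)%:Z * sg j)).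
      move=> b bl; rewrite (_ : (b == j) = false) ?mul0r ?addr0 //.
      by apply/eqP => eb; move: lj; rewrite -eb leqNgt bl.
    by apply: hs_weak Hw => //; apply: leqW.
  - exists 0; split; first exact: hs_0.
    by rewrite (_ : j = i) ?scaler0 /X -?exprSr -?exprS ?subrr //; apply/val_inj.
elim=> {v a}.
- move=> j v lj jM Hv; have [w [Hw e]] := gen j lj; exists w; split=> //.
  by apply: hs_ext Hw => b bl; rewrite Hv.
- move=> j v lj jM kj Hv; have [w [Hw e]] := gen j lj.
  have uj := hc_unit hc kj.
  have ij : hs lo M (fun b => - S b j) (x j)^-1 by apply: hs_inv.
  exists (- ((x j)^-1 * w * (x j)^-1)); split.
    apply: hs_opp; apply: hs_mul (hs_mul ij Hw (fun _ _ => erefl)) ij _ => b bl.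
    by rewrite Hv //; ring.
  rewrite scalerN scalerAl scalerAr -e mulrBr mulrBl !mulrA mulVr // mul1r opprB.
  by rewrite -!mulrA mulrV // mulr1.
- move=> c v _; exists 0; split; first exact: hs_0.
  by rewrite -scalerAl -scalerAr mulr1 mul1r subrr scaler0.
- move=> v a b _ [w [Hw e]] _ [w' [Hw' e']]; exists (w + w'); split; first exact: hs_add.
  by rewrite mulrDr mulrDl opprD addrACA e e' scalerDr.
- move=> v v' u a b Ha [w [Hw e]] Hb [w' [Hw' e']] Hu; exists (w * b + a * w'); split.
    apply: hs_add.
      by apply: hs_mul Hw Hb _ => c cl; rewrite Hu //; ring.
    by apply: hs_mul Ha Hw' _ => c cl; rewrite Hu //; ring.
  by rewrite scalerDr scalerAl scalerAr -e -e' mulrBl mulrBr !mulrA addrA subrK.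
- by move=> v; exists 0; rewrite mulr0 mul0r subrr scaler0; split=> //; apply: hs_0.
Qed.

(** ** Graph of a specialisation *)
Section Graph.
Variables (Q : algType K) (X : 'I_M -> Q).

(** The specialisation sending [x j] to [X j] is a relation: that the [X j] satisfy the
    relations of the [x j] has to be proved again after each deletion, in the form of
    [st_fun] below. *)
Inductive graph (k : nat) : ('I_M -> int) -> R -> Q -> Prop :=
| gr_gen (j : 'I_M) v : (k <= j)%N ->
    (forall i : 'I_M, (i < k)%N -> v i = S i j) -> graph k v (x j) (X j)
| gr_inv (j : 'I_M) v b : (k <= j)%N -> j \in kappa ->
    (forall i : 'I_M, (i < k)%N -> v i = - S i j) ->
    X j * b = 1 -> b * X j = 1 -> graph k v (x j)^-1 b
| gr_sc c v : (forall i : 'I_M, (i < k)%N -> v i = 0) -> graph k v c%:A (ev c)%:A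
| gr_add v a b a' b' : graph k v a b -> graph k v a' b' -> graph k v (a + a') (b + b')
| gr_mul v w u a b a' b' : graph k v a b -> graph k w a' b' ->
    (forall i : 'I_M, (i < k)%N -> u i = v i + w i) -> graph k u (a * a') (b * b')
| gr_0 v : graph k v 0 0.

Lemma gr_mono k k' v w a b : (k' <= k)%N -> (forall i : 'I_M, (i < k')%N -> v i = w i) ->
  graph k v a b -> graph k' w a b.
Proof.
move=> kk e H; elim: H w e => {v a b}.
- move=> j v kj Hv w e; apply: gr_gen; first exact: leq_trans kj.
  by move=> i ik; rewrite -e // Hv // (leq_trans ik).
- move=> j v b kj kj' Hv e1 e2 w e; apply: gr_inv => //; first exact: leq_trans kj.
  by move=> i ik; rewrite -e // Hv // (leq_trans ik).
- by move=> c v Hv w e; apply: gr_sc => i ik; rewrite -e // Hv // (leq_trans ik).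
- by move=> v a b a' b' _ IH _ IH' w e; apply: gr_add; [apply: IH|apply: IH'].
- move=> v w u a b a' b' _ IH _ IH' Hu w' e.
  apply: (gr_mul (IH _ (fun _ _ => erefl)) (IH' _ (fun _ _ => erefl))) => i ik.
  by rewrite -e // Hu // (leq_trans ik).
- by move=> v w e; apply: gr_0.
Qed.

Lemma gr_ext k v w a b : (forall i : 'I_M, (i < k)%N -> v i = w i) ->
  graph k v a b -> graph k w a b.
Proof. exact: gr_mono. Qed.

Lemma gr_weak k k' v a b : (k' <= k)%N -> graph k v a b -> graph k' v a b.
Proof. by move=> kk; apply: gr_mono. Qed.

Lemma gr_scale k v c a b : graph k v a b -> graph k v (c *: a) (ev c *: b).
Proof.
move=> H; rewrite -[c *: a]mul1r -[_ *: b]mul1r -!scalerAr !scalerAl.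
by apply: (gr_mul (v := fun=> 0) _ H) => [|i _]; [apply: gr_sc | rewrite add0r].
Qed.

Lemma gr_opp k v a b : graph k v a b -> graph k v (- a) (- b).
Proof.
by move=> H; have := gr_scale (-1) H; rewrite rmorphN rmorph1 !scaleN1r.
Qed.
Lemma gr_sub k v a b a' b' : graph k v a b -> graph k v a' b' -> graph k v (a - a') (b - b').
Proof. by move=> H H'; apply: gr_add => //; apply: gr_opp. Qed.

Lemma gr_1 k v : (forall i : 'I_M, (i < k)%N -> v i = 0) -> graph k v 1 1.
Proof. by move=> e; have := gr_sc 1 e; rewrite rmorph1 !scale1r. Qed.

Lemma gr_exp k v a b n : graph k v a b -> graph k (fun i => n%:Z * v i) (a ^+ n) (b ^+ n).
Proof.
move=> H; elim: n => [|n IH]; first by apply: gr_1 => i _; rewrite mul0r.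
by rewrite !exprS; apply: gr_mul H IH _ => i _; rewrite intS; ring.
Qed.

Lemma gr_sum k v (r : seq nat) (F : nat -> R) (F' : nat -> Q) :
  (forall i, i \in r -> graph k v (F i) (F' i)) ->
  graph k v (\sum_(i <- r) F i) (\sum_(i <- r) F' i).
Proof.
elim: r => [|i r IH] H; first by rewrite !big_nil; apply: gr_0.
rewrite !big_cons; apply: gr_add; first by apply: H; rewrite mem_head.
by apply: IH => j jr; apply: H; rewrite inE jr orbT.
Qed.

Lemma gr_total k v a : (forall j : 'I_M, (k <= j)%N -> j \in kappa -> exists b, X j * b = 1 /\ b * X j = 1) ->
  hs k M v a -> exists b, graph k v a b.
Proof.
move=> U; elim=> {v a}.
- by move=> j v kj _ Hv; exists (X j); apply: gr_gen.
- by move=> j v kj _ kk Hv; have [b [e1 e2]] := U j kj kk; exists b; apply: gr_inv.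
- by move=> c v Hv; exists (ev c)%:A; apply: gr_sc.
- by move=> v a b _ [c Hc] _ [d Hd]; exists (c + d); apply: gr_add.
- by move=> v w u a b _ [c Hc] _ [d Hd] Hu; exists (c * d); apply: gr_mul Hc Hd Hu.
- by move=> v; exists 0; apply: gr_0.
Qed.

Lemma gr_hs k v a b : graph k v a b -> hs k M v a.
Proof.
elim=> {v a b}.
- by move=> j v kj Hv; apply: hs_gen.
- by move=> j v b kj kk Hv _ _; apply: hs_inv.
- by move=> c v Hv; apply: hs_sc.
- by move=> v a b a' b' _ H _ H'; apply: hs_add.
- by move=> v w u a b a' b' _ H _ H' Hu; apply: hs_mul H H' Hu.
- by move=> v; apply: hs_0.
Qed.

End Graph.

(** ** Stages of the deletion procedure *)
Variable Q : algType K.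

(** [st_fun] says that [graph] is a partial function, and [st_DG] that [D i] is the commutator
    with [x i ^+ l] divided by [h].  The constant in [st_Dy] is the specialisation of
    (q^(l * S i j) - 1) / h. *)
Record stage (k : nat) (P : pred 'I_M) (X : 'I_M -> Q) (D : 'I_M -> Q -> Q)
    (y yi : 'I_M -> Q) (E : 'I_M -> Q -> Q) : Prop := {
  st_P : forall i, P i -> (i < k)%N;
  st_unit : forall j : 'I_M, (k <= j)%N -> j \in kappa -> exists b, X j * b = 1 /\ b * X j = 1;
  st_fun : forall v b, graph X k v 0 b -> b = 0;
  st_central : forall j : 'I_M, (k <= j)%N -> central (X j ^+ l);
  st_derD : forall i : 'I_M, (k <= i)%N -> derivation (D i);
  st_DG : forall (i : 'I_M) v u a b w c, (k <= i)%N -> graph X k v a b -> graph X k u w c ->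
     (forall j : 'I_M, (j < k)%N -> u j = v j + l%:Z * S j i) ->
     x i ^+ l * a - a * x i ^+ l = h *: w -> D i b = c;
  st_yK : forall i, P i -> y i * yi i = 1 /\ yi i * y i = 1;
  st_yy : forall i j, P i -> P j -> y i * y j = eps ^ S i j *: (y j * y i);
  st_yX : forall i (j : 'I_M), P i -> (k <= j)%N -> y i * X j = eps ^ S i j *: (X j * y i);
  st_derE : forall i, P i -> derivation (E i);
  st_Ey : forall i j, P i -> P j -> E i (y j) = (S i j)%:~R *: y j;
  st_EX : forall i (j : 'I_M), P i -> (k <= j)%N -> E i (X j) = (S i j)%:~R *: X j;
  st_Dy : forall i j : 'I_M, (k <= i)%N -> P j ->
     D i (y j) = (dconst eps l * (S i j)%:~R) *: (X i ^+ l * y j) }.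

(** Graded algebra of a stage; only the degrees indexed by [T] are recorded. *)
Inductive galg (T : pred 'I_M) (k : nat) (P : pred 'I_M) (X y yi : 'I_M -> Q) :
   ('I_M -> int) -> Q -> Prop :=
| ga_X (j : 'I_M) v : (k <= j)%N -> (forall i, T i -> v i = S i j) -> galg T k P X y yi v (X j)
| ga_Xi (j : 'I_M) v b : (k <= j)%N -> j \in kappa -> (forall i, T i -> v i = - S i j) ->
    X j * b = 1 -> b * X j = 1 -> galg T k P X y yi v b
| ga_y j v : P j -> (forall i, T i -> v i = S i j) -> galg T k P X y yi v (y j)
| ga_yi j v : P j -> (forall i, T i -> v i = - S i j) -> galg T k P X y yi v (yi j)
| ga_sc c v : (forall i, T i -> v i = 0) -> galg T k P X y yi v c%:A
| ga_add v a b : galg T k P X y yi v a -> galg T k P X y yi v b -> galg T k P X y yi v (a + b)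
| ga_mul v w u a b : galg T k P X y yi v a -> galg T k P X y yi w b ->
    (forall i, T i -> u i = v i + w i) -> galg T k P X y yi u (a * b)
| ga_0 v : galg T k P X y yi v 0.

Arguments ga_Xi {T k P X y yi j v b}.

Definition alg k P X y yi := galg pred0 k P X y yi (fun=> 0).

Lemma ga_mono (T T' : pred 'I_M) k P X y yi v w b : (forall i, T' i -> T i) ->
  (forall i, T' i -> v i = w i) -> galg T k P X y yi v b -> galg T' k P X y yi w b.
Proof.
move=> TT e H; elim: H w e => {v b}.
- by move=> j v kj Hv w e; apply: ga_X => // i Ti; rewrite -e // Hv // TT.
- by move=> j v b kj kk Hv e1 e2 w e; apply: (ga_Xi kj kk _ e1 e2) => i Ti; rewrite -e // Hv // TT.
- by move=> j v Pj Hv w e; apply: ga_y => // i Ti; rewrite -e // Hv // TT.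
- by move=> j v Pj Hv w e; apply: ga_yi => // i Ti; rewrite -e // Hv // TT.
- by move=> c v Hv w e; apply: ga_sc => i Ti; rewrite -e // Hv // TT.
- by move=> v a b _ IH _ IH' w e; apply: ga_add; [apply: IH|apply: IH'].
- move=> v w u a b _ IH _ IH' Hu w' e.
  apply: (ga_mul (IH _ (fun _ _ => erefl)) (IH' _ (fun _ _ => erefl))) => i Ti.
  by rewrite -e // Hu // TT.
- by move=> v w e; apply: ga_0.
Qed.

Section Galg.
Variables (T : pred 'I_M) (k : nat) (P : pred 'I_M) (X y yi : 'I_M -> Q).
Local Notation ga := (galg T k P X y yi).

Lemma ga_ext v w b : (forall i, T i -> v i = w i) -> ga v b -> ga w b.
Proof. exact: ga_mono. Qed.

Lemma ga_scale v c b : ga v b -> ga v (c *: b).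
Proof.
move=> H; rewrite -[c *: b]mul1r -scalerAr scalerAl.
by apply: (ga_mul (v := fun=> 0) _ H) => [|i _]; [apply: ga_sc | rewrite add0r].
Qed.

Lemma ga_opp v b : ga v b -> ga v (- b).
Proof. by move=> H; rewrite -scaleN1r; apply: ga_scale. Qed.

Lemma ga_1 v : (forall i, T i -> v i = 0) -> ga v 1.
Proof. by move=> e; rewrite -[1]scale1r; apply: ga_sc. Qed.

Lemma ga_sub v a b : ga v a -> ga v b -> ga v (a - b).
Proof. by move=> Ha Hb; apply: ga_add => //; apply: ga_opp. Qed.

Lemma ga_exp v b n : ga v b -> ga (fun i => n%:Z * v i) (b ^+ n).
Proof.
move=> H; elim: n => [|n IH]; first by apply: ga_1 => i _; rewrite mul0r.
by rewrite !exprS; apply: ga_mul H IH _ => i _; rewrite intS; ring.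
Qed.

Lemma ga_graph v a b : (forall i : 'I_M, T i -> (i < k)%N) -> graph X k v a b -> ga v b.
Proof.
move=> Tk; elim=> {v a b}.
- by move=> j v kj Hv; apply: ga_X => // i /Tk; apply: Hv.
- by move=> j v b kj kk Hv e1 e2; apply: (ga_Xi kj kk _ e1 e2) => i /Tk; apply: Hv.
- by move=> c v Hv; apply: ga_sc => i /Tk; apply: Hv.
- by move=> *; apply: ga_add.
- by move=> v w u a b a' b' _ H _ H' Hu; apply: ga_mul H H' _ => i /Tk; apply: Hu.
- by move=> v; apply: ga_0.
Qed.

End Galg.

Lemma ga_alg T k P X y yi v b : galg T k P X y yi v b -> alg k P X y yi b.
Proof. exact: ga_mono. Qed.

Lemma alg_subring k P X y yi : subring (alg k P X y yi).
Proof.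
split; first by apply: ga_1.
- by move=> a b; apply: ga_sub.
- by move=> a b Ha Hb; apply: ga_mul Ha Hb _.
Qed.

(** Without homogeneity this would fail already for quantum tori, which can specialise to
    matrix algebras. *)
Definition nil_prop (k : nat) := forall P X D y yi E, stage k P X D y yi E ->
  forall v b, galg P k P X y yi v b -> (exists n, b ^+ n = 0) ->
  strongly_nil (alg k P X y yi) b.

Lemma eps_expD (a b : int) : eps ^ (a + b) = eps ^ a * eps ^ b.
Proof. by rewrite expfzDr // (eps_neq0 sp). Qed.

(** A degree is measured infinitesimally by a derivation, and multiplicatively by
    commutation with an element: the latter only sees it modulo [l], and the former
    does not give commutation relations. *)
Definition weight (F : Q -> Q) (u : Q) (d : int) (b : Q) :=
  F b = d%:~R *: b /\ u * b = eps ^ d *: (b * u).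

Section Weight.
Variables (F : Q -> Q) (u : Q).
Hypothesis dF : derivation F.
Local Notation wt := (weight F u).

Lemma weight_sc c : wt 0 c%:A.
Proof. by split; rewrite ?(der_sc _ dF) ?scale0r // -scalerAr -scalerAl mulr1 mul1r scale1r. Qed.
Lemma weight_0 d : wt d 0.
Proof. by split; rewrite ?(der_0 dF) ?mulr0 ?mul0r scaler0. Qed.
Lemma weight_D d a b : wt d a -> wt d b -> wt d (a + b).
Proof. by move=> [a1 a2] [b1 b2]; split; rewrite ?(der_D dF) ?mulrDr ?mulrDl ?a1 ?b1 ?a2 ?b2 scalerDr. Qed.
Lemma weight_Z d c b : wt d b -> wt d (c *: b).
Proof.
move=> [b1 b2]; split; first by rewrite (der_Z dF) b1 !scalerA mulrC.
by rewrite -scalerAr b2 -scalerAl !scalerA mulrC.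
Qed.
Lemma weight_B d a b : wt d a -> wt d b -> wt d (a - b).
Proof. by move=> Ha Hb; rewrite -[- b]scaleN1r; apply: weight_D => //; apply: weight_Z. Qed.
Lemma weight_M d e a b : wt d a -> wt e b -> wt (d + e) (a * b).
Proof.
move=> [a1 a2] [b1 b2]; split.
  by rewrite (der_M dF) a1 b1 -scalerAl -scalerAr -scalerDl rmorphD.
by rewrite mulrA a2 -scalerAl -(mulrA a u) b2 -(scalerAr _ a) scalerA -eps_expD !mulrA.
Qed.
Lemma weight_inv d a b : wt d a -> a * b = 1 -> b * a = 1 -> wt (- d) b.
Proof.
move=> [a1 a2] ab ba; split.
  by rewrite (der_inv dF ab ba) a1 -scalerAr ba -scalerAl mul1r rmorphN scaleNr.
have -> : b * u = eps ^ d *: (u * b).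
  have -> : u * b = b * (a * u) * b by rewrite mulrA ba mul1r.
  by rewrite scalerAl scalerAr -a2 -!mulrA ab mulr1.
by rewrite scalerA -eps_expD addNr expr0z scale1r.
Qed.
End Weight.

Section StageFacts.
Variables (k : nat) (P : pred 'I_M) (X : 'I_M -> Q) (D : 'I_M -> Q -> Q)
    (y yi : 'I_M -> Q) (E : 'I_M -> Q -> Q).
Hypothesis st : stage k P X D y yi E.

(** Both [E i] and the commutation with [y i] measure the degree along [i]. *)
Lemma galg_degree v b i : P i -> galg P k P X y yi v b -> weight (E i) (y i) (v i) b.
Proof.
move=> Pi; have dE := st_derE st Pi.
elim=> {v b}.
- by move=> j v kj Hv; rewrite Hv //; split; [apply: (st_EX st) | apply: (st_yX st)].
- move=> j v b kj kk Hv e1 e2; rewrite Hv //; apply: (weight_inv dE _ e1 e2).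
  by split; [apply: (st_EX st) | apply: (st_yX st)].
- by move=> j v Pj Hv; rewrite Hv //; split; [apply: (st_Ey st) | apply: (st_yy st)].
- move=> j v Pj Hv; rewrite Hv //; have [e1 e2] := st_yK st Pj.
  by apply: (weight_inv dE _ e1 e2); split; [apply: (st_Ey st) | apply: (st_yy st)].
- by move=> c v Hv; rewrite Hv //; apply: weight_sc.
- by move=> v a b _ Ha _ Hb; apply: weight_D.
- by move=> v w u a b _ Ha _ Hb Hu; rewrite Hu //; apply: weight_M.
- by move=> v; apply: weight_0.
Qed.

Lemma gr_funct v a b b' : graph X k v a b -> graph X k v a b' -> b = b'.
Proof.
move=> H H'; apply/eqP; rewrite -subr_eq0; apply/eqP.
by apply: (st_fun st (v := v)); rewrite -(subrr a); apply: gr_sub.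
Qed.

End StageFacts.

(** * Deleting a variable *)
Section Deletion.
Variables (k : 'I_M) (P : pred 'I_M) (X : 'I_M -> Q) (D : 'I_M -> Q -> Q)
    (y yi : 'I_M -> Q) (E : 'I_M -> Q -> Q).
Hypothesis st : stage k P X D y yi E.
Variable zi : Q.
Hypotheses (ziC : central zi) (zziK : X k ^+ l * zi = 1).

Let char0 := char0_int sp.
Let c0 := dconst eps l.
Let c0_neq0 : c0 != 0 := dconst_neq0 sp.
Let sgk := sg k.
Let sgk0 : sgk != 0 := hc_sg0 hc k.
Local Notation xk := (X k).
Local Notation z := (X k ^+ l).
Let Pk i : P i -> (i < k)%N. Proof. exact: (st_P st). Qed.
Let PkF i : P i -> (i == k) = false.
Proof. by move=> /Pk ik; apply/eqP => e; move: ik; rewrite e ltnn. Qed.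

Let zC : central z := st_central st (leqnn k).
Let zizK : zi * z = 1. Proof. by rewrite ziC. Qed.

Definition inv_k := zi * xk ^+ l.-1.
Local Notation xi := inv_k.

Lemma xk_invK : xk * xi = 1.
Proof. by rewrite /inv_k mulrA -ziC -mulrA -exprS prednK. Qed.
Lemma inv_kK : xi * xk = 1.
Proof. by rewrite /inv_k -mulrA -exprSr prednK. Qed.

Lemma inv_kX p : (p <= l)%N -> zi * xk ^+ (l - p) = xi ^+ p.
Proof.
move=> pl; have e : xi ^+ p * xk ^+ p = 1.
  elim: p {pl} => [|p IH]; first by rewrite mulr1.
  by rewrite exprSr exprS mulrA -(mulrA _ xi) inv_kK mulr1.
rewrite -[LHS]mul1r -e -mulrA; have -> : xk ^+ p * (zi * xk ^+ (l - p)) = 1.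
  by rewrite mulrA -ziC -mulrA -exprD subnKC.
by rewrite mulr1.
Qed.

(** Normalised so that the eigenvalues of the [y j] are the integers [S k j] ([Ek_y]). *)
Definition Ek b := c0^-1 *: (zi * D k b).
Let dk : derivation (D k) := st_derD st (leqnn k).

Lemma Ek_der : derivation Ek.
Proof.
split=> [a b|c a|a b]; rewrite /Ek.
- by rewrite (der_D dk) mulrDr scalerDr.
- by rewrite (der_Z dk) -scalerAr !scalerA mulrC.
- rewrite (der_M dk) mulrDr scalerDr -scalerAl -scalerAr; congr (_ *: _ + _ *: _).
    by rewrite mulrA.
  by rewrite mulrA ziC -mulrA.
Qed.

(** [x k ^+ l] commutes with [x k]. *)
Lemma D_xk : D k xk = 0.
Proof.
have H0 : graph X k (fun i => S i k + l%:Z * S i k) 0 0 by apply: gr_0.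
have H : graph X k (fun i => S i k) (x k) xk by apply: gr_gen.
by apply: (st_DG st (leqnn k) H H0) => //; rewrite scaler0 -exprSr -exprS subrr.
Qed.

Lemma Ek_xk : Ek xk = 0.
Proof. by rewrite /Ek D_xk mulr0 scaler0. Qed.

Lemma Ek_y j : P j -> Ek (y j) = (S k j)%:~R *: y j.
Proof.
move=> Pj; rewrite /Ek (st_Dy st) // -scalerAr mulrA zizK mul1r scalerA mulrA mulVf //.
by rewrite mul1r.
Qed.

(** [bideg v d] : degree [v] for the previous gradings and [d] for the new one. *)
Definition bideg (v : 'I_M -> int) (d : int) (b : Q) : Prop :=
  weight Ek xk d b /\ forall i, P i -> weight (E i) (y i) (v i) b.

Lemma bideg_family : eigen_family Ek P bideg.
Proof.
have dE i Pi := @st_derE _ _ _ _ _ _ _ st i Pi.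
split.
- by move=> v d b [[]].
- by move=> v w d b e [Hd H]; split=> // i Pi; rewrite -e //; apply: H.
- by move=> v d; split=> [|i Pi]; apply: weight_0 => //; [apply: Ek_der | apply: dE].
- move=> v d a b [Ha Ha'] [Hb Hb']; split=> [|i Pi]; apply: weight_D => //.
  + exact: Ek_der.
  + exact: dE.
  + exact: Ha'.
  + exact: Hb'.
- move=> v d c a [Ha Ha']; split=> [|i Pi]; apply: weight_Z => //.
  + exact: Ek_der.
  + exact: dE.
  + exact: Ha'.
- move=> v d w e a b [Ha Ha'] [Hb Hb']; split=> [|i Pi]; apply: weight_M => //.
  + exact: Ek_der.
  + exact: dE.
  + exact: Ha'.
  + exact: Hb'.
Qed.
Let fB := bideg_family.

Lemma bideg_inv v d a b : bideg v d a -> a * b = 1 -> b * a = 1 ->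
  bideg (fun i => - v i) (- d) b.
Proof.
move=> [Ha Ha'] ab ba; split=> [|i Pi]; first exact: (weight_inv Ek_der Ha ab ba).
exact: (weight_inv (st_derE st Pi) (Ha' i Pi) ab ba).
Qed.

Lemma bideg_1 : bideg (fun=> 0) 0 1.
Proof.
by rewrite -[1]scale1r; split=> [|i Pi]; apply: weight_sc; [apply: Ek_der|apply: (st_derE st)].
Qed.

Lemma bideg_xk : bideg (fun i => S i k) 0 xk.
Proof.
split=> [|i Pi]; split; rewrite ?Ek_xk ?scale0r ?expr0z ?scale1r //.
  exact: (st_EX st).
exact: (st_yX st).
Qed.

Lemma bideg_y j : P j -> bideg (fun i => S i j) (S k j) (y j).
Proof.
move=> Pj; split=> [|i Pi]; split.
- exact: Ek_y.
- rewrite [y j * _](st_yX st Pj (leqnn k)) scalerA -eps_expD (hc_skew hc k j).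
  by rewrite addNr expr0z scale1r.
- exact: (st_Ey st).
- exact: (st_yy st).
Qed.

Lemma bideg_invk p : bideg (fun i => - (p%:Z * S i k)) 0 (xi ^+ p).
Proof.
elim: p => [|p IH].
  by apply: (fam_ext fB) bideg_1 => i _; rewrite mul0r oppr0.
have H1 : bideg (fun i => - S i k) 0 xi.
  by rewrite -oppr0; apply: bideg_inv bideg_xk xk_invK inv_kK.
rewrite exprS -[0](addr0 0).
by apply: (fam_ext fB) (fam_M fB H1 IH) => i _; rewrite intS; ring.
Qed.

(** ** Commutation chains in the target *)
Definition chain_vdeg (j : 'I_M) (m : nat) (i : 'I_M) : int :=
  S i j + m%:Z * (S i k + (i == k)%:Z * sg k).
Definition chain_kdeg (j : 'I_M) (m : nat) : int := S k j + sg k * m%:Z.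

Section Chain.
Variables (j : 'I_M) (a : nat -> R) (al : nat -> Q).
Hypothesis kj : (k < j)%N.
Local Notation vd := (chain_vdeg j).
Local Notation dd := (chain_kdeg j).
Hypothesis a0 : a 0%N = x j.
Hypothesis Ha : forall m : nat, x k * a m = q ^ (S k j + sg k * m%:Z) *: (a m * x k) + a m.+1.
Hypothesis al0 : forall m, (l <= m)%N -> a m = 0.
Hypothesis Hal : forall m, graph X k.+1 (vd m) (a m) (al m).

Let vdk m : vd m k = dd m.
Proof. by rewrite /chain_vdeg /chain_kdeg eqxx S_diag add0r mul1r mulrC. Qed.
Let vdl m (i : 'I_M) : (i < k)%N -> vd m i = S i j + m%:Z * S i k.
Proof.
move=> ik; rewrite /chain_vdeg (_ : (i == k) = false) ?mul0r ?addr0 //.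
by apply/eqP => e; move: ik; rewrite e ltnn.
Qed.
Let vdP m i : P i -> vd m i = S i j + m%:Z * S i k.
Proof. by move=> /Pk; apply: vdl. Qed.

Lemma chain_al0 : al 0%N = X j.
Proof.
apply: (gr_funct st (v := vd 0) (a := x j)).
  by rewrite -a0; apply: gr_weak (Hal 0).
by apply: gr_gen (ltnW kj) _ => i _; rewrite /chain_vdeg mul0r addr0.
Qed.

Lemma chain_al_ge m : (l <= m)%N -> al m = 0.
Proof. by move=> lm; have := Hal m; rewrite al0 // => /(gr_weak (leqnSn k)); apply: st_fun st _ _. Qed.

Lemma chain_xk m : xk * al m = eps ^ dd m *: (al m * xk) + al m.+1.
Proof.
have H := gr_weak (leqnSn k) (Hal m); have H' := gr_weak (leqnSn k) (Hal m.+1).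
have gk : graph X k (fun i => S i k) (x k) xk by apply: gr_gen.
apply: (gr_funct st (v := fun i => vd m.+1 i) (a := x k * a m)).
  by apply: gr_mul gk H _ => i ik; rewrite !vdl // intS; ring.
rewrite Ha; apply: gr_add => //; rewrite -(ev_qX sp); apply: gr_scale.
by apply: gr_mul H gk _ => i ik; rewrite !vdl // intS; ring.
Qed.

(** Specialising [chain_comm] at the [m]-th term of the chain and dividing by
    [X k ^+ l] expresses [Ek] by a triangular matrix. *)
Lemma chain_Ek : exists be : nat -> nat -> K, forall m,
  Ek (al m) = (dd m)%:~R *: al m + \sum_(1 <= p < l) be m p *: (al (m + p)%N * xi ^+ p).
Proof.
have /choice[be Hbe] : forall m, exists be : nat -> K,
  Ek (al m) = (dd m)%:~R *: al m + \sum_(1 <= p < l) be p *: (al (m + p)%N * xi ^+ p);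
  last by exists be.
move=> m; have [th [be [evth H]]] := chain_comm sp R (dd m) (hc_cop hc k).
exists (fun p => c0^-1 * ev (be p)).
have Hs (p : nat) : x k * a (m + p)%N =
    q ^ (dd m + sg k * p%:Z) *: (a (m + p)%N * x k) + a (m + p.+1)%N.
  by rewrite Ha addnS; congr (q ^ _ *: _ + _); rewrite /chain_kdeg PoszD; ring.
have /= e := H (x k) (fun p => a (m + p)%N) Hs.
rewrite addn0 [a (m + l)%N]al0 ?leq_addl // addr0 in e.
have Hm n := gr_weak (leqnSn k) (Hal n).
have gx n : graph X k (fun i => n%:Z * S i k) (x k ^+ n) (xk ^+ n).
  by apply: gr_exp; apply: gr_gen.
have G1 : graph X k (fun i => vd m i + l%:Z * S i k)
    (th *: (a m * x k ^+ l) + \sum_(1 <= p < l) be p *: (a (m + p)%N * x k ^+ (l - p)))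
    (ev th *: (al m * xk ^+ l) + \sum_(1 <= p < l) ev (be p) *: (al (m + p)%N * xk ^+ (l - p))).
  apply: gr_add; first by apply: gr_scale; apply: gr_mul (Hm m) (gx l) _.
  apply: gr_sum => p; rewrite mem_index_iota => /andP[p1 pl]; apply: gr_scale.
  apply: gr_mul (Hm (m + p)%N) (gx (l - p)%N) _ => i ik.
  rewrite !vdl //; have -> : (l - p)%:Z = l%:Z - p%:Z by lia.
  by rewrite PoszD; ring.
rewrite /Ek (st_DG st (leqnn k) (Hm m) G1 _ e) // evth mulrDr scalerDr; congr (_ + _).
  rewrite -scalerAr scalerA mulrA mulVf // mul1r.
  by rewrite ziC -mulrA zziK mulr1.
rewrite mulr_sumr scaler_sumr; apply: eq_big_nat => p /andP[p1 pl].
by rewrite -scalerAr scalerA mulrA ziC -mulrA inv_kX // ltnW.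
Qed.

(** Triangular with distinct eigenvalues, [Ek] is diagonalised by downward induction along
    the chain: the higher terms are corrected by solving [(Ek - dd m) b = c].  [Y] is any
    family of bidegree eigenvectors, and the last hypothesis must put the lowest component
    [al m - b] into [Y]; it is used for three families of increasing precision. *)
Lemma chain_filt (Y : ('I_M -> int) -> int -> Q -> Prop) :
  eigen_family Ek P Y -> (forall v d b, Y v d b -> bideg v d b) ->
  (forall p, Y (fun i => - (p%:Z * S i k)) 0 (xi ^+ p)) ->
  (forall m b, filt Y sgk (vd m) (dd m + sgk) b -> bideg (vd m) (dd m) (al m - b) ->
     Y (vd m) (dd m) (al m - b)) ->
  forall m, filt Y sgk (vd m) (dd m) (al m).
Proof.
move=> fY YB Yxi rule; have [be Hbe] := chain_Ek.
have main n m : (l <= m + n)%N -> filt Y sgk (vd m) (dd m) (al m).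
  elim/ltn_ind: n m => n IH m lmn.
  have [lm|ml] := leqP l m; first by rewrite chain_al_ge //; apply: filt_0.
  have IH' p : (0 < p)%N -> filt Y sgk (vd (m + p)) (dd (m + p)) (al (m + p)%N).
    move=> p0; apply: (IH (n - p)%N); first by rewrite ltn_subrL p0; lia.
    by lia.
  set c := \sum_(1 <= p < l) be m p *: (al (m + p)%N * xi ^+ p).
  have Hc : filt Y sgk (vd m) (dd m + sgk) c.
    apply: (filt_sum fY) => p; rewrite mem_index_iota => /andP[p1 pl]; apply: (filt_Z fY).
    apply: (filt_shiftn fY (n := p.-1)).
    have -> : dd m + sgk + sgk * p.-1%:Z = dd (m + p) + 0.
      have ep : p%:Z = p.-1%:Z + 1 by lia.
      by rewrite /chain_kdeg /sgk PoszD ep; ring.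
    have HH := filt_M fY (IH' p p1) (filt_X sgk (Yxi p)).
    apply: (filt_ext fY _ HH) => i Pi.
    by rewrite !vdP // PoszD; ring.
  have [b [Hb eb]] := filt_solve char0 Ek_der fY sgk0 Hc.
  rewrite -[al m](subrK b); apply: (filt_D fY); last exact: (filt_shift fY).
  apply: filt_X; apply: rule => //.
  have Hb' := filt_sub YB Hb.
  have Eal : Ek (al m - b) = (dd m)%:~R *: (al m - b).
    have eb' : Ek b = c + (dd m)%:~R *: b by rewrite -eb subrK.
    by rewrite (der_B _ _ Ek_der) Hbe -/c eb' scalerBr opprD addrA addrK.
  split; first split=> //.
    (* the defect of commutation with [xk] is an eigenvector for [dd m], but a sum of higher
       components: it is zero *)
    apply/eqP; rewrite -subr_eq0; apply/eqP.
    apply: (filt_eigen0 char0 Ek_der fB sgk0 (v := vd m.+1) (d := dd m)); last first.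
      rewrite (der_B _ _ Ek_der) (der_Z Ek_der) !(der_M Ek_der) Ek_xk Eal mul0r mulr0 add0r addr0.
      by rewrite -scalerAr -scalerAl scalerBr !scalerA mulrC.
    have -> : xk * (al m - b) - eps ^ dd m *: ((al m - b) * xk) =
        al m.+1 - (xk * b - eps ^ dd m *: (b * xk)).
      have zmodE (t1 t2 t3 t4 : Q) : t1 + t2 - t3 - (t1 - t4) = t2 - (t3 - t4).
        by rewrite !opprB [LHS](AC (3*2) ((1*5)*(2*(4*3)))) /= subrr add0r.
      by rewrite mulrBr mulrBl chain_xk scalerBr zmodE.
    have Hal1 : filt bideg sgk (vd m.+1) (dd m + sgk) (al m.+1).
      have := filt_sub YB (IH' 1%N isT); rewrite addn1.
      by rewrite (_ : dd m.+1 = dd m + sgk) // /chain_kdeg /sgk intS; ring.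
    have bxk := filt_X sgk bideg_xk.
    have e1 i : P i -> vd m i + S i k = vd m.+1 i by move=> Pi; rewrite !vdP // intS; ring.
    apply: (filt_B fB) => //; apply: (filt_B fB).
      rewrite -[_ + sgk]add0r.
      by apply: (filt_ext fB) (filt_M fB bxk Hb') => i Pi; rewrite addrC e1.
    apply: (filt_Z fB); rewrite -[_ + sgk]addr0.
    by apply: (filt_ext fB) (filt_M fB Hb' bxk).
  move=> i Pi; have dE := st_derE st Pi.
  have H := @ga_graph P k P X y yi _ _ _ Pk (gr_weak (leqnSn k) (Hal m)).
  apply: (weight_B dE (galg_degree st Pi H)).
  apply: (filt_ind (Y := weight (E i) (y i) (vd m i)) _ _ _ Hb'); first exact: weight_0.
    by move=> u w; apply: weight_D.
  by move=> p u [_ /(_ i Pi)].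
by move=> m; apply: (main l); apply: leq_addl.
Qed.

End Chain.

Lemma units_above (j : 'I_M) : (k.+1 <= j)%N -> j \in kappa -> exists b, X j * b = 1 /\ b * X j = 1.
Proof. by move=> kj; apply: (st_unit st); apply: ltnW. Qed.

Lemma chain_exists (j : 'I_M) : (k < j)%N -> exists (a : nat -> R) (al : nat -> Q),
  [/\ a 0%N = x j,
      forall m : nat, x k * a m = q ^ (S k j + sg k * m%:Z) *: (a m * x k) + a m.+1,
      forall m, (l <= m)%N -> a m = 0
    & forall m, graph X k.+1 (chain_vdeg j m) (a m) (al m)].
Proof.
move=> kj; have [a [a0 Ha al0 Hh]] := hc_upper hc kj.
have /choice[al Hal] m : exists b, graph X k.+1 (chain_vdeg j m) (a m) b.
  by apply: gr_total (Hh m); apply: units_above.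
by exists a, al.
Qed.

Let kF (i : 'I_M) : (i < k)%N -> (i == k) = false.
Proof. by move=> ik; apply/eqP => e; move: ik; rewrite e ltnn. Qed.

Lemma kappa_bideg (j : 'I_M) : (k < j)%N -> j \in kappa -> bideg (fun i => S i j) (S k j) (X j).
Proof.
move=> kj kk; have [a [al [a0 Ha al0 Hal]]] := chain_exists kj.
have a1 m : a m.+1 = 0.
  elim: m => [|m IH].
    have := Ha 0%N; rewrite mulr0 addr0 a0 (hc_kappa hc k kk) => /eqP.
    by rewrite -subr_eq0 opprD addNKr oppr_eq0 => /eqP.
  by have := Ha m.+1; rewrite IH mulr0 mul0r scaler0 add0r.
have al1 m : al m.+1 = 0.
  by have := gr_weak (leqnSn k) (Hal m.+1); rewrite a1; apply: (st_fun st).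
have e0 := chain_al0 kj a0 Hal.
split; first split.
- have [be Hbe] := chain_Ek kj Ha al0 Hal.
  have := Hbe 0%N; rewrite e0 /chain_kdeg mulr0 addr0 big1_seq ?addr0 // => p /andP[_].
  by rewrite mem_index_iota => /andP[p0 _]; rewrite -(prednK p0) add0n al1 mul0r scaler0.
- by have := chain_xk Ha Hal 0%N; rewrite e0 al1 addr0 /chain_kdeg mulr0 addr0.
- by move=> i Pi; split; [apply: (st_EX st) | apply: (st_yX st)] => //; apply: ltnW.
Qed.

Lemma X_filt0 (j : 'I_M) : (k < j)%N -> filt bideg sgk (fun i => S i j) (S k j) (X j).
Proof.
move=> kj; have [a [al [a0 Ha al0 Hal]]] := chain_exists kj.
have H := chain_filt kj Ha al0 Hal fB (fun _ _ _ H => H) bideg_invk (fun _ _ _ H => H) 0%N.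
rewrite (chain_al0 kj a0 Hal) /chain_kdeg mulr0 addr0 in H.
by apply: (filt_ext fB _ H) => i _; rewrite /chain_vdeg mul0r addr0.
Qed.

Lemma gr_filt0 v a b : graph X k.+1 v a b -> filt bideg sgk v (v k) b.
Proof.
have Pk1 i : P i -> (i < k.+1)%N by move=> /Pk/ltnW.
elim=> {v a b}.
- move=> j v kj Hv; rewrite Hv //; apply: (filt_ext fB _ (X_filt0 kj)) => i /Pk1 ik.
  by rewrite Hv.
- move=> j v b kj kk Hv e1 e2; rewrite Hv //; apply: filt_X.
  apply: (fam_ext fB) (bideg_inv (kappa_bideg kj kk) e1 e2) => i /Pk1 ik.
  by rewrite Hv.
- move=> c v Hv; rewrite Hv //; apply: filt_X; apply: (fam_Z fB).
  by apply: (fam_ext fB) bideg_1 => i /Pk1 ik; rewrite Hv.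
- by move=> v a b a' b' _ H _ H'; apply: (filt_D fB).
- move=> v w u a b a' b' _ H _ H' Hu; rewrite Hu //.
  by apply: (filt_ext fB _ (filt_M fB H H')) => i /Pk1 ik; rewrite Hu.
- by move=> v; apply: filt_0.
Qed.

Lemma gr_D_filt (i : 'I_M) v a b : (k < i)%N -> graph X k.+1 v a b ->
  filt bideg sgk (fun c => v c + l%:Z * S c i) (v k + l%:Z * S k i) (D i b).
Proof.
move=> ki H; have [w [Hw e]] := comm_exists ki (gr_hs H).
have [c Hc] := gr_total (X := X) units_above Hw.
have -> : D i b = c.
  by apply: (st_DG st (ltnW ki) (gr_weak (leqnSn k) H) (gr_weak (leqnSn k) Hc) _ e).
exact: gr_filt0 Hc.
Qed.

(** Elements of bidegree [(v, d)] on which the remaining derivations are controlled. *)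
Definition bideg1 v d b := bideg v d b /\ forall i : 'I_M, (k < i)%N ->
  filt bideg sgk (fun c => v c + l%:Z * S c i) (d + l%:Z * S k i) (D i b).

Let dD (i : 'I_M) : (k < i)%N -> derivation (D i).
Proof. by move=> ki; apply: (st_derD st); apply: ltnW. Qed.

Lemma bideg1_family : eigen_family Ek P bideg1.
Proof.
split.
- by move=> v d b [[[]]].
- move=> v w d b e [Hb HD]; split; first exact: (fam_ext fB) Hb.
  by move=> i ki; apply: (filt_ext fB _ (HD i ki)) => j Pj; rewrite e.
- move=> v d; split; first exact: (fam_0 fB).
  by move=> i ki; rewrite (der_0 (dD ki)); apply: filt_0.
- move=> v d a b [Ha Da] [Hb Db]; split; first exact: (fam_D fB).
  by move=> i ki; rewrite (der_D (dD ki)); apply: (filt_D fB); [apply: Da|apply: Db].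
- move=> v d c a [Ha Da]; split; first exact: (fam_Z fB).
  by move=> i ki; rewrite (der_Z (dD ki)); apply: (filt_Z fB); apply: Da.
- move=> v d w e a b [Ha Da] [Hb Db]; split; first exact: (fam_M fB).
  move=> i ki; rewrite (der_M (dD ki)); apply: (filt_D fB).
    have H := filt_M fB (Da i ki) (filt_X sgk Hb); rewrite addrAC.
    by apply: (filt_ext fB _ H) => j _; rewrite addrAC.
  have H := filt_M fB (filt_X sgk Ha) (Db i ki); rewrite -addrA.
  by apply: (filt_ext fB _ H) => j _; rewrite addrA.
Qed.
Let fB1 := bideg1_family.

Lemma bideg1_inv v d a b : bideg1 v d a -> a * b = 1 -> b * a = 1 ->
  bideg1 (fun i => - v i) (- d) b.
Proof.
move=> [Ha Da] ab ba; have Hb := bideg_inv Ha ab ba; split=> // i ki.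
rewrite (der_inv (dD ki) ab ba); apply: (filt_N fB).
have H := filt_M fB (filt_M fB (filt_X sgk Hb) (Da i ki)) (filt_X sgk Hb).
have -> : - d + l%:Z * S k i = - d + (d + l%:Z * S k i) + - d by ring.
by apply: (filt_ext fB _ H) => j _; ring.
Qed.

Lemma bideg1_1 : bideg1 (fun=> 0) 0 1.
Proof.
split; first exact: bideg_1.
by move=> i ki; rewrite (der_1 (dD ki)); apply: filt_0.
Qed.

(** The leading term has the form required by [st_Dy]; the rest is of higher degree and
    disappears in the projection. *)
Lemma D_xk_eq (i : 'I_M) : (k < i)%N -> exists2 w, filt bideg sgk (fun a => S a k + l%:Z * S a i) (l%:Z * S k i + sgk) w
  & D i xk = (c0 * (S i k)%:~R) *: (xk * X i ^+ l) + w.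
Proof.
move=> ki; have [th [w [evth Hw e]]] := comm_lower ki.
have [c Hc] := gr_total (X := X) units_above Hw; exists c.
  have := gr_filt0 Hc; rewrite S_diag add0r eqxx mul1r => H.
  by apply: (filt_ext fB _ H) => a Pa; rewrite PkF // mul0r addr0.
have Hxk : graph X k (fun a => S a k) (x k) xk by apply: gr_gen.
have Hxi : graph X k (fun a => S a i) (x i) (X i) by apply: gr_gen (ltnW ki) _.
have Hc' : graph X k (fun a => S a k + l%:Z * S a i) w c.
  by apply: gr_ext (gr_weak (leqnSn k) Hc) => a ak; rewrite kF // mul0r addr0.
rewrite /c0 -evth; apply: (st_DG st (ltnW ki) Hxk _ _ e) => //.
apply: gr_add Hc'; apply: gr_scale; apply: gr_mul Hxk (gr_exp l Hxi) _ => a _ //.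
Qed.

Lemma Xl_filt (i : 'I_M) : (k < i)%N -> filt bideg sgk (fun a => l%:Z * S a i) (l%:Z * S k i) (X i ^+ l).
Proof.
move=> ki; have H : graph X k.+1 (fun a => S a i) (x i) (X i) by apply: gr_gen.
exact: (gr_filt0 (gr_exp l H)).
Qed.

Lemma bideg1_xk : bideg1 (fun i => S i k) 0 xk.
Proof.
split; first exact: bideg_xk.
move=> i ki; have [w Hw ->] := D_xk_eq ki; rewrite add0r.
apply: (filt_D fB); last exact: (filt_shift fB Hw).
apply: (filt_Z fB); rewrite -[_ * S k i]add0r.
exact: (filt_M fB (filt_X sgk bideg_xk) (Xl_filt ki)).
Qed.

Lemma bideg1_y j : P j -> bideg1 (fun i => S i j) (S k j) (y j).
Proof.
move=> Pj; split; first exact: bideg_y.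
move=> i ki; rewrite (st_Dy st (ltnW ki) Pj); apply: (filt_Z fB).
have H := filt_M fB (Xl_filt ki) (filt_X sgk (bideg_y Pj)); rewrite [S k j + _]addrC.
by apply: (filt_ext fB _ H) => a _; rewrite addrC.
Qed.

Lemma bideg1_invk p : bideg1 (fun i => - (p%:Z * S i k)) 0 (xi ^+ p).
Proof.
elim: p => [|p IH].
  by apply: (fam_ext fB1) bideg1_1 => i _; rewrite mul0r oppr0.
have H1 : bideg1 (fun i => - S i k) 0 xi.
  by rewrite -oppr0; apply: bideg1_inv bideg1_xk xk_invK inv_kK.
rewrite exprS -[0](addr0 0).
by apply: (fam_ext fB1) (fam_M fB1 H1 IH) => i _; rewrite intS; ring.
Qed.

Lemma filt_der (i : 'I_M) v d b : (k < i)%N -> filt bideg1 sgk v d b ->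
  filt bideg sgk (fun c => v c + l%:Z * S c i) (d + l%:Z * S k i) (D i b).
Proof.
move=> ki H; have d0 := dD ki.
apply: (filt_ind (Y := fun b => filt bideg sgk (fun c => v c + l%:Z * S c i) (d + l%:Z * S k i) (D i b)) _ _ _ H).
- by rewrite (der_0 d0); apply: filt_0.
- by move=> u w Hu Hw; rewrite (der_D d0); apply: (filt_D fB).
- move=> n u [_ /(_ i ki) Hu]; apply: (filt_shiftn fB (n := n)).
  by rewrite addrAC.
Qed.

Lemma X_filt1 (j : 'I_M) : (k < j)%N -> filt bideg1 sgk (fun i => S i j) (S k j) (X j).
Proof.
move=> kj; have [a [al [a0 Ha al0 Hal]]] := chain_exists kj.
have H := chain_filt kj Ha al0 Hal fB1 (fun _ _ _ H => H.1) bideg1_invk _ 0%N.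
rewrite (chain_al0 kj a0 Hal) /chain_kdeg mulr0 addr0 in H.
apply: (filt_ext fB1 _ (H _)) => [i _|]; first by rewrite /chain_vdeg mul0r addr0.
move=> m b Hb Hab; split=> // i ki; rewrite (der_B _ _ (dD ki)); apply: (filt_B fB).
  have := gr_D_filt ki (Hal m); rewrite {2}/chain_vdeg eqxx S_diag add0r mul1r.
  by rewrite [m%:Z * _]mulrC.
by apply: (filt_shift fB); rewrite addrAC; apply: filt_der.
Qed.

(** These are the new variables: the image of [x j] under the deletion of [x k]. *)
Definition lowest (j : 'I_M) (b : Q) :=
  [/\ bideg1 (fun i => S i j) (S k j) b,
      filt bideg1 sgk (fun i => S i j) (S k j + sgk) (X j - b)
    & j \in kappa -> b = X j].

Lemma lowest_exists : exists X' : 'I_M -> Q, forall j : 'I_M, (k < j)%N -> lowest j (X' j).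
Proof.
apply: (fin_all_exists (P := fun (j : 'I_M) b => (k < j)%N -> lowest j b)) => j.
have [kj|_] := boolP (k < j)%N; last by exists 0.
have [b0 [b1 [eb H0 H1]]] := filt_split fB1 (X_filt1 kj).
exists b0 => _; have e1 : X j - b0 = b1 by rewrite eb addrC addKr.
split=> //; first by rewrite e1.
move=> kk; apply/eqP; rewrite eq_sym -subr_eq0; apply/eqP.
have H : filt bideg1 sgk (fun i => S i j) (S k j + sgk) (X j - b0) by rewrite e1.
apply: (filt_eigen0 char0 Ek_der fB1 sgk0 H).
have [[e2 _] _] := kappa_bideg kj kk; have [[[e3 _] _] _] := H0.
by rewrite (der_B _ _ Ek_der) e2 e3 scalerBr.
Qed.

Section NewVariables.
Variable X' : 'I_M -> Q.
Hypothesis HX' : forall j : 'I_M, (k < j)%N -> lowest j (X' j).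

Let Pk1 i : P i -> (i < k.+1)%N. Proof. by move=> /Pk/ltnW. Qed.

(** The new variables satisfy the relations of the old ones, because they are their
    lowest components. *)
Lemma gr_lift v a b' : graph X' k.+1 v a b' -> exists b,
  [/\ graph X k.+1 v a b, bideg1 v (v k) b' & filt bideg1 sgk v (v k + sgk) (b - b')].
Proof.
elim=> {v a b'}.
- move=> j v kj Hv; have [H1 H2 _] := HX' kj; exists (X j); rewrite Hv //; split.
  + exact: gr_gen.
  + by apply: (fam_ext fB1) H1 => i /Pk1 ik; rewrite Hv.
  + by apply: (filt_ext fB1 _ H2) => i /Pk1 ik; rewrite Hv.
- move=> j v b kj kk Hv e1 e2; have [H1 _ /(_ kk) eX] := HX' kj.
  exists b; rewrite Hv // subrr; split; last exact: filt_0.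
    by apply: (gr_inv (j := j)) => //; rewrite -eX.
  by apply: (fam_ext fB1) (bideg1_inv H1 e1 e2) => i /Pk1 ik; rewrite Hv.
- move=> c v Hv; exists (ev c)%:A; rewrite Hv // subrr; split; last exact: filt_0.
    exact: gr_sc.
  by apply: (fam_Z fB1); apply: (fam_ext fB1) bideg1_1 => i /Pk1 ik; rewrite Hv.
- move=> v a b a' b' _ [c [H1 H2 H3]] _ [c' [H1' H2' H3']]; exists (c + c'); split.
  + exact: gr_add.
  + exact: (fam_D fB1).
  + by rewrite opprD addrACA; apply: (filt_D fB1).
- move=> v w u a b a' b' _ [c [H1 H2 H3]] _ [c' [H1' H2' H3']] Hu; exists (c * c').
  rewrite Hu //; split.
  + exact: gr_mul H1 H1' Hu.
  + by apply: (fam_ext fB1) (fam_M fB1 H2 H2') => i /Pk1 ik; rewrite Hu.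
  + have -> : c * c' - b * b' = (c - b) * (b' + (c' - b')) + b * (c' - b').
      by rewrite [b' + _]addrC subrK mulrBl mulrBr addrA subrK.
    have Hc' : filt bideg1 sgk w (w k) (b' + (c' - b')).
      by apply: (filt_D fB1); [apply: filt_X | apply: (filt_shift fB1)].
    have e i : P i -> v i + w i = u i by move=> /Pk1 ik; rewrite Hu.
    apply: (filt_D fB1).
      by rewrite addrAC; apply: (filt_ext fB1 e (filt_M fB1 H3 Hc')).
    by rewrite -addrA; apply: (filt_ext fB1 e (filt_M fB1 (filt_X sgk H2) H3')).
- by move=> v; exists 0; rewrite subrr; split; [apply: gr_0|apply: (fam_0 fB1)|apply: filt_0].
Qed.

Let fsub v d b : filt bideg1 sgk v d b -> filt bideg sgk v d b.
Proof. by apply: filt_sub => ? ? ? []. Qed.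

Lemma Xl_lowest (i : 'I_M) : (k < i)%N ->
  [/\ bideg (fun a => l%:Z * S a i) (l%:Z * S k i) (X' i ^+ l)
    & filt bideg sgk (fun a => l%:Z * S a i) (l%:Z * S k i + sgk) (X i ^+ l - X' i ^+ l)].
Proof.
move=> ki; have H : graph X' k.+1 (fun a => S a i) (x i) (X' i) by apply: gr_gen.
have H1 : graph X k.+1 (fun a => S a i) (x i) (X i) by apply: gr_gen.
have [b [Hb [Hb' _] Hf]] := gr_lift (gr_exp l H).
have eb : b = X i ^+ l.
  exact: (gr_funct st (gr_weak (leqnSn k) Hb) (gr_weak (leqnSn k) (gr_exp l H1))).
by split=> //; rewrite -eb; apply: fsub.
Qed.

Definition der_bound (n : nat) (i j : 'I_M) :=
  [/\ (k < j)%N ->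
        eigensum bideg sgk n (fun a => S a j + l%:Z * S a i) (S k j + l%:Z * S k i) (D i (X' j)),
      eigensum bideg sgk n (fun a => S a k + l%:Z * S a i) (0 + l%:Z * S k i) (D i xk)
    & P j ->
        eigensum bideg sgk n (fun a => S a j + l%:Z * S a i) (S k j + l%:Z * S k i) (D i (y j))].

(** A uniform bound on the number of components of the [D i b] makes the projection of
    [D i] to its lowest component a polynomial in the adjoint action of [Ek]. *)
Lemma uniform_bound : exists n, forall i j : 'I_M, (k < i)%N -> der_bound n i j.
Proof.
have [f Hf] : exists f : 'I_M * 'I_M -> nat, forall p : 'I_M * 'I_M,
    (k < p.1)%N -> der_bound (f p) p.1 p.2.
  apply: (fin_all_exists (P := fun (p : 'I_M * 'I_M) n => (k < p.1)%N -> der_bound n p.1 p.2)).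
  case=> i j /=; have [ki|_] := boolP (k < i)%N; last by exists 0%N.
  have [n1 H1] : exists n, (k < j)%N -> eigensum bideg sgk n (fun a => S a j + l%:Z * S a i) (S k j + l%:Z * S k i) (D i (X' j)).
    have [kj|_] := boolP (k < j)%N; last by exists 0%N.
    by have [[_ /(_ i ki)[n Hn]] _ _] := HX' kj; exists n.
  have [n2 H2] := bideg1_xk.2 i ki.
  have [n3 H3] : exists n, P j -> eigensum bideg sgk n (fun a => S a j + l%:Z * S a i) (S k j + l%:Z * S k i) (D i (y j)).
    have [Pj|_] := boolP (P j); last by exists 0%N.
    by have [n Hn] := (bideg1_y Pj).2 i ki; exists n.
  exists (maxn n1 (maxn n2 n3)) => _; split.
  - by move=> /H1; apply: (eigensum_le fB); rewrite leq_maxl.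
  - by apply: (eigensum_le fB _ H2); rewrite leq_max leq_maxl orbT.
  - by move=> /H3; apply: (eigensum_le fB); rewrite !leq_max leqnn !orbT.
exists (\max_p f p) => i j ki; have [h1 h2 h3] := Hf (i, j) ki.
have le := leq_bigmax (F := f) (i, j).
by split; [move=> /h1|apply: (eigensum_le fB le h2)|move=> /h3]; apply: (eigensum_le fB).
Qed.

Section Bounded.
Variable n : nat.
Hypothesis Hn : forall i j : 'I_M, (k < i)%N -> der_bound n i j.

Definition bounded v d b := bideg v d b /\ forall i : 'I_M, (k < i)%N ->
  eigensum bideg sgk n (fun a => v a + l%:Z * S a i) (d + l%:Z * S k i) (D i b).

Lemma bounded_M v d w e a b : bounded v d a -> bounded w e b ->
  bounded (fun i => v i + w i) (d + e) (a * b).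
Proof.
move=> [Ha Da] [Hb Db]; split; first exact: (fam_M fB).
move=> i ki; rewrite (der_M (dD ki)); apply: (eigensum_D fB).
  have H := eigensum_Mr fB (Da i ki) Hb; rewrite addrAC.
  by apply: (eigensum_ext fB _ H) => j _; rewrite addrAC.
have H := eigensum_Ml fB Ha (Db i ki); rewrite -addrA.
by apply: (eigensum_ext fB _ H) => j _; rewrite addrA.
Qed.

Lemma bounded_ext v w d b : (forall i, P i -> v i = w i) -> bounded v d b -> bounded w d b.
Proof.
move=> e [Hb HD]; split; first exact: (fam_ext fB) Hb.
by move=> i ki; apply: (eigensum_ext fB _ (HD i ki)) => j Pj; rewrite e.
Qed.

Lemma bounded_inv v d a b : bounded v d a -> a * b = 1 -> b * a = 1 ->
  bounded (fun i => - v i) (- d) b.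
Proof.
move=> [Ha Da] ab ba; have Hb := bideg_inv Ha ab ba; split=> // i ki.
rewrite (der_inv (dD ki) ab ba) -scaleN1r; apply: (eigensum_Z fB).
have H := eigensum_Mr fB (eigensum_Ml fB Hb (Da i ki)) Hb.
have -> : - d + l%:Z * S k i = - d + (d + l%:Z * S k i) + - d by ring.
by apply: (eigensum_ext fB _ H) => j _; ring.
Qed.

Lemma gr_bounded v a b : graph X' k.+1 v a b -> bounded v (v k) b.
Proof.
elim=> {v a b}.
- move=> j v kj Hv; rewrite Hv //; apply: (bounded_ext (v := fun i => S i j)).
    by move=> i /Pk1 ik; rewrite Hv.
  split; first by have [[]] := HX' kj.
  by move=> i ki; have [/(_ kj)] := Hn j ki.
- move=> j v b kj kk Hv e1 e2; rewrite Hv //.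
  apply: (bounded_ext (v := fun i => - S i j)); first by move=> i /Pk1 ik; rewrite Hv.
  apply: bounded_inv e1 e2; split; first by have [[]] := HX' kj.
  by move=> i ki; have [/(_ kj)] := Hn j ki.
- move=> c v Hv; rewrite Hv //; apply: (bounded_ext (v := fun=> 0)).
    by move=> i /Pk1 ik; rewrite Hv.
  split; first by apply: (fam_Z fB) bideg_1.
  by move=> i ki; rewrite (der_sc _ (dD ki)); apply: (eigensum_0 fB).
- move=> v a b a' b' _ [Hb Db] _ [Hb' Db']; split; first exact: (fam_D fB).
  by move=> i ki; rewrite (der_D (dD ki)); apply: (eigensum_D fB); [apply: Db|apply: Db'].
- move=> v w u a b a' b' _ H _ H' Hu; rewrite Hu //.
  by apply: bounded_ext (bounded_M H H') => i /Pk1 ik; rewrite Hu.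
- move=> v; split; first exact: (fam_0 fB).
  by move=> i ki; rewrite (der_0 (dD ki)); apply: (eigensum_0 fB).
Qed.

(** The lowest component of [D i] for the adjoint action of [Ek]. *)
Definition new_D (i : 'I_M) : Q -> Q := dproj Ek sgk n 1 (l%:Z * S k i) (D i).
Definition new_P : pred 'I_M := fun i => (i == k) || P i.
Definition new_y (i : 'I_M) : Q := if i == k then xk else y i.
Definition new_yi (i : 'I_M) : Q := if i == k then xi else yi i.
Definition new_E (i : 'I_M) : Q -> Q := if i == k then Ek else E i.

Lemma new_D_eq (i : 'I_M) v d b c : (k < i)%N -> bounded v d b ->
  bideg (fun a => v a + l%:Z * S a i) (d + l%:Z * S k i) c ->
  filt bideg sgk (fun a => v a + l%:Z * S a i) (d + l%:Z * S k i + sgk) (D i b - c) ->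
  new_D i b = c.
Proof.
move=> ki [[[Eb _] _] Hb] Hc Hf; rewrite /new_D (dproj_eigen Ek_der _ _ _ _ (dD ki) Eb).
exact: (proj_lowest char0 Ek_der fB sgk0 (eigensum_S fB (Hb i ki)) Hc Hf).
Qed.

Lemma new_D_y (i : 'I_M) v d b s w : (k < i)%N -> bounded v d b ->
  D i b = s *: (X i ^+ l * b) + w ->
  filt bideg sgk (fun a => v a + l%:Z * S a i) (d + l%:Z * S k i + sgk) w ->
  new_D i b = s *: (X' i ^+ l * b).
Proof.
move=> ki Bb e Hw; have [h1 h2] := Xl_lowest ki; have Hb := Bb.1.
have e1 (a : 'I_M) : P a -> l%:Z * S a i + v a = v a + l%:Z * S a i by rewrite addrC.
apply: (new_D_eq ki Bb).
  by apply: (fam_Z fB); rewrite addrC; apply: (fam_ext fB) e1 (fam_M fB h1 Hb).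
have -> : D i b - s *: (X' i ^+ l * b) = s *: ((X i ^+ l - X' i ^+ l) * b) + w.
  by rewrite e [LHS]addrAC -scalerBr -mulrBl.
apply: (filt_D fB) => //; apply: (filt_Z fB).
have H := filt_M fB h2 (filt_X sgk Hb).
have -> : d + l%:Z * S k i + sgk = l%:Z * S k i + sgk + d by ring.
exact: (filt_ext fB e1 H).
Qed.

(** Each relation of stage [k] holds between lowest components, because an eigenvector that
    is also a sum of eigenvectors of higher degrees is zero ([filt_eigen0]). *)
Lemma stage_next : stage k.+1 new_P X' new_D new_y new_yi new_E.
Proof.
have PN i : new_P i -> i = k \/ P i by case/orP => [/eqP|]; [left|right].
split.
- by move=> i /PN[->|/Pk1].
- by move=> j kj kk; have [_ _ /(_ kk) ->] := HX' kj; apply: units_above.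
- move=> v b' H; have [b [Hb [Hb' _] Hf]] := gr_lift H.
  have b0 : b = 0 := st_fun st (gr_weak (leqnSn k) Hb).
  rewrite b0 sub0r in Hf; have := filt_N fB (fsub Hf); rewrite opprK => Hf'.
  by apply: (filt_eigen0 char0 Ek_der fB sgk0 Hf'); case: Hb' => [[]].
- move=> j kj; have [h1 h2] := Xl_lowest kj.
  have [m Hm] := Xl_filt kj.
  rewrite -(proj_lowest char0 Ek_der fB sgk0 (eigensum_S fB Hm) h1 h2).
  by apply: (proj_central Ek_der); apply: (st_central st); apply: ltnW.
- by move=> i ki; apply: (dproj_der Ek_der); apply: dD.
- move=> i v u a b' w c' ki Hb' Hc' Hu e.
  have [b [Hb _ Hf]] := gr_lift Hb'; have [c [Hc Hc1 Hf']] := gr_lift Hc'.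
  have eD : D i b = c.
    apply: (st_DG st (ltnW ki) (gr_weak (leqnSn k) Hb) (gr_weak (leqnSn k) Hc) _ e).
    by move=> j jk; apply: Hu; apply: ltnW.
  have uk := Hu k (ltnSn k); have eP a0 : P a0 -> u a0 = v a0 + l%:Z * S a0 i.
    by move=> /Pk1 jk; apply: Hu.
  apply: (new_D_eq ki (gr_bounded Hb')).
    by rewrite -uk; apply: (fam_ext fB) eP Hc1.1.
  have -> : D i b' - c' = (c - c') - D i (b - b').
    by rewrite (der_B _ _ (dD ki)) eD opprB [RHS]addrC addrA subrK.
  apply: (filt_B fB); first by rewrite -uk; apply: (filt_ext fB eP (fsub Hf')).
  by rewrite addrAC; apply: filt_der.
- move=> i /PN[->|Pi]; rewrite /new_y /new_yi; first by rewrite eqxx xk_invK inv_kK.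
  by rewrite PkF //; apply: (st_yK st).
- move=> i j /PN[->|Pi] /PN[->|Pj]; rewrite /new_y ?eqxx ?PkF //.
  + by rewrite S_diag expr0z scale1r.
  + by have [[_ ->] _] := bideg_y Pj.
  + exact: (st_yX st).
  + exact: (st_yy st).
- move=> i j /PN[->|Pi] kj; rewrite /new_y ?eqxx ?PkF //; have [[[[_ e] H] _] _ _] := HX' kj => //.
  by have [] := H i Pi.
- by move=> i /PN[->|Pi]; rewrite /new_E ?eqxx ?PkF //; [apply: Ek_der | apply: (st_derE st)].
- move=> i j /PN[->|Pi] /PN[->|Pj]; rewrite /new_E /new_y ?eqxx ?PkF //.
  + by rewrite S_diag Ek_xk scale0r.
  + exact: Ek_y.
  + exact: (st_EX st).
  + exact: (st_Ey st).
- move=> i j /PN[->|Pi] kj; rewrite /new_E ?eqxx ?PkF //; have [[[[e _] H] _] _ _] := HX' kj => //.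
  by have [] := H i Pi.
- move=> i j ki /PN[->|Pj]; rewrite /new_y ?eqxx ?PkF //.
    have [w Hw e] := D_xk_eq ki.
    apply: (new_D_y (v := fun i => S i k) (d := 0) (w := w) ki).
    + by split; [apply: bideg_xk | move=> i' ki'; have [] := Hn k ki'].
    + by rewrite e (st_central st (ltnW ki)).
    + by rewrite add0r.
  apply: (new_D_y (v := fun i => S i j) (d := S k j) (w := 0) ki).
  + by split; [apply: bideg_y | move=> i' ki'; have [_ _ /(_ Pj)] := Hn j ki'].
  + by rewrite addr0; apply: (st_Dy st) => //; apply: ltnW.
  + exact: filt_0.
Qed.

(** ** Comparison of the two algebras *)
Definition new_deg (v : 'I_M -> int) (d : int) (i : 'I_M) : int := if i == k then d else v i.
Definition new_galg v d b := galg new_P k.+1 new_P X' new_y new_yi (new_deg v d) b.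

Let degE v d i : P i -> new_deg v d i = v i. Proof. by move=> Pi; rewrite /new_deg PkF. Qed.
Let degk v d : new_deg v d k = d. Proof. by rewrite /new_deg eqxx. Qed.

Lemma new_galg_family : eigen_family Ek P new_galg.
Proof.
split.
- move=> v d b H; have Nk : new_P k by rewrite /new_P eqxx.
  by have [e _] := galg_degree stage_next Nk H; move: e; rewrite /new_E eqxx degk.
- move=> v w d b e; apply: ga_ext => i /orP[/eqP->|Pi]; first by rewrite !degk.
  by rewrite !degE // e.
- by move=> v d; apply: ga_0.
- by move=> v d a b; apply: ga_add.
- by move=> v d c b; apply: ga_scale.
- move=> v d w e a b Ha Hb; apply: ga_mul Ha Hb _ => i _.
  by rewrite /new_deg; case: ifP.
Qed.
Let fC := new_galg_family.

Lemma new_galg_graph v a b : graph X' k.+1 v a b -> new_galg v (v k) b.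
Proof.
move=> H; have Nk i : new_P i -> (i < k.+1)%N by apply: (st_P stage_next).
apply: ga_ext (@ga_graph new_P _ new_P _ _ _ _ _ _ Nk H) => i _.
by rewrite /new_deg; case: eqP => [->|].
Qed.

Lemma new_galg_invk p : new_galg (fun i => - (p%:Z * S i k)) 0 (xi ^+ p).
Proof.
have H : new_galg (fun i => - S i k) 0 xi.
  have := @ga_yi new_P k.+1 new_P X' new_y new_yi k; rewrite /new_yi eqxx; apply.
    by rewrite /new_P eqxx.
  move=> i /orP[/eqP->|Pi]; first by rewrite degk S_diag oppr0.
  by rewrite degE.
apply: (ga_ext _ (ga_exp p H)) => i _; rewrite /new_deg; case: ifP; first by rewrite mulr0.
by rewrite mulrN.
Qed.

Definition bideg_galg v d b := bideg v d b /\ new_galg v d b.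

Lemma bideg_galg_family : eigen_family Ek P bideg_galg.
Proof.
split.
- by move=> v d b [[[]]].
- by move=> v w d b e [H1 H2]; split; [apply: (fam_ext fB) H1|apply: (fam_ext fC) H2].
- by move=> v d; split; [apply: (fam_0 fB)|apply: (fam_0 fC)].
- by move=> v d a b [H1 H2] [H3 H4]; split; [apply: (fam_D fB)|apply: (fam_D fC)].
- by move=> v d c b [H1 H2]; split; [apply: (fam_Z fB)|apply: (fam_Z fC)].
- by move=> v d w e a b [H1 H2] [H3 H4]; split; [apply: (fam_M fB)|apply: (fam_M fC)].
Qed.

(** The lowest component at each step of [chain_filt] is the specialisation of the same
    element of the chain at the new variables, by uniqueness of lowest components. *)
Lemma X_new_galg (j : 'I_M) : (k < j)%N -> filt new_galg sgk (fun i => S i j) (S k j) (X j).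
Proof.
move=> kj; have [a [al [a0 Ha al0 Hal]]] := chain_exists kj.
have H := chain_filt kj Ha al0 Hal bideg_galg_family (fun _ _ _ H => H.1)
   (fun p => conj (bideg_invk p) (new_galg_invk p)) _ 0%N.
rewrite (chain_al0 kj a0 Hal) /chain_kdeg mulr0 addr0 in H.
suff H2 : filt bideg_galg sgk (chain_vdeg j 0) (S k j) (X j).
  apply: (filt_ext fC (v := chain_vdeg j 0)); first by move=> i _; rewrite /chain_vdeg mul0r addr0.
  by apply: filt_sub H2 => ? ? ? [].
apply: H => m b Hb Hab; split=> //.
have vk : chain_vdeg j m k = S k j + sg k * m%:Z.
  by rewrite /chain_vdeg eqxx S_diag add0r mul1r mulrC.
have [b' Hb'] : exists b', graph X' k.+1 (chain_vdeg j m) (a m) b'.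
  by apply: gr_total (gr_hs (Hal m)); apply: (st_unit stage_next).
have [b1 [Hb1 [Hb1' _] Hf]] := gr_lift Hb'.
have eb1 : b1 = al m := gr_funct st (gr_weak (leqnSn k) Hb1) (gr_weak (leqnSn k) (Hal m)).
rewrite eb1 vk in Hf; rewrite vk in Hb1'.
have -> : al m - b = b'.
  apply: (filt_lowest char0 Ek_der fB sgk0 Hab Hb1' (a := al m)); last exact: fsub.
  have -> : al m - (al m - b) = b by rewrite opprB addrC subrK.
  by apply: filt_sub Hb => ? ? ? [].
by have := new_galg_graph Hb'; rewrite vk.
Qed.

(** The degrees along [k] of the generators need not be congruent modulo [sgk], so the
    filtration has step 1 from here on. *)
Lemma filt1_le v d d' b : d' <= d -> filt new_galg 1 v d b -> filt new_galg 1 v d' b.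
Proof.
move=> dd' H; apply: (filt_shiftn fC (n := `|d - d'|%N)); rewrite mul1r.
by have -> : d' + `|d - d'|%N%:Z = d by lia.
Qed.

Lemma ga_new_galg v b : galg P k P X y yi v b -> exists lo, filt new_galg 1 v lo b.
Proof.
elim=> {v b}.
- move=> j v kj Hv; have eV i : P i -> S i j = v i by move=> Pi; rewrite Hv.
  have [/val_inj e|neq] := eqVneq (j : nat) k.
    exists 0; apply: filt_X; have := @ga_y new_P k.+1 new_P X' new_y new_yi k (new_deg v 0).
    rewrite /new_y eqxx e; apply; first by rewrite /new_P eqxx.
    by move=> i /orP[/eqP->|Pi]; rewrite ?degk ?S_diag ?degE // -eV // e.
  have kj' : (k < j)%N by rewrite ltn_neqAle eq_sym neq kj.
  have [m Hm] := filt_ext fC eV (X_new_galg kj').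
  elim: m (S k j) (X j) Hm => [|m IH] d b; first by move=> /= ->; exists 0; apply: filt_0.
  move=> [b0 [b1 [-> H0 H1]]]; have [lo Hlo] := IH _ _ H1; exists (Num.min lo d).
  apply: (filt_D fC); last by apply: filt1_le Hlo; rewrite ge_min lexx.
  by apply: (filt1_le (d := d)); [rewrite ge_min lexx orbT | apply: filt_X].
- move=> j v b kj kk Hv e1 e2; have eV i : P i -> - S i j = v i by move=> Pi; rewrite Hv.
  have [/val_inj e|neq] := eqVneq (j : nat) k.
    have -> : b = xi by rewrite -[b]mulr1 -xk_invK mulrA -e e2 mul1r.
    exists 0; apply: filt_X; have := @ga_yi new_P k.+1 new_P X' new_y new_yi k (new_deg v 0).
    rewrite /new_yi eqxx; apply; first by rewrite /new_P eqxx.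
    by move=> i /orP[/eqP->|Pi]; rewrite ?degk ?S_diag ?oppr0 ?degE // -eV // e.
  have kj' : (k < j)%N by rewrite ltn_neqAle eq_sym neq kj.
  have [_ _ /(_ kk) eX] := HX' kj'.
  exists (- S k j); apply: filt_X; apply: (ga_Xi kj' kk); rewrite ?eX //.
  by move=> i /orP[/eqP->|Pi]; rewrite ?degk ?degE // eV.
- move=> j v Pj Hv; exists (S k j); apply: filt_X.
  have := @ga_y new_P k.+1 new_P X' new_y new_yi j (new_deg v (S k j)).
  rewrite /new_y PkF //; apply; first by rewrite /new_P Pj orbT.
  by move=> i /orP[/eqP->|Pi]; rewrite ?degk ?degE // Hv.
- move=> j v Pj Hv; exists (- S k j); apply: filt_X.
  have := @ga_yi new_P k.+1 new_P X' new_y new_yi j (new_deg v (- S k j)).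
  rewrite /new_yi PkF //; apply; first by rewrite /new_P Pj orbT.
  by move=> i /orP[/eqP->|Pi]; rewrite ?degk ?degE // Hv.
- move=> c v Hv; exists 0; apply: filt_X; apply: ga_sc.
  by move=> i /orP[/eqP->|Pi]; rewrite ?degk ?degE // Hv.
- move=> v a b _ [d Ha] _ [e Hb]; exists (Num.min d e); apply: (filt_D fC).
    by apply: filt1_le Ha; rewrite ge_min lexx.
  by apply: filt1_le Hb; rewrite ge_min lexx orbT.
- move=> v w u a b _ [d Ha] _ [e Hb] Hu; exists (d + e).
  by apply: (filt_ext fC _ (filt_M fC Ha Hb)) => i Pi; rewrite Hu.
- by move=> v; exists 0; apply: filt_0.
Qed.

Local Notation A' := (alg k.+1 new_P X' new_y new_yi).
Let sA' : subring A' := alg_subring _ _ _ _ _.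

Lemma filt_alg v d b : filt new_galg 1 v d b -> A' b.
Proof.
apply: filt_ind; first exact: ga_0.
  by move=> a c; apply: ga_add.
by move=> n' c; apply: ga_alg.
Qed.

Lemma alg_incl b : alg k P X y yi b -> A' b.
Proof.
have incl v c : galg P k P X y yi v c -> A' c by move=> /ga_new_galg[lo]; apply: filt_alg.
suff H v : galg pred0 k P X y yi v b -> A' b by apply: H.
elim=> {v b}.
- by move=> j v kj _; apply: (incl (fun i => S i j)); apply: ga_X.
- by move=> j v b kj kk _ e1 e2; apply: (incl (fun i => - S i j)); apply: (ga_Xi kj kk).
- by move=> j v Pj _; apply: (incl (fun i => S i j)); apply: ga_y.
- by move=> j v Pj _; apply: (incl (fun i => - S i j)); apply: ga_yi.
- by move=> c v _; apply: ga_sc.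
- by move=> v a b _ Ha _ Hb; apply: ga_add.
- by move=> v w u a b _ Ha _ Hb _; apply: ga_mul Ha Hb _.
- by move=> v; apply: ga_0.
Qed.

(** The lowest component of a power is the power of the lowest component, which is
    therefore nilpotent; once it lies in a nilpotent ideal it can be subtracted. *)
Lemma nilpotent_new_galg n' v d b : eigensum new_galg 1 n' v d b -> nil_prop k.+1 ->
  (exists r, b ^+ r = 0) -> strongly_nil A' b.
Proof.
move=> + cl; elim: n' d b => [|n' IH] d b; first by move=> /= -> _; apply: strongly_nil0.
move=> [b0 [b1 [eb H0 H1]]] [r br].
have Hb : filt new_galg 1 v d b by exists n'.+1, b0, b1.
have f1 : filt new_galg 1 v (d + 1) b1 by exists n'.
have pow m : filt new_galg 1 (fun i => m%:Z * v i) (m%:Z * d + 1) (b ^+ m - b0 ^+ m) /\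
    new_galg (fun i => m%:Z * v i) (m%:Z * d) (b0 ^+ m).
  elim: m => [|m [IH1 IH2]].
    rewrite subrr; split; first exact: filt_0.
    by apply: ga_1 => i _; rewrite /new_deg !mul0r; case: ifP.
  have -> : b ^+ m.+1 - b0 ^+ m.+1 = b * (b ^+ m - b0 ^+ m) + b1 * b0 ^+ m.
    have -> : b1 = b - b0 by rewrite eb addrC addKr.
    by rewrite !exprS mulrBr mulrBl addrA subrK.
  have e i : P i -> v i + m%:Z * v i = m.+1%:Z * v i by move=> _; rewrite intS; ring.
  split; last first.
    rewrite exprS (_ : m.+1%:Z * d = d + m%:Z * d); last by rewrite intS; ring.
    exact: (fam_ext fC e (fam_M fC H0 IH2)).
  apply: (filt_D fC).
    rewrite (_ : m.+1%:Z * d + 1 = d + (m%:Z * d + 1)); last by rewrite intS; ring.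
    exact: (filt_ext fC e (filt_M fC Hb IH1)).
  rewrite (_ : m.+1%:Z * d + 1 = d + 1 + m%:Z * d); last by rewrite intS; ring.
  exact: (filt_ext fC e (filt_M fC f1 (filt_X 1 IH2))).
have [Hr Hr0] := pow r.
have b0r : b0 ^+ r = 0.
  apply: (filt_eigen0 char0 Ek_der fC (oner_neq0 _) (d := r%:Z * d)); last exact: (fam_E fC Hr0).
  by have := filt_N fC Hr; rewrite br sub0r opprK; apply.
have s0 : strongly_nil A' b0 by apply: (cl _ _ _ _ _ _ stage_next _ _ H0); exists r.
have Ab := filt_alg Hb; have Ab0 : A' b0 := ga_alg H0.
have Ab1 : A' b1 := filt_alg f1.
rewrite eb; apply: strongly_nilD => //; apply: (IH _ _ H1).
apply: (nilpotent_modulo sA' Ab1 Ab); last by exists r.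
have -> : b1 - b = (-1) * b0 by rewrite eb opprD addrCA subrr addr0 mulN1r.
by apply: strongly_nilMl => //; apply: (subr_N sA'); apply: (subr_1 sA').
Qed.

Lemma nil_prop_unit v b : nil_prop k.+1 -> galg P k P X y yi v b -> (exists r, b ^+ r = 0) ->
  strongly_nil (alg k P X y yi) b.
Proof.
move=> cl Hb nb; have [lo [m Hm]] := ga_new_galg Hb.
apply: (strongly_nil_sub (alg_subring _ _ _ _ _) alg_incl); first exact: ga_alg Hb.
exact: nilpotent_new_galg Hm cl nb.
Qed.

End Bounded.
End NewVariables.

Lemma nil_prop_step_unit v b : nil_prop k.+1 -> galg P k P X y yi v b -> (exists r, b ^+ r = 0) ->
  strongly_nil (alg k P X y yi) b.
Proof.
have [X' HX'] := lowest_exists; have [n Hn] := uniform_bound HX'.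
exact: (nil_prop_unit HX' Hn).
Qed.

End Deletion.

(** * Quantum tori *)
Lemma torus_unit (P : pred 'I_M) X y yi (yK : forall i, P i -> y i * yi i = 1 /\ yi i * y i = 1) v b :
  galg P M P X y yi v b -> b = 0 \/ exists u ui : Q,
    [/\ galg P M P X y yi v u, galg P M P X y yi (fun i => - v i) ui, u * ui = 1 & ui * u = 1].
Proof.
elim=> {v b}.
- by move=> j v Mj; have := ltn_ord j; rewrite ltnNge Mj.
- by move=> j v b Mj; have := ltn_ord j; rewrite ltnNge Mj.
- move=> j v Pj Hv; right; have [e1 e2] := yK j Pj; exists (y j), (yi j); split=> //.
    exact: ga_y.
  by apply: ga_yi => // i Pi; rewrite Hv.
- move=> j v Pj Hv; right; have [e1 e2] := yK j Pj; exists (yi j), (y j); split=> //.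
    exact: ga_yi.
  by apply: ga_y => // i Pi; rewrite Hv // opprK.
- move=> c v Hv; right; exists 1, 1; rewrite mulr1; split=> //; first exact: ga_1.
  by apply: ga_1 => i Pi; rewrite Hv ?oppr0.
- by move=> v a b _ [->|Ha] _ Hb; [rewrite add0r | right].
- move=> v w u a b _ [->|[s [si [s1 s2 s3 s4]]]] _; first by left; rewrite mul0r.
  case=> [->|[t [ti [t1 t2 t3 t4]]]] Hu; first by left; rewrite mulr0.
  right; exists (s * t), (ti * si); split.
  + exact: ga_mul s1 t1 Hu.
  + by apply: ga_mul t2 s2 _ => i Pi; rewrite Hu // opprD addrC.
  + by rewrite mulrA -(mulrA s) t3 mulr1.
  + by rewrite mulrA -(mulrA ti) s4 mulr1.
- by move=> v; left.
Qed.

(** Dividing [b] by a unit [u] of the same degree gives an element of degree 0, which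
    commutes with the generators; being nilpotent, it generates a nilpotent ideal. *)
Lemma nil_prop_torus : nil_prop M.
Proof.
move=> P X D y yi E st v b Hb [n bn].
have sA := alg_subring M P X y yi.
have [->|[u [ui [Hu Hui uui uiu]]]] := torus_unit (st_yK st) Hb; first exact: strongly_nil0.
set c := ui * b.
have Hc : galg P M P X y yi (fun=> 0) c by apply: ga_mul Hui Hb _ => i Pi; rewrite addNr.
have cC w a : galg pred0 M P X y yi w a -> c * a = a * c.
  have yc i : P i -> c * y i = y i * c.
    by move=> Pi; have [_ ->] := galg_degree st Pi Hc; rewrite expr0z scale1r.
  elim=> {w a}.
  - by move=> j w Mj; have := ltn_ord j; rewrite ltnNge Mj.
  - by move=> j w a Mj; have := ltn_ord j; rewrite ltnNge Mj.
  - by move=> j w Pj _; apply: yc.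
  - move=> j w Pj _; have [e1 e2] := st_yK st Pj.
    by rewrite -[c in LHS]mul1r -e2 -(mulrA (yi j)) -yc // -!mulrA e1 mulr1.
  - by move=> a w _; rewrite -scalerAl -scalerAr mulr1 mul1r.
  - by move=> w a1 a2 _ IH1 _ IH2; rewrite mulrDr mulrDl IH1 IH2.
  - by move=> w1 w2 w3 a1 a2 _ IH1 _ IH2 _; rewrite mulrA IH1 -mulrA IH2 mulrA.
  - by move=> w; rewrite mulr0 mul0r.
have Ac : alg M P X y yi c := ga_alg Hc.
have Au : alg M P X y yi u := ga_alg Hu.
have eb : b = c * u by rewrite (cC _ _ Au) /c mulrA uui mul1r.
have cn : c ^+ n = 0.
  have := bn; rewrite eb exprMn_comm; last exact: cC Au.
  move/(congr1 (fun a => a * ui ^+ n)); rewrite mul0r -mulrA.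
  suff -> : u ^+ n * ui ^+ n = 1 by rewrite mulr1.
  by rewrite -exprMn_comm ?uui ?expr1n // /GRing.comm uui uiu.
exists (fun d => exists2 a, alg M P X y yi a & d = c * a); split; last by exists u.
split; last first.
  exists n => t szt Ht.
  have [a ->] : exists a, \prod_(d <- t) d = c ^+ size t * a.
    elim: t Ht {szt} => [|d t IH] /=; first by exists 1; rewrite big_nil mulr1.
    move=> /all_in_cons[[a Aa ->] /IH[a' e]]; exists (a * a').
    have cX m : a * c ^+ m = c ^+ m * a.
      by apply: commrX; symmetry; apply: cC Aa.
    by rewrite big_cons e exprS -!mulrA (mulrA a (c ^+ _)) cX -!mulrA.
  by rewrite szt cn mul0r.
split.
- by move=> _ [a Aa ->]; apply: (subr_M sA).
- by exists 0; [apply: (subr_0 sA) | rewrite mulr0].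
- by move=> _ _ [a Aa ->] [a' Aa' ->]; exists (a + a'); [apply: (subr_D sA)|rewrite mulrDr].
- move=> d _ Ad [a Aa ->]; exists (d * a); first exact: (subr_M sA).
  by rewrite mulrA -(cC _ _ Ad) mulrA.
- by move=> _ d [a Aa ->] Ad; exists (a * d); [apply: (subr_M sA)|rewrite mulrA].
Qed.

(** * A variable whose [l]-th power vanishes *)
Section Vanishing.
Variables (k : 'I_M) (P : pred 'I_M) (X : 'I_M -> Q) (D : 'I_M -> Q -> Q)
    (y yi : 'I_M -> Q) (E : 'I_M -> Q -> Q).
Hypothesis st : stage k P X D y yi E.
Hypothesis z0 : X k ^+ l = 0.
Hypothesis cl : nil_prop k.+1.
Local Notation xk := (X k).

Lemma stage_weak : stage k.+1 P X D y yi E.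
Proof.
have w (j : 'I_M) : (k.+1 <= j)%N -> (k <= j)%N by apply: ltnW.
split.
- by move=> i /(st_P st)/ltnW.
- by move=> j kj; apply: (st_unit st); apply: w.
- by move=> v b /(gr_weak (leqnSn k)); apply: (st_fun st).
- by move=> j /w; apply: (st_central st).
- by move=> j /w; apply: (st_derD st).
- move=> i v u a b c d /w ki Hb Hc Hu e.
  apply: (st_DG st ki (gr_weak (leqnSn k) Hb) (gr_weak (leqnSn k) Hc) _ e).
  by move=> j jk; apply: Hu; apply: ltnW.
- exact: (st_yK st).
- exact: (st_yy st).
- by move=> i j Pi /w; apply: (st_yX st).
- exact: (st_derE st).
- exact: (st_Ey st).
- by move=> i j Pi /w; apply: (st_EX st).
- by move=> i j /w; apply: (st_Dy st).
Qed.

Local Notation A0 := (alg k.+1 P X y yi).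
Local Notation A := (alg k P X y yi).
Let sA0 : subring A0 := alg_subring _ _ _ _ _.
Let sA : subring A := alg_subring _ _ _ _ _.

Lemma k_notin_kappa : k \notin kappa.
Proof.
apply/negP => kk; have [b [e1 e2]] := st_unit st (leqnn k) kk.
have : xk ^+ l * b ^+ l = 1 by rewrite -exprMn_comm ?e1 ?expr1n // /GRing.comm e1 e2.
by rewrite z0 mul0r => /eqP; rewrite eq_sym oner_eq0.
Qed.

(** The commutator of [x k ^+ l] and [x j ^+ l] also computes the value of [D j] at
    [X k ^+ l = 0]. *)
Lemma D_k_vanish (j : 'I_M) : (k < j)%N -> D k (X j ^+ l) = 0.
Proof.
move=> kj; have Hj : graph X k (fun i => S i j) (x j) (X j) by apply: gr_gen (ltnW kj) _.
have Hk : graph X k (fun i => S i k) (x k) xk by apply: gr_gen.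
have [w [Hw e]] := comm_exists (leqnn k) (gr_hs (gr_exp l Hj)).
have [W HW] := gr_total (st_unit st) Hw.
rewrite (st_DG st (leqnn k) (gr_exp l Hj) HW _ e) //.
have e' : x j ^+ l * x k ^+ l - x k ^+ l * x j ^+ l = h *: - w by rewrite scalerN -e opprB.
have := st_DG st (ltnW kj) (gr_exp l Hk) (gr_opp HW) _ e'.
rewrite z0 (der_0 (st_derD st (ltnW kj))) => H; apply/eqP; rewrite -oppr_eq0 -H //.
by move=> i ik; rewrite addrC.
Qed.

Section VanishingChain.
Variables (j : 'I_M) (a : nat -> R) (al : nat -> Q).
Hypothesis kj : (k < j)%N.
Hypothesis a0 : a 0%N = x j.
Hypothesis Ha : forall m : nat, x k * a m = q ^ (S k j + sg k * m%:Z) *: (a m * x k) + a m.+1.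
Hypothesis al0 : forall m, (l <= m)%N -> a m = 0.
Hypothesis Hal : forall m, graph X k.+1 (chain_vdeg k j m) (a m) (al m).
Hypothesis l1 : (1 < l)%N.

Let la := q ^ S k j.
Let rho := q ^ sg k.
(* The quantum factorial of [l - 1] divided by that of [m]: divided powers are taken
   without denominators. *)
Let g m := \prod_(m.+1 <= i < l) qint rho i.

Let gS m : (m.+1 < l)%N -> g m = qint rho m.+1 * g m.+1.
Proof. by move=> ml; rewrite /g big_ltn. Qed.

Let g_neq0 m : ev (g m) != 0.
Proof.
rewrite /g rmorph_prod big_seq; elim/big_ind: _ => [|u v u0 v0|i].
- exact: oner_neq0.
- by rewrite mulf_neq0.
rewrite mem_index_iota => /andP[mi il]; apply: (qint_ev_neq0 sp (hc_cop hc k)).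
by apply/negP => /dvdn_leq -/(_ (leq_trans (ltn0Sn m) mi)); rewrite leqNgt il.
Qed.

(** [word p n] is the coefficient of degree [n] in the [p]-th power of the divided
    power series of the chain: up to a scalar it is the [n]-th iterate of the skew
    derivation at [x j ^+ p], divided by a quantum factorial. *)
Fixpoint word (p n : nat) : R :=
  match p with
  | 0 => if n == 0%N then 1 else 0
  | p'.+1 => \sum_(0 <= m < n.+1) (la ^+ (n - m) * g m) *: (a m * word p' (n - m))
  end.
Fixpoint wordQ (p n : nat) : Q :=
  match p with
  | 0 => if n == 0%N then 1 else 0
  | p'.+1 => \sum_(0 <= m < n.+1) (ev (la ^+ (n - m) * g m)) *: (al m * wordQ p' (n - m))
  end.

Let wdeg (p n : nat) (i : 'I_M) : int :=
  p%:Z * S i j + n%:Z * (S i k + (i == k)%:Z * sg k).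

Lemma word_graph p n : graph X k.+1 (wdeg p n) (word p n) (wordQ p n).
Proof.
elim: p n => [|p IH] n /=.
  case: eqP => [->|_]; last exact: gr_0.
  by apply: gr_1 => i _; rewrite /wdeg !mul0r addr0.
apply: gr_sum => m; rewrite mem_index_iota ltnS => /andP[_ mn]; apply: gr_scale.
apply: gr_mul (Hal m) (IH (n - m)%N) _ => i _.
rewrite /wdeg /chain_vdeg intS (_ : (n - m)%N%:Z = n%:Z - m%:Z); last by lia.
by ring.
Qed.

(** For divided powers the Leibniz rule becomes additive: differentiating the word of
    degree [n] gives [qint rho n.+1] times the one of degree [n.+1]. *)
Lemma word_comm p n : x k * word p n =
  (la ^+ p * rho ^+ n) *: (word p n * x k) + qint rho n.+1 *: word p n.+1.
Proof.
elim: p n => [|p IH] n /=.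
  rewrite scaler0 addr0 expr0 mul1r; case: eqP => [->|_].
    by rewrite expr0 scale1r mulr1 mul1r.
  by rewrite mulr0 mul0r scaler0.
have Ha' m : x k * a m = (la * rho ^+ m) *: (a m * x k) + a m.+1.
  by rewrite Ha exprzDr ?(sp_unit sp) // -exprz_exp -exprnP.
pose f1 m := (la ^+ (n - m) * g m) *: (a m * word p (n - m)%N).
pose f2 m := (la ^+ (n.+1 - m) * rho ^+ m * qint rho (n.+1 - m) * g m) *: (a m * word p (n.+1 - m)%N).
pose f3 m := (la ^+ (n.+1 - m) * qint rho m * g m) *: (a m * word p (n.+1 - m)%N).
have -> : x k * \sum_(0 <= m < n.+1) f1 m = \sum_(0 <= m < n.+1)
    ((la ^+ p.+1 * rho ^+ n) *: (f1 m * x k) + (f2 m + f3 m.+1)).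
  rewrite mulr_sumr; apply: eq_big_nat => m /andP[_ mn]; rewrite ltnS in mn.
  rewrite /f1 /f2 /f3 -scalerAr mulrA Ha' mulrDl -scalerAl -(mulrA (a m) (x k)) IH mulrDr.
  rewrite !scalerDr -addrA; congr (_ + (_ + _)).
  - rewrite -!scalerAr -!scalerAl !scalerA; congr (_ *: _); last exact: mulrA.
    have -> : rho ^+ n = rho ^+ m * rho ^+ (n - m) by rewrite -exprD subnKC.
    by rewrite exprS; ring.
  - rewrite -!scalerAr !scalerA subSn //; congr (_ *: _).
    by rewrite exprS; ring.
  - rewrite subSS; have [ml|lm] := ltnP m.+1 l.
      by rewrite gS // -mulrA.
    by rewrite al0 // mul0r !scaler0.
rewrite big_split /= -scaler_sumr -mulr_suml; congr (_ + _).
rewrite big_split /= scaler_sumr.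
have e2 : \sum_(0 <= m < n.+1) f2 m = \sum_(0 <= m < n.+2) f2 m.
  by rewrite [RHS]big_nat_recr //= /f2 subnn [qint rho 0]big_ord0 mulr0 mul0r scale0r addr0.
have e3 : \sum_(0 <= m < n.+1) f3 m.+1 = \sum_(0 <= m < n.+2) f3 m.
  by rewrite [RHS]big_nat_recl //= /f3 [qint rho 0]big_ord0 mulr0 mul0r scale0r add0r.
rewrite e2 e3 -big_split; apply: eq_big_nat => m /andP[_ mn]; rewrite ltnS in mn.
rewrite /f2 /f3 /= -scalerDl scalerA; congr (_ *: _).
have -> : qint rho n.+1 = qint rho m + rho ^+ m * qint rho (n.+1 - m) by rewrite -qintD subnKC.
by ring.
Qed.

Lemma wordQ_comm p n : xk * wordQ p n =
  (ev (la ^+ p * rho ^+ n)) *: (wordQ p n * xk) + ev (qint rho n.+1) *: wordQ p n.+1.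
Proof.
have H n' := gr_weak (leqnSn k) (word_graph p n').
have gk : graph X k (fun i => S i k) (x k) xk by apply: gr_gen.
have kF (i : 'I_M) : (i < k)%N -> (i == k)%:Z = 0.
  by move=> ik; case: eqP => // e; move: ik; rewrite e ltnn.
apply: (gr_funct st (v := wdeg p n.+1) (a := x k * word p n)).
  by apply: gr_mul gk (H n) _ => i ik; rewrite /wdeg kF // intS; ring.
rewrite word_comm; apply: gr_add; last exact: gr_scale.
apply: gr_scale; apply: gr_mul (H n) gk _ => i ik.
by rewrite /wdeg kF // intS; ring.
Qed.

(** Start from a word of degree [l * n] whose image is central and killed by [D k].
    Applying [chain_comm] to the words of degrees [l * n + m], the last term
    [m = l] is divisible by [h], with a quotient that is a nonzero multiple of the word of
    degree [l * n.+1] ([qint_mult]), and the terms in between vanish by centrality.  So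
    that word is zero.  The start [n = 0] is a multiple of [X j ^+ l]. *)
Lemma wordQ_vanish r : (0 < r)%N -> wordQ l (l * r) = 0.
Proof.
have cop := hc_cop hc k.
have step n : central (wordQ l (l * n)) -> D k (wordQ l (l * n)) = 0 -> wordQ l (l * n.+1) = 0.
  move=> Cn Dn.
  (* the iterates of the skew derivation at [word l (l * n)], by [word_comm] *)
  pose pr m := \prod_(0 <= t < m) qint rho (l * n + t).+1.
  pose c m := pr m *: word l (l * n + m).
  have Hc m : x k * c m = q ^ ((l%:Z * S k j + sg k * (l * n)%:Z) + sg k * m%:Z) *: (c m * x k) + c m.+1.
    rewrite /c -scalerAr word_comm scalerDr -scalerAl !scalerA; congr (_ *: _ + _ *: word _ _).
    - rewrite mulrC; congr (_ * _).
      rewrite !exprzDr ?(sp_unit sp) // /la /rho exprD !exprnP !exprz_exp.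
      by rewrite [S k j * _]mulrC PoszM mulrA.
    - by rewrite /pr big_nat_recr.
    - by rewrite addnS.
  have [th [be [evth H]]] := chain_comm sp R (l%:Z * S k j + sg k * (l * n)%:Z) cop.
  have {H}e := H _ _ Hc.
  have [gm [egm gm0]] := qint_mult sp cop l1 (r := n.+1) isT.
  pose gam := \prod_(0 <= t < l.-1) qint rho (l * n + t).+1 * gm.
  have ecl : c l = h *: (gam *: word l (l * n.+1)).
    rewrite /c (_ : l * n + l = l * n.+1)%N; last by rewrite mulnS addnC.
    rewrite scalerA; congr (_ *: _); rewrite /pr /gam -{1}(prednK l0) big_nat_recr //=.
    by rewrite -addnS prednK // addnC -mulnS egm mulrCA.
  have gam0 : ev gam != 0.
    rewrite /gam rmorphM mulf_neq0 // rmorph_prod big_seq; elim/big_ind: _ => [|u v u0 v0|t].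
    - exact: oner_neq0.
    - by rewrite mulf_neq0.
    rewrite mem_index_iota => /andP[_ tl]; apply: (qint_ev_neq0 sp cop).
    rewrite -addnS dvdn_addr ?dvdn_mulr //; apply/negP => /dvdn_leq -/(_ isT).
    by move: tl l0; lia.
  rewrite ecl -scalerDr in e.
  have Hw m := gr_weak (leqnSn k) (word_graph l (l * n + m)).
  have e0 : c 0%N = word l (l * n) by rewrite /c /pr big_nil scale1r addn0.
  rewrite e0 in e.
  have kF (i : 'I_M) : (i < k)%N -> (i == k)%:Z = 0.
    by move=> ik; case: eqP => // ei; move: ik; rewrite ei ltnn.
  have gx p : graph X k (fun i => p%:Z * S i k) (x k ^+ p) (xk ^+ p).
    by apply: gr_exp; apply: gr_gen.
  have G1 : graph X k (fun i => wdeg l (l * n) i + l%:Z * S i k)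
     (th *: (word l (l * n) * x k ^+ l) + \sum_(1 <= m < l) be m *: (c m * x k ^+ (l - m)) + gam *: word l (l * n.+1))
     (ev th *: (wordQ l (l * n) * xk ^+ l) + \sum_(1 <= m < l) ev (be m) *: ((ev (pr m) *: wordQ l (l * n + m)) * xk ^+ (l - m)) + ev gam *: wordQ l (l * n.+1)).
    apply: gr_add; first apply: gr_add.
    + apply: gr_scale; have := Hw 0%N; rewrite addn0 => Hw0.
      by apply: gr_mul Hw0 (gx l) _.
    + apply: gr_sum => m; rewrite mem_index_iota => /andP[m1 ml]; apply: gr_scale.
      apply: gr_mul (gr_scale _ (Hw m)) (gx (l - m)%N) _ => i ik.
      rewrite /wdeg kF // (_ : (l - m)%N%:Z = l%:Z - m%:Z); last by lia.
      by rewrite PoszD; ring.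
    + apply: gr_scale; have := Hw l; rewrite (_ : l * n + l = l * n.+1)%N; last by rewrite mulnS addnC.
      apply: gr_ext => i ik; rewrite /wdeg kF // mulnS PoszD; ring.
  (* for [m = 1] by centrality, since the commutation factor is an [l]-th power *)
  have kap m : (0 < m < l.+1)%N -> (ev (pr m)) *: wordQ l (l * n + m) = 0.
    elim: m => // m IH /andP[_ ml]; rewrite /pr big_nat_recr //= -/(pr m) rmorphM -scalerA.
    case: m IH ml => [|m] IH ml.
      rewrite /pr big_nil rmorph1 scale1r addn0 addn1.
      have := wordQ_comm l (l * n); rewrite Cn.
      suff -> : ev (la ^+ l * rho ^+ (l * n)) = 1.
        by rewrite scale1r -[X in X = _]addr0 => /addrI <-.
      rewrite rmorphM !rmorphXn !(ev_qX sp) !exprnP !exprz_exp PoszM.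
      have el : eps ^ l%:Z = 1 by rewrite -exprnP (prim_expr_order (sp_prim sp)).
      rewrite (_ : S k j * l%:Z = l%:Z * S k j) 1?mulrC //.
      rewrite (_ : sg k * (l%:Z * n%:Z) = l%:Z * (sg k * n%:Z)); last by ring.
      by rewrite -!(exprz_exp _ l%:Z) el !exp1rz mulr1.
    have IH' := IH (ltnW ml).
    have := congr1 (fun u => ev (pr m.+1) *: u) (wordQ_comm l (l * n + m.+1)).
    rewrite /= scalerDr scalerAr IH' mulr0 scalerA [_ * ev (la ^+ _ * _)]mulrC -scalerA.
    by rewrite [ev (pr _) *: (_ * xk)]scalerAl IH' mul0r scaler0 add0r (addnS _ m.+1) => <-.
  have Hw0 := Hw 0%N; rewrite addn0 in Hw0.
  have := st_DG st (leqnn k) Hw0 G1 (fun _ _ => erefl) e.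
  rewrite Dn z0 mulr0 scaler0 add0r big1_seq ?add0r; last first.
    move=> m /andP[_]; rewrite mem_index_iota => /andP[m1 ml].
    by rewrite kap ?mul0r ?scaler0 // m1 ltnW.
  by move=> /esym/eqP; rewrite scaler_eq0 (negPf gam0) => /eqP.
have w0 p : wordQ p 0 = ev (g 0 ^+ p) *: al 0%N ^+ p.
  elim: p => [|p IH] /=; first by rewrite rmorph1 scale1r.
  rewrite big_nat1 subnn mul1r IH -scalerAr scalerA -rmorphM -!exprS //.
have ez : wordQ l 0 = ev (g 0 ^+ l) *: X j ^+ l by rewrite w0 (chain_al0 st kj a0 Hal).
elim: r => // r IH _; case: r IH => [_|r IH]; apply: step.
- by rewrite muln0 ez => b; rewrite -scalerAl (st_central st (ltnW kj)) scalerAr.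
- by rewrite muln0 ez (der_Z (st_derD st (leqnn k))) D_k_vanish // scaler0.
- by rewrite IH // => b; rewrite mul0r mulr0.
- by rewrite IH // (der_0 (st_derD st (leqnn k))).
Qed.

Lemma al_alg m : A0 (al m).
Proof. by have /ga_alg := @ga_graph P _ P X y yi _ _ _ (st_P stage_weak) (Hal m). Qed.

Lemma wordQ_alg p n : A0 (wordQ p n).
Proof. by have /ga_alg := @ga_graph P _ P X y yi _ _ _ (st_P stage_weak) (word_graph p n). Qed.

Let sn0 := strongly_nil0 sA0.

(** Modulo nilpotent ideals, the word of degree [p * r] reduces to the [p]-th power of
    [al r], every other term having a factor [al m] with [r < m]. *)
Lemma wordQ_leading r : (forall m, (r < m)%N -> strongly_nil A0 (al m)) -> forall p : nat,
  (forall n, (p * r < n)%N -> strongly_nil A0 (wordQ p n)) /\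
  exists u : K, u != 0 /\ strongly_nil A0 (wordQ p (p * r)%N - u *: al r ^+ p).
Proof.
move=> Hr; elim=> [|p [IH1 [u [u0 IH2]]]].
  split; first by case.
  by exists 1; rewrite oner_neq0 scale1r subrr.
have sumN (t : seq nat) F : (forall m, m \in t -> strongly_nil A0 (F m)) ->
    strongly_nil A0 (\sum_(m <- t) F m).
  elim: t => [|m t IH] H; first by rewrite big_nil.
  rewrite big_cons; apply: (strongly_nilD sA0); first by apply: H; rewrite mem_head.
  by apply: IH => m' mt; apply: H; rewrite inE mt orbT.
have scN c b : strongly_nil A0 b -> strongly_nil A0 (c *: b).
  by move=> Hb; rewrite -[b]mul1r scalerAl; apply: strongly_nilMl => //; apply: ga_sc.
have term m n : (m != r) || (p.+1 * r < n)%N -> (p.+1 * r <= n)%N -> (m <= n)%N ->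
    strongly_nil A0 (al m * wordQ p (n - m)).
  move=> mr pn mn; have [rm|mr'] := ltnP r m.
    by apply: strongly_nilMr; [apply: Hr | apply: wordQ_alg].
  apply: strongly_nilMl; first exact: al_alg.
  apply: IH1; move: mr; rewrite mulSn in pn *; lia.
split=> [n pn|] /=.
  apply: sumN => m; rewrite mem_index_iota ltnS => /andP[_ mn]; apply: scN.
  by apply: term => //; [rewrite pn orbT | apply: ltnW].
set n := (p.+1 * r)%N.
have rn : (r < n.+1)%N by rewrite ltnS /n mulSn leq_addr.
exists (ev (la ^+ (n - r) * g r) * u); split.
  by rewrite mulf_neq0 // rmorphM mulf_neq0 // rmorphXn expf_neq0 // (ev_qX sp) expfz_neq0 // (eps_neq0 sp).
rewrite (bigD1_seq r) /=; [|by rewrite mem_index_iota|exact: (iota_uniq 0 n.+1)].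
rewrite addrAC; apply: (strongly_nilD sA0); last first.
  rewrite -big_filter; apply: sumN => m; rewrite mem_filter mem_index_iota ltnS => /andP[mr /andP[_ mn]].
  by apply: scN; apply: term; rewrite ?mr.
have -> : (n - r = p * r)%N by rewrite /n mulSn addKn.
rewrite -scalerA -scalerBr; apply: scN; rewrite exprS scalerAr -mulrBr.
by apply: strongly_nilMl => //; apply: al_alg.
Qed.

(** Downward induction on [m]: by the two preceding lemmas [al m ^+ l] lies in a nilpotent
    ideal, so [al m] is nilpotent, and it is homogeneous at stage [k.+1]. *)
Lemma chain_nil m : (0 < m)%N -> strongly_nil A0 (al m).
Proof.
have main n m' : (0 < m')%N -> (l <= m' + n)%N -> strongly_nil A0 (al m').
  elim: n m' => [|n IH] r r0 lr.
    by rewrite (chain_al_ge st al0 Hal) //; move: lr; rewrite addn0.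
  have Hr m' : (r < m')%N -> strongly_nil A0 (al m').
    by move=> rm; apply: IH; lia.
  have [_ [u [u0 H]]] := wordQ_leading Hr l; rewrite wordQ_vanish // sub0r in H.
  have H2 : strongly_nil A0 (al r ^+ l).
    have -> : al r ^+ l = (- u^-1)%:A * - (u *: al r ^+ l).
      by rewrite -scalerAl mul1r scalerN scaleNr opprK scalerA mulVf // scale1r.
    by apply: strongly_nilMl => //; apply: ga_sc.
  have [s es] := strongly_nilP H2.
  have G1 := @ga_graph P _ P X y yi _ _ _ (st_P stage_weak) (Hal r).
  by apply: (cl stage_weak G1); exists (l * s)%N; rewrite exprM.
by move=> m0; apply: (main l) => //; apply: leq_addl.
Qed.

End VanishingChain.

Definition tails (j : 'I_M) (al : nat -> Q) :=
  [/\ al 0%N = X j,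
      forall m, exists mu : K, xk * al m = mu *: (al m * xk) + al m.+1,
      forall m, (0 < m)%N -> strongly_nil A0 (al m)
    & forall m, (l <= m)%N -> al m = 0].

Lemma tails_exist : exists al : 'I_M -> nat -> Q, forall j : 'I_M, (k < j)%N -> tails j (al j).
Proof.
apply: (fin_all_exists (P := fun (j : 'I_M) al => (k < j)%N -> tails j al)) => j.
have [kj|_] := boolP (k < j)%N; last by exists (fun=> 0).
have [a [al [a0 Ha al0 Hal]]] := chain_exists st kj.
exists al => _; split.
- exact: (chain_al0 st kj a0 Hal).
- by move=> m; exists (eps ^ chain_kdeg k j m); apply: (chain_xk st Ha Hal).
- move=> m m0; have [l1|] := ltnP 1 l; first exact: (chain_nil kj a0 Ha al0 Hal l1).
  move=> l1; rewrite (chain_al_ge st al0 Hal); first exact: strongly_nil0.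
  exact: leq_trans l1 m0.
- by move=> m; apply: (chain_al_ge st al0 Hal).
Qed.

Lemma ga_below T v b : galg T k.+1 P X y yi v b -> galg T k P X y yi v b.
Proof.
elim=> {v b}.
- by move=> j v kj Hv; apply: ga_X => //; apply: ltnW.
- by move=> j v b kj kk Hv e1 e2; apply: (ga_Xi (ltnW kj) kk).
- by move=> j v Pj Hv; apply: ga_y.
- by move=> j v Pj Hv; apply: ga_yi.
- by move=> c v Hv; apply: ga_sc.
- by move=> v a b _ Ha _ Hb; apply: ga_add.
- by move=> v w u a b _ Ha _ Hb Hu; apply: ga_mul Ha Hb Hu.
- by move=> v; apply: ga_0.
Qed.

Section Tails.
Variable al : 'I_M -> nat -> Q.
Hypothesis Hal : forall j : 'I_M, (k < j)%N -> tails j (al j).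

Let sn_A0 b : strongly_nil A0 b -> A0 b.
Proof. by move=> [J [[iJ _] Jb]]; apply: (id_sub iJ). Qed.

(** The ideal generated by the obstructions to the normality of [xk]. *)
Inductive tail : Q -> Prop :=
| tl_gen (j : 'I_M) m : (k < j)%N -> (0 < m)%N -> tail (al j m)
| tl_D a b : tail a -> tail b -> tail (a + b)
| tl_Ml a b : A0 a -> tail b -> tail (a * b)
| tl_Mr a b : tail a -> A0 b -> tail (a * b)
| tl_0 : tail 0.

Lemma tail_ideal : ideal_of A0 tail.
Proof.
split; [|exact: tl_0|exact: tl_D|exact: tl_Ml|exact: tl_Mr].
move=> b; elim=> {b}.
- by move=> j m kj m0; have [_ _ /(_ m m0)/sn_A0] := Hal kj.
- by move=> a b _ Ha _ Hb; apply: (subr_D sA0).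
- by move=> a b Aa _ Hb; apply: (subr_M sA0).
- by move=> a b _ Ha Ab; apply: (subr_M sA0).
- exact: (subr_0 sA0).
Qed.

Lemma tail_nil : nilpotent_set tail.
Proof.
pose t := [seq al j m | j <- [seq j : 'I_M <- enum 'I_M | (k < j)%N], m <- iota 1 l].
have [|J [[iJ [r Hr]] HJ]] := strongly_nil_common sA0 (t := t).
  move=> b /allpairsPdep[j [m [+ + ->]]]; rewrite mem_filter mem_iota => /andP[kj _] /andP[m0 _].
  by have [_ _ H _] := Hal kj; apply: H.
exists r => u su Hu; apply: Hr => // b /Hu{su Hu}; elim=> {b}.
- move=> j m kj m0; have [lm|ml] := leqP l m.
    by have [_ _ _ ->] := Hal kj => //; apply: id_0 iJ.
  apply: HJ; apply/allpairsPdep; exists j, m; split=> //.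
    by rewrite mem_filter kj mem_enum.
  by rewrite mem_iota m0 add1n ltnS ltnW.
- by move=> a b _ Ha _ Hb; apply: (id_D iJ).
- by move=> a b Aa _ Hb; apply: (id_Ml iJ).
- by move=> a b _ Ha Ab; apply: (id_Mr iJ).
- exact: id_0 iJ.
Qed.

Let tlN a : tail a -> tail (- a). Proof. exact: (id_N sA0 tail_ideal). Qed.
Let tlZ (c : K) a : tail a -> tail (c *: a).
Proof. by move=> Ta; rewrite -[a]mul1r scalerAl; apply: tl_Ml => //; apply: ga_sc. Qed.
Let A0Z (c : K) a : A0 a -> A0 (c *: a). Proof. exact: ga_scale. Qed.

(** [xk] is normal modulo the tails, on the algebra of stage [k.+1]. *)
Lemma alg_twist b : A0 b -> exists b', A0 b' /\ tail (xk * b - b' * xk).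
Proof.
suff H v : galg pred0 k.+1 P X y yi v b -> exists b', A0 b' /\ tail (xk * b - b' * xk) by apply: H.
have inv c d (mu : K) n : A0 d -> c * d = 1 -> d * c = 1 -> mu != 0 -> tail n ->
    xk * c = mu *: (c * xk) + n -> exists d', A0 d' /\ tail (xk * d - d' * xk).
  move=> Ad cd dc mu0 Tn e; exists (mu^-1 *: d); split; first exact: A0Z.
  have : d * xk = mu *: (xk * d) + d * n * d.
    have <- : d * (xk * c) * d = d * xk by rewrite -!mulrA cd mulr1.
    by rewrite e mulrDr mulrDl -scalerAr -scalerAl !mulrA dc mul1r.
  move/(congr1 (fun u => mu^-1 *: u)); rewrite scalerDr scalerA mulVf // scale1r scalerAl => ->.
  rewrite opprD addrA subrr add0r; apply: tlN; apply: tlZ.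
  by apply: tl_Mr => //; apply: tl_Ml.
elim=> {v b}.
- move=> j v kj _; have [e0 tw Hn _] := Hal kj; have [mu e] := tw 0%N; rewrite e0 in e.
  exists (mu *: X j); split; first by apply: A0Z; apply: ga_X.
  by rewrite e -scalerAl addrC addKr; apply: tl_gen.
- move=> j v b kj kk _ e1 e2; have [e0 tw Hn _] := Hal kj; have [mu e] := tw 0%N; rewrite e0 in e.
  have Tn : tail (al j 1) by apply: tl_gen.
  have Ab : A0 b by apply: (ga_Xi kj kk).
  have [mu0|mu0] := eqVneq mu 0; last exact: (inv (X j) b mu (al j 1)).
  exists 0; split; first exact: (subr_0 sA0).
  rewrite mul0r subr0; have -> : xk * b = (al j 1 * b) * b.
    by move: e; rewrite mu0 scale0r add0r => <-; rewrite -(mulrA xk) e1 mulr1.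
  by apply: tl_Mr => //; apply: tl_Mr.
- move=> j v Pj _; exists (eps ^ (- S j k) *: y j); split; first by apply: A0Z; apply: ga_y.
  rewrite -scalerAl (st_yX st) // scalerA -eps_expD addNr expr0z scale1r subrr; exact: tl_0.
- move=> j v Pj _; have [e1 e2] := st_yK st Pj.
  apply: (inv (y j) (yi j) (eps ^ (- S j k)) 0) => //; first exact: ga_yi.
  + by rewrite expfz_neq0 // (eps_neq0 sp).
  + exact: tl_0.
  + by rewrite addr0 (st_yX st) // scalerA -eps_expD addNr expr0z scale1r.
- move=> c v _; exists c%:A; split; first exact: ga_sc.
  by rewrite -scalerAr -scalerAl mulr1 mul1r subrr; apply: tl_0.
- move=> v a b _ [a' [Aa Ta]] _ [b' [Ab Tb]]; exists (a' + b'); split; first exact: ga_add.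
  by rewrite mulrDr mulrDl opprD addrACA; apply: tl_D.
- move=> v w u a b Ha [a' [Aa Ta]] Hb [b' [Ab Tb]] _; exists (a' * b'); split; first exact: (subr_M sA0).
  have -> : xk * (a * b) - a' * b' * xk = (xk * a - a' * xk) * b + a' * (xk * b - b' * xk).
    by rewrite mulrBl mulrBr !mulrA addrA subrK.
  by apply: tl_D; [apply: tl_Mr => //; apply: ga_alg Hb | apply: tl_Ml].
- move=> v; exists 0; split; first exact: ga_0.
  by rewrite mulr0 mul0r subrr; apply: tl_0.
Qed.

Lemma tail_twist n : tail n -> exists n', tail n' /\ tail (xk * n - n' * xk).
Proof.
elim=> {n}.
- move=> j m kj m0; have [_ tw _ _] := Hal kj; have [mu e] := tw m.
  exists (mu *: al j m); split; first by apply: tlZ; apply: tl_gen.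
  by rewrite e -scalerAl addrC addKr; apply: tl_gen.
- move=> a b _ [a' [Aa Ta]] _ [b' [Ab Tb]]; exists (a' + b'); split; first exact: tl_D.
  by rewrite mulrDr mulrDl opprD addrACA; apply: tl_D.
- move=> a b Aa Hb [b' [Ab Tb]]; have [a' [Aa' Ta]] := alg_twist Aa.
  exists (a' * b'); split; first exact: tl_Ml.
  have -> : xk * (a * b) - a' * b' * xk = (xk * a - a' * xk) * b + a' * (xk * b - b' * xk).
    by rewrite mulrBl mulrBr !mulrA addrA subrK.
  by apply: tl_D; [apply: tl_Mr => //; apply: (id_sub tail_ideal) | apply: tl_Ml].
- move=> a b Ha [a' [Aa Ta]] Ab; have [b' [Ab' Tb]] := alg_twist Ab.
  exists (a' * b'); split; first exact: tl_Mr.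
  have -> : xk * (a * b) - a' * b' * xk = (xk * a - a' * xk) * b + a' * (xk * b - b' * xk).
    by rewrite mulrBl mulrBr !mulrA addrA subrK.
  by apply: tl_D; [apply: tl_Mr | apply: tl_Mr => //; apply: (id_sub tail_ideal)] => //; apply: tl_Ml => //; apply: (id_sub tail_ideal).
- by exists 0; rewrite mulr0 mul0r subrr; split; apply: tl_0.
Qed.

(** The right ideal of the whole algebra spanned by the tails is two-sided. *)
Inductive tailA : Q -> Prop :=
| ta_0 : tailA 0
| ta_add n a b : tail n -> A a -> tailA b -> tailA (n * a + b).

Let A0A b : A0 b -> A b. Proof. exact: ga_below. Qed.

Lemma ta_D a b : tailA a -> tailA b -> tailA (a + b).
Proof.
move=> + Hb; elim=> {a}; first by rewrite add0r.
by move=> n a c Tn Aa _ IH; rewrite -addrA; apply: ta_add.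
Qed.
Lemma ta_gen n a : tail n -> A a -> tailA (n * a).
Proof. by move=> Tn Aa; rewrite -[_ * _]addr0; apply: ta_add => //; apply: ta_0. Qed.
Lemma ta_tail n : tail n -> tailA n.
Proof. by move=> Tn; rewrite -[n]mulr1; apply: ta_gen => //; apply: (subr_1 sA). Qed.

Lemma ta_Mr a b : tailA a -> A b -> tailA (a * b).
Proof.
move=> + Ab; elim=> {a}; first by rewrite mul0r; apply: ta_0.
move=> n a c Tn Aa _ IH; rewrite mulrDl -mulrA; apply: ta_add => //.
exact: (subr_M sA).
Qed.

Lemma ta_Mx b : tailA b -> tailA (xk * b).
Proof.
elim=> {b}; first by rewrite mulr0; apply: ta_0.
move=> n a c Tn Aa _ IH; rewrite mulrDr; apply: ta_D => //.
have [n' [Tn' Tx]] := tail_twist Tn.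
have -> : xk * (n * a) = n' * (xk * a) + (xk * n - n' * xk) * a.
  by rewrite mulrBl !mulrA addrC subrK.
apply: ta_D; apply: ta_gen => //; apply: (subr_M sA) => //.
by apply: ga_X.
Qed.

Lemma ta_M0 a b : A0 a -> tailA b -> tailA (a * b).
Proof.
move=> Aa; elim=> {b}; first by rewrite mulr0; apply: ta_0.
move=> n c d Tn Ac _ IH; rewrite mulrDr mulrA; apply: ta_add => //.
exact: tl_Ml.
Qed.

(** Induction over the whole algebra: it is generated by [xk] and the smaller one. *)
Lemma alg_ind_k (Y : Q -> Prop) : Y xk -> (forall b, A0 b -> Y b) ->
  (forall a b, A a -> A b -> Y a -> Y b -> Y (a + b)) ->
  (forall a b, A a -> A b -> Y a -> Y b -> Y (a * b)) -> forall b, A b -> Y b.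
Proof.
move=> Yx Y0 YD YM b; suff H v : galg pred0 k P X y yi v b -> Y b by apply: H.
elim=> {v b}.
- move=> j v kj _; have [/val_inj->|ne] := eqVneq (j : nat) k => //.
  by apply: Y0; apply: ga_X => //; rewrite ltn_neqAle eq_sym ne kj.
- move=> j v b kj kk _ e1 e2; have [/val_inj e|ne] := eqVneq (j : nat) k.
    by have := k_notin_kappa; rewrite -e kk.
  by apply: Y0; apply: (ga_Xi _ kk _ e1 e2) => //; rewrite ltn_neqAle eq_sym ne kj.
- by move=> j v Pj _; apply: Y0; apply: ga_y.
- by move=> j v Pj _; apply: Y0; apply: ga_yi.
- by move=> c v _; apply: Y0; apply: ga_sc.
- by move=> v a b Ha Ya Hb Yb; apply: YD => //; [apply: ga_alg Ha | apply: ga_alg Hb].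
- by move=> v w u a b Ha Ya Hb Yb _; apply: YM => //; [apply: ga_alg Ha | apply: ga_alg Hb].
- by move=> v; apply: Y0; apply: ga_0.
Qed.

Lemma tailA_ideal : ideal_of A tailA.
Proof.
split; [|exact: ta_0|exact: ta_D| |exact: ta_Mr].
  move=> b; elim=> {b}; first exact: (subr_0 sA).
  move=> n a b Tn Aa _ Ab; apply: (subr_D sA) => //; apply: (subr_M sA) => //.
  by apply: A0A; apply: (id_sub tail_ideal).
move=> a b Aa Tb; move: a Aa b Tb.
apply: alg_ind_k; [exact: ta_Mx|by move=> a Aa b; apply: ta_M0| |].
- by move=> a b Aa Ab IHa IHb c Tc; rewrite mulrDl; apply: ta_D; [apply: IHa|apply: IHb].
- by move=> a b Aa Ab IHa IHb c Tc; rewrite -mulrA; apply: IHa; apply: IHb.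
Qed.

Inductive tail_span (m : nat) : Q -> Prop :=
| ts_0 : tail_span m 0
| ts_add u a b : size u = m -> all_in tail u -> A a -> tail_span m b ->
    tail_span m (\prod_(d <- u) d * a + b).

Lemma ts_D m a b : tail_span m a -> tail_span m b -> tail_span m (a + b).
Proof.
move=> + Hb; elim=> {a}; first by rewrite add0r.
by move=> u a c su Tu Aa _ IH; rewrite -addrA; apply: ts_add.
Qed.

Lemma ts_M m w b : tail_span m w -> tailA b -> tail_span m.+1 (w * b).
Proof.
move=> + Tb; elim=> {w}; first by rewrite mul0r; apply: ts_0.
move=> u a c su Tu Aa _ IH; rewrite mulrDl -mulrA; apply: ts_D => //.
have := id_Ml tailA_ideal Aa Tb; elim=> [|n d e Tn Ad _ IHe].
  by rewrite mulr0; apply: ts_0.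
rewrite mulrDr mulrA; have -> : \prod_(d <- u) d * n = \prod_(d <- rcons u n) d.
  by rewrite -cats1 big_cat /= big_seq1.
apply: ts_add => //; first by rewrite size_rcons su.
by rewrite -cats1; apply/all_in_cat; split=> // v; rewrite inE => /eqP->.
Qed.

(** As [tailA] is two-sided, a product of [m] of its elements is in the right span of the
    products of [m] tails. *)
Lemma tailA_nil : nilpotent_set tailA.
Proof.
have [r Hr] := tail_nil; exists r => t szt Ht.
have main u : all_in tailA u -> forall m w, tail_span m w ->
    tail_span (m + size u)%N (w * \prod_(d <- u) d).
  elim: u => [|b u IH] Hu m w Hw; first by rewrite big_nil mulr1 addn0.
  have [Tb Tu] := (all_in_cons _ _ _).1 Hu; rewrite big_cons mulrA /= addnS -addSn.
  by apply: IH => //; apply: ts_M.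
have ts1 : tail_span 0 1.
  have := @ts_add 0 [::] 1 0 erefl _ (subr_1 sA) (ts_0 0); rewrite big_nil mulr1 addr0.
  by apply.
have := main t Ht 0%N 1 ts1; rewrite mul1r add0n szt; elim=> // u a b su Tu _ _ ->.
by rewrite Hr // mul0r addr0.
Qed.

Lemma alg_twistA a : A a -> exists a', A a' /\ tailA (xk * a - a' * xk).
Proof.
move: a; apply: alg_ind_k.
- by exists xk; rewrite subrr; split; [apply: ga_X | apply: ta_0].
- by move=> b /alg_twist[b' [Ab Tb]]; exists b'; split; [apply: A0A | apply: ta_tail].
- move=> a b _ _ [a' [Aa Ta]] [b' [Ab Tb]]; exists (a' + b'); split; first exact: (subr_D sA).
  by rewrite mulrDr mulrDl opprD addrACA; apply: ta_D.
- move=> a b _ Hb [a' [Aa Ta]] [b' [Ab Tb]]; exists (a' * b'); split; first exact: (subr_M sA).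
  have -> : xk * (a * b) - a' * b' * xk = (xk * a - a' * xk) * b + a' * (xk * b - b' * xk).
    by rewrite mulrBl mulrBr !mulrA addrA subrK.
  by apply: ta_D; [apply: ta_Mr | apply: (id_Ml tailA_ideal)].
Qed.

(** Modulo the tails [xk] is normal, hence generates a nilpotent ideal. *)
Definition Jx (b : Q) := exists a n, [/\ A a, tailA n & b = a * xk + n].

Let Axk : A xk. Proof. exact: ga_X. Qed.

Lemma Jx_ideal : ideal_of A Jx.
Proof.
split.
- move=> _ [a [n [Aa Tn ->]]]; apply: (subr_D sA); first exact: (subr_M sA).
  exact: (id_sub tailA_ideal).
- by exists 0, 0; rewrite mul0r addr0; split=> //; [apply: (subr_0 sA)|apply: ta_0].
- move=> _ _ [a [n [Aa Tn ->]]] [b [m [Ab Tm ->]]]; exists (a + b), (n + m).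
  by rewrite mulrDl addrACA; split=> //; [apply: (subr_D sA)|apply: ta_D].
- move=> c _ Ac [a [n [Aa Tn ->]]]; exists (c * a), (c * n).
  by rewrite mulrDr mulrA; split=> //; [apply: (subr_M sA)|apply: (id_Ml tailA_ideal)].
- move=> _ c [a [n [Aa Tn ->]]] Ac; have [c' [Ac' Tc]] := alg_twistA Ac.
  exists (a * c'), (a * (xk * c - c' * xk) + n * c); split.
  + exact: (subr_M sA).
  + by apply: ta_D; [apply: (id_Ml tailA_ideal)|apply: ta_Mr].
  + by rewrite mulrDl mulrBr !mulrA addrA [_ + (_ - _)]addrC subrK.
Qed.

Lemma Jx_nil : nil_ideal A Jx.
Proof.
split; first exact: Jx_ideal.
apply: (nilpotent_set_ext (s := l) tailA_nil) => t szt Ht.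
suff [a [Aa]] : exists a, A a /\ tailA (\prod_(d <- t) d - a * xk ^+ size t).
  by rewrite szt z0 mulr0 subr0.
elim: t Ht {szt} => [|d t IH] Ht.
  by exists 1; rewrite big_nil mulr1 subrr; split; [apply: (subr_1 sA)|apply: ta_0].
have [[a [n [Aa Tn ->]]] /IH[b [Ab Tb]]] := (all_in_cons _ _ _).1 Ht.
have [b' [Ab' Tb']] := alg_twistA Ab.
have AX m : A (xk ^+ m) by apply: (ga_ext _ (ga_exp m Axk)).
have Ap : A (\prod_(j <- t) j).
  rewrite -[X in A X](subrK (b * xk ^+ size t)); apply: (subr_D sA); last exact: (subr_M sA).
  exact: (id_sub tailA_ideal).
exists (a * b'); split; first exact: (subr_M sA).
rewrite big_cons /= exprS; set p := \prod_(j <- t) j in Ap Tb *.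
have -> : (a * xk + n) * p - a * b' * (xk * xk ^+ size t) =
   a * (xk * (p - b * xk ^+ size t)) + (n * p + a * ((xk * b - b' * xk) * xk ^+ size t)).
  have zmodE (t1 t2 t3 t4 : Q) : t1 + t2 - t3 = (t1 - t4) + (t2 + (t4 - t3)).
    by rewrite [RHS](AC (2*(1*2)) (((1*3)*5)*(2*4))) /= addNr addr0.
  by rewrite mulrDl !mulrBr !mulrBl !mulrBr !mulrA; apply: zmodE.
apply: ta_D; first by do 2! apply: (id_Ml tailA_ideal) => //.
apply: ta_D; first exact: ta_Mr.
by apply: (id_Ml tailA_ideal) => //; apply: ta_Mr.
Qed.

Lemma alg_decomp T v b : galg T k P X y yi v b ->
  exists b0, galg T k.+1 P X y yi v b0 /\ Jx (b - b0).
Proof.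
have J0 : Jx 0 := id_0 Jx_ideal.
elim=> {v b}.
- move=> j v kj Hv; have [/val_inj->|ne] := eqVneq (j : nat) k.
    exists 0; split; first exact: ga_0.
    by rewrite subr0; exists 1, 0; rewrite mul1r addr0; split=> //; [apply: (subr_1 sA)|apply: ta_0].
  exists (X j); rewrite subrr; split=> //.
  by apply: ga_X => //; rewrite ltn_neqAle eq_sym ne kj.
- move=> j v b kj kk Hv e1 e2; have [/val_inj e|ne] := eqVneq (j : nat) k.
    by have := k_notin_kappa; rewrite -e kk.
  exists b; rewrite subrr; split=> //.
  by apply: (ga_Xi _ kk Hv e1 e2) => //; rewrite ltn_neqAle eq_sym ne kj.
- by move=> j v Pj Hv; exists (y j); rewrite subrr; split=> //; apply: ga_y.
- by move=> j v Pj Hv; exists (yi j); rewrite subrr; split=> //; apply: ga_yi.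
- by move=> c v Hv; exists c%:A; rewrite subrr; split=> //; apply: ga_sc.
- move=> v a b _ [a0 [Ha Ja]] _ [b0 [Hb Jb]]; exists (a0 + b0); split; first exact: ga_add.
  by rewrite opprD addrACA; apply: (id_D Jx_ideal).
- move=> v w u a b Ha [a0 [Ha0 Ja]] Hb [b0 [Hb0 Jb]] Hu; exists (a0 * b0).
  split; first exact: ga_mul Ha0 Hb0 Hu.
  have -> : a * b - a0 * b0 = (a - a0) * b + a0 * (b - b0).
    by rewrite mulrBl mulrBr addrA subrK.
  apply: (id_D Jx_ideal); first by apply: (id_Mr Jx_ideal) => //; apply: ga_alg Hb.
  by apply: (id_Ml Jx_ideal) => //; apply: A0A; apply: ga_alg Ha0.
- by move=> v; exists 0; rewrite subrr; split=> //; apply: ga_0.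
Qed.

(** Modulo the nilpotent ideal [Jx] every element comes from stage [k.+1]. *)
Lemma nil_prop_vanish v b : galg P k P X y yi v b -> (exists n, b ^+ n = 0) -> strongly_nil A b.
Proof.
move=> Hb nb; have [b0 [Hb0 Jb]] := alg_decomp Hb.
have Ab := ga_alg Hb; have Ab0 : A0 b0 := ga_alg Hb0.
have [J [[iJ nJ] Jb0]] : strongly_nil A0 b0.
  apply: (cl stage_weak Hb0); apply: (nilpotent_modulo sA (A0A Ab0) Ab) nb.
  exists Jx; split; first exact: Jx_nil.
  by rewrite -opprB; apply: (id_N sA Jx_ideal).
have JA a : J a -> A a by move=> Ja; apply: A0A; apply: (id_sub iJ).
exists (fun c => exists a j, [/\ J a, Jx j & c = a + j]); split; last first.
  by exists b0, (b - b0); rewrite [b0 + _]addrC subrK.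
split; last exact: (nil_ideal_sum sA Jx_nil JA nJ).
have dec c : A c -> exists c0, A0 c0 /\ Jx (c - c0) by move=> /alg_decomp.
have iX := Jx_ideal.
split.
- by move=> _ [a [j [Ja Jj ->]]]; apply: (subr_D sA); [apply: JA|apply: (id_sub iX)].
- by exists 0, 0; rewrite addr0; split=> //; [apply: id_0 iJ|apply: id_0 iX].
- move=> _ _ [a [j [Ja Jj ->]]] [a' [j' [Ja' Jj' ->]]]; exists (a + a'), (j + j').
  by rewrite addrACA; split=> //; [apply: (id_D iJ)|apply: (id_D iX)].
- move=> c _ Ac [a [j [Ja Jj ->]]]; have [c0 [Ac0 Jc]] := dec _ Ac.
  exists (c0 * a), ((c - c0) * a + c * j); split.
  + exact: (id_Ml iJ).
  + by apply: (id_D iX); [apply: (id_Mr iX) => //; apply: JA|apply: (id_Ml iX)].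
  + by rewrite mulrDr addrA -mulrDl [c0 + _]addrC subrK.
- move=> _ c [a [j [Ja Jj ->]]] Ac; have [c0 [Ac0 Jc]] := dec _ Ac.
  exists (a * c0), (a * (c - c0) + j * c); split.
  + exact: (id_Mr iJ).
  + by apply: (id_D iX); [apply: (id_Ml iX) => //; apply: JA|apply: (id_Mr iX)].
  + by rewrite mulrDl addrA -mulrDr [c0 + _]addrC subrK.
Qed.

End Tails.

Lemma nil_prop_step_vanish v b : galg P k P X y yi v b -> (exists n, b ^+ n = 0) ->
  strongly_nil A b.
Proof. by have [al Hal] := tails_exist; apply: (nil_prop_vanish Hal). Qed.

End Vanishing.

Hypothesis central_inv : forall c : Q, central c -> c != 0 ->
  exists c', central c' /\ c * c' = 1.

Lemma nil_prop_all k : (k <= M)%N -> nil_prop k.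
Proof.
move=> kM; rewrite -(subKn kM); elim: (M - k)%N (leq_subr k M) => [|n IH] nM.
  by rewrite subn0; apply: nil_prop_torus.
have kn : (M - n.+1 < M)%N by rewrite ltn_subrL (leq_trans _ nM).
have := IH (ltnW nM); have -> : (M - n)%N = (M - n.+1).+1 by rewrite subnSK.
move=> cl P X D y yi E st v b Hb nb.
have := cl; rewrite -[(M - n.+1)%N]/(nat_of_ord (Ordinal kn)) => cl'.
have [z0|z0] := eqVneq (X (Ordinal kn) ^+ l) 0.
  exact: (@nil_prop_step_vanish (Ordinal kn) P X D y yi E st z0 cl' v b Hb nb).
have [zi [ziC zzi]] := central_inv (st_central st (leqnn (Ordinal kn))) z0.
exact: (@nil_prop_step_unit (Ordinal kn) P X D y yi E st zi ziC zzi v b cl' Hb nb).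
Qed.

End Commutators.

(** * Prime rings *)
Section PrimeRings.
Variable B : nzRingType.
Hypothesis primeB : prime_ideal (fun a : B => a = 0).

Lemma prime_elt a b : (forall c : B, a * c * b = 0) -> a = 0 \/ b = 0.
Proof.
move=> ab; have [_ _ pr] := primeB.
(* [T] and [T'] are two-sided ideals with zero product, containing [a] and [b]. *)
pose T u := forall c, u * c * b = 0; pose T' v := forall u c, T u -> u * c * v = 0.
have [] := pr T T'.
- split.
  + by move=> c; rewrite !mul0r.
  + by move=> u v Hu Hv c; rewrite !mulrDl Hu Hv addr0.
  + by move=> r u Hu c; rewrite -!mulrA [u * _]mulrA Hu mulr0.
  + by move=> r u Hu c; rewrite -(mulrA u) Hu.
- split.
  + by move=> u c _; rewrite mulr0.
  + by move=> v w Hv Hw u c Tu; rewrite mulrDr Hv // Hw // addr0.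
  + by move=> r v Hv u c Tu; rewrite mulrA -(mulrA u) Hv.
  + by move=> r v Hv u c Tu; rewrite mulrA Hv // mul0r.
- by move=> u v Tu Tv; rewrite -[u]mulr1 Tv.
- by move=> /(_ a ab); left.
- by move=> H; right; apply: H => u c; apply.
Qed.

Lemma prime_central (c a : B) : central c -> c * a = 0 -> c = 0 \/ a = 0.
Proof. by move=> Cc ca; apply: prime_elt => d; rewrite Cc -mulrA ca mulr0. Qed.

(** Primeness extends a nonzero product of elements of [J] by one more nonzero factor. *)
Lemma prime_nilpotent_ideal (J : B -> Prop) : (forall a b, J b -> J (a * b)) ->
  nilpotent_set J -> forall b, J b -> b = 0.
Proof.
move=> JM [r Hr] b Jb; apply/eqP; apply: contraT => b0.
suff [t [szt Jt /eqP]] : exists t, [/\ size t = r, all_in J t & \prod_(a <- t) a != 0].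
  by rewrite (Hr t szt Jt).
elim: r {Hr} => [|r [t [szt Jt nz]]]; first by exists [::]; rewrite big_nil oner_neq0.
suff [c nc] : exists c, \prod_(a <- t) a * c * b != 0.
  exists (rcons t (c * b)); split; first by rewrite size_rcons szt.
    by rewrite -cats1; apply/all_in_cat; split=> // u; rewrite inE => /eqP->; apply: JM.
  by rewrite -cats1 big_cat /= big_seq1 mulrA.
apply: contrapT => H; have [|e|e] := @prime_elt (\prod_(a <- t) a) b.
- by move=> c; apply/eqP; apply: contrapT => /negP nc; apply: H; exists c.
- by move: nz; rewrite e eqxx.
- by move: b0; rewrite e eqxx.
Qed.

(** If [a * b = 0] then [b * c * a] has square zero for all [c]. *)
Lemma prime_reduced_domain : (forall b : B, b ^+ 2 = 0 -> b = 0) ->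
  forall a b : B, a * b = 0 -> a = 0 \/ b = 0.
Proof.
move=> red a b ab; have [|->|->] := @prime_elt b a; [|by right|by left].
by move=> c; apply: red; rewrite expr2 -!mulrA (mulrA a b) ab mul0r !mulr0.
Qed.
End PrimeRings.

(** * Extension of derivations to central fractions *)
Section ExtendDerivation.
Variables (K : fieldType) (B : nzRingType) (kap : {rmorphism K -> B}) (Q : algType K).
Variable j : {rmorphism B -> Q}.
Hypothesis jinj : forall b, j b = 0 -> b = 0.
Hypothesis jkap : forall k, j (kap k) = k%:A.
Hypothesis jinv : forall c : B, central c -> c != 0 ->
  exists c' : Q, [/\ central c', j c * c' = 1 & c' * j c = 1].
Hypothesis jfrac : forall p : Q, exists b c : B, [/\ central c, c != 0 & p * j c = j b].

Lemma frac_cancel (c : B) (p p' : Q) : central c -> c != 0 -> p * j c = p' * j c -> p = p'.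
Proof.
move=> Cc c0 e; have [c' [_ e1 _]] := jinv Cc c0.
by rewrite -[p]mulr1 -e1 mulrA e -mulrA e1 mulr1.
Qed.

Lemma frac_central (c : B) : central c -> central (j c).
Proof.
move=> Cc p; have [b [d [Cd d0 e]]] := jfrac p; apply: (frac_cancel Cd d0).
have jC a : j c * j a = j a * j c by rewrite -!rmorphM Cc.
by rewrite -!mulrA e !jC mulrA e.
Qed.

Lemma frac_inv (p : Q) : central p -> p != 0 -> exists p', central p' /\ p * p' = 1.
Proof.
move=> Cp p0; have [b [c [Cc c0 e]]] := jfrac p.
have Cb : central b.
  move=> a; apply/eqP; rewrite -subr_eq0; apply/eqP; apply: jinj.
  by rewrite rmorphB !rmorphM -e -mulrA (frac_central Cc) mulrA Cp mulrA subrr.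
have b0 : b != 0.
  apply: contra_neq p0 => b0; apply: (frac_cancel Cc c0).
  by rewrite e b0 rmorph0 mul0r.
have [b' [Cb' e1 _]] := jinv Cb b0; exists (j c * b'); split; last by rewrite mulrA e.
by move=> a; rewrite -mulrA Cb' mulrA (frac_central Cc) mulrA.
Qed.

Variable d : B -> B.
Hypotheses (dD : forall a b, d (a + b) = d a + d b)
  (dM : forall a b, d (a * b) = d a * b + a * d b) (dkap : forall k, d (kap k) = 0).

(** The quotient rule; the denominators may be changed because they are central. *)
Lemma extend_derivation : exists D : Q -> Q, derivation D /\ forall b, D (j b) = j (d b).
Proof.
have dC (c : B) : central c -> central (d c).
  by move=> Cc a; have := congr1 d (Cc a); rewrite !dM Cc [RHS]addrC => /addIr.
have [D HD] : exists D : Q -> Q, forall p (b c : B), central c -> c != 0 -> p * j c = j b ->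
    D p * j c = j (d b) - p * j (d c).
  have /choice[D HD] p : exists p', forall b c : B, central c -> c != 0 -> p * j c = j b ->
      p' * j c = j (d b) - p * j (d c).
    have [b [c [Cc c0 e]]] := jfrac p; have [c' [Cc' e1 e2]] := jinv Cc c0.
    exists ((j (d b) - p * j (d c)) * c') => b' e' Ce e0 ep.
    apply: (frac_cancel Cc c0); rewrite -!mulrA (mulrA c') [c' * _]Cc' -mulrA e2 mulr1.
    have H : b' * c = b * e'.
      apply/eqP; rewrite -subr_eq0; apply/eqP; apply: jinj.
      by rewrite rmorphB !rmorphM -e -ep -!mulrA [j e' * _](frac_central Ce) subrr.
    have := congr1 (fun u => j (d u)) H; rewrite /= !dM !rmorphD !rmorphM -e -ep => H'.
    rewrite !mulrBl; apply/eqP; rewrite subr_eq addrAC eq_sym subr_eq eq_sym; apply/eqP.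
    move: H'; rewrite -!mulrA [j e' * j (d c)](frac_central Ce) [j c * j (d e')](frac_central Cc).
    by move=> ->.
  by exists D.
have Dj b : D (j b) = j (d b).
  have C1 : central (1 : B) by move=> a; rewrite mul1r mulr1.
  have d1 : d 1 = 0.
    by have := dM 1 1; rewrite !mulr1 mul1r => e; apply: (addrI (d 1)); rewrite addr0 -e.
  have := HD (j b) b 1 C1 (oner_neq0 _); rewrite rmorph1 !mulr1 d1 rmorph0 mulr0 subr0.
  by apply.
have CM (c e : B) : central c -> central e -> central (c * e).
  by move=> Cc Ce a; rewrite -mulrA Ce mulrA Cc -mulrA.
have M0 (c e : B) : central c -> c != 0 -> e != 0 -> c * e != 0.
  move=> Cc c0 e0; apply: contra_neq e0 => ce; apply: jinj.
  have [c' [_ _ e2]] := jinv Cc c0.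
  by rewrite -[j e]mul1r -e2 -mulrA -rmorphM ce rmorph0 mulr0.
have DD a b : D (a + b) = D a + D b.
  have [a1 [c [Cc c0 ea]]] := jfrac a; have [b1 [e [Ce e0 eb]]] := jfrac b.
  have Cce := CM _ _ Cc Ce; have ce0 := M0 _ _ Cc c0 e0.
  have Ea : a * j (c * e) = j (a1 * e) by rewrite !rmorphM mulrA ea.
  have Eb : b * j (c * e) = j (b1 * c) by rewrite Cc !rmorphM mulrA eb.
  apply: (frac_cancel Cce ce0).
  rewrite (HD _ (a1 * e + b1 * c)) //; last by rewrite mulrDl Ea Eb -rmorphD.
  by rewrite !mulrDl (HD _ _ _ Cce ce0 Ea) (HD _ _ _ Cce ce0 Eb) dD rmorphD opprD addrACA.
have DM a b : D (a * b) = D a * b + a * D b.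
  have [a1 [c [Cc c0 ea]]] := jfrac a; have [b1 [e [Ce e0 eb]]] := jfrac b.
  have Cce := CM _ _ Cc Ce; have ce0 := M0 _ _ Cc c0 e0.
  have Jc := frac_central Cc; have Je := frac_central Ce.
  apply: (frac_cancel Cce ce0).
  rewrite (HD _ (a1 * b1)) //; last first.
    by rewrite rmorphM mulrA -(mulrA a) -Jc mulrA ea -mulrA eb rmorphM.
  have Ha := HD _ _ _ Cc c0 ea; have Hb := HD _ _ _ Ce e0 eb.
  have Jdc := frac_central (dC _ Cc); have Jde := frac_central (dC _ Ce).
  have -> : (D a * b + a * D b) * j (c * e) = (D a * j c) * (b * j e) + (a * j c) * (D b * j e).
    by rewrite rmorphM mulrDl; congr (_ + _); rewrite -!mulrA; congr (_ * _); rewrite !mulrA Jc.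
  rewrite Ha Hb ea eb !dM !rmorphD !rmorphM mulrBl mulrBr.
  rewrite -ea -eb; rewrite mulrDr opprD addrACA; congr (_ - _ + (_ - _)).
  - by rewrite -!mulrA; congr (_ * _); rewrite Jdc mulrA.
  - by rewrite -!mulrA; congr (_ * _); rewrite Jc mulrA.
exists D; split=> //; split=> // c a.
by rewrite -mulr_algl DM -jkap Dj dkap rmorph0 mul0r add0r jkap mulr_algl.
Qed.
End ExtendDerivation.

(** * Specialisation *)
Section Localisation.
Variables (K : closedFieldType) (charK : [pchar K] =i pred0).
Variables (C : comUnitRingType) (fs : seq {poly K}) (phi : {rmorphism {poly K} -> C}).
Hypothesis locC : localization fs phi.
Variables (l : nat) (eps : K) (prim_eps : l.-primitive_root eps).
Variable ev : {rmorphism C -> K}.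
Hypothesis evE : forall p, ev (phi p) = p.[eps].

Lemma mult_neq0 s : mult_set fs s -> s != 0.
Proof.
move=> Hs; apply/eqP => s0; have := loc_unit locC Hs.
by rewrite s0 rmorph0 unitr0.
Qed.

Lemma phi_reg f c : f != 0 -> phi f * c = 0 -> c = 0.
Proof.
move=> f0; have [p [s [Hs ->]]] := loc_frac locC c; have us := loc_unit locC Hs.
rewrite mulrA -rmorphM => e.
have : phi (f * p) = 0 by rewrite -[LHS](divrK us) e mul0r.
move/(loc_ker locC) => [s' Hs' /eqP]; rewrite !mulf_eq0 (negPf (mult_neq0 Hs')) (negPf f0) /=.
by move/eqP->; rewrite rmorph0 mul0r.
Qed.

Lemma Xn_sub1_neq0 n : (0 < n)%N -> 'X^n - 1 != 0 :> {poly K}.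
Proof. by move=> n0; rewrite -size_poly_gt0 size_XnsubC. Qed.

Lemma specialised_localisation : specialised (phi 'X) (phi ('X - eps%:P)) ev eps l.
Proof.
have qU : phi 'X \is a GRing.unit := loc_unit locC (MultSetX fs).
have l0 : (0 < l)%N := prim_order_gt0 prim_eps.
have qreg n c : (0 < n)%N -> (phi 'X ^+ n - 1) * c = 0 -> c = 0.
  by move=> n0; rewrite -rmorphXn -(rmorph1 phi) -rmorphB; apply: phi_reg; apply: Xn_sub1_neq0.
split=> //.
- by rewrite evE hornerX.
- by rewrite evE hornerXsubC subrr.
- move=> c; have [p [s [Hs ->]]] := loc_frac locC c; have us := loc_unit locC Hs.
  move/(congr1 (fun u => u * ev (phi s))); rewrite mul0r -rmorphM divrK // evE => /eqP.
  move/factor_theorem => [g ->]; exists (phi g / phi s).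
  by rewrite rmorphM mulrA [phi g * _]mulrC.
- by move=> c; apply: phi_reg; rewrite polyXsubC_eq0.
- case=> n c n0; first by apply: qreg; rewrite lt0n.
  rewrite NegzE => H; apply: (qreg n.+1) => //.
  have e : phi 'X ^+ n.+1 - 1 = - phi 'X ^+ n.+1 * (phi 'X ^ (- n.+1%:Z) - 1).
    rewrite exprnP mulNr mulrBr mulr1 -exprzDr // subrr expr0z opprB //.
  by rewrite e -mulrA H mulr0.
- (* the quotient of 'X^l - 1 by 'X - eps takes at eps the value of the derivative *)
  have : root ('X^l - 1 : {poly K}) eps.
    by rewrite rootE !hornerE (prim_expr_order prim_eps) subrr.
  move/factor_theorem => [g eg]; exists (phi g); split.
    by rewrite -rmorphXn -(rmorph1 phi) -rmorphB eg rmorphM mulrC.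
  rewrite evE; have := congr1 (fun p => (p^`()).[eps]) eg.
  rewrite /= derivM derivB derivXn derivC derivXsubC !hornerE subrr mulr0 add0r => <-.
  rewrite subr0 hornerMn hornerXn -mulr_natl.
  have e0 : eps != 0.
    apply/eqP => e; have := prim_expr_order prim_eps.
    by rewrite e expr0n eqn0Ngt l0 => /eqP; rewrite eq_sym oner_eq0.
  congr (_ * _); apply: (mulIf e0); rewrite mulVf // -exprSr prednK //.
  exact: prim_expr_order.
Qed.
End Localisation.

(** * Prime quotients of the specialised algebra *)
Section Core.
Variables (K : fieldType) (C : comUnitRingType) (phi : {rmorphism {poly K} -> C}).
Variables (h : C) (ev : {rmorphism C -> K}) (eps : K) (l : nat).
Hypothesis evE : forall p, ev (phi p) = p.[eps].
Hypothesis sp : specialised (phi 'X) h ev eps l.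
Variables (R : unitAlgType C) (M : nat) (S : 'M[int]_M) (kappa : {set 'I_M}) (x : 'I_M -> R).
Variables sg sg' : 'I_M -> int.
Hypothesis hc : homogeneous_chains (phi 'X) l S kappa x sg sg'.
Variables (B : nzRingType) (rho : {rmorphism R -> B}).
Hypothesis primeB : prime_ideal (fun a : B => a = 0).
Hypothesis rho_surj : forall b, exists a, rho a = b.
Hypothesis rho_h : forall w, rho (h *: w) = 0.
Hypothesis rho_stable : forall i v w,
  x i ^+ l * v - v * x i ^+ l = h *: w -> rho v = 0 -> rho w = 0.

Local Notation hs := (hsub S kappa x).

Lemma hs_all y : hs 0 M (fun=> 0) y.
Proof.
elim: (hc_gen hc y) => {y}.
- move=> y [j _ [->|[kj ->]]]; first exact: hs_gen.
  exact: hs_inv.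
- by move=> c; apply: hs_sc.
- by move=> y z _ Hy _ Hz; apply: hs_add.
- by move=> y z _ Hy _ Hz; apply: hs_mul Hy Hz _.
Qed.

Lemma comm_all (i : 'I_M) a : exists w, x i ^+ l * a - a * x i ^+ l = h *: w.
Proof. by have [w [_ e]] := comm_exists sp hc (leq0n i) (hs_all a); exists w. Qed.

Lemma rho_central (i : 'I_M) : central (rho (x i ^+ l)).
Proof.
move=> b; have [a <-] := rho_surj b; have [w e] := comm_all i a.
by apply/eqP; rewrite -subr_eq0 -!rmorphM -rmorphB e rho_h.
Qed.

Definition scalar_emb : {rmorphism K -> B} := rho \o in_alg R \o phi \o polyC.

Lemma scalar_embE k : scalar_emb k = rho (phi k%:P)%:A.
Proof. by []. Qed.

Lemma scalar_emb_central k : central (scalar_emb k).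
Proof.
move=> b; have [a <-] := rho_surj b.
by rewrite scalar_embE -!rmorphM -scalerAl -scalerAr mulr1 mul1r.
Qed.

Lemma rho_scalar c : rho c%:A = scalar_emb (ev c).
Proof.
rewrite scalar_embE; have [|d e] := sp_ker sp (c := c - phi (ev c)%:P).
  by rewrite rmorphB evE hornerC subrr.
apply/eqP; rewrite -subr_eq0 -rmorphB -scalerBl e -scalerA rho_h //.
Qed.

(** Every element of [B] is homogeneous at stage 0, where no degree is recorded. *)
Theorem prime_quotient_domain (a b : B) : a * b = 0 -> a = 0 \/ b = 0.
Proof.
apply: prime_reduced_domain => // {a b} b b2.
have [Q [j [jinj jkap jinv jfrac]]] :=
  central_fractions scalar_emb_central (fun c a => prime_central primeB (c := c) (a := a)).
(* the derivations of B attached to the [x i ^+ l], and their extensions to Q *)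
have /choice[d Hd] (i : 'I_M) : exists d : B -> B,
    forall v w, x i ^+ l * v - v * x i ^+ l = h *: w -> d (rho v) = rho w.
  have /choice[d Hd] c : exists c', forall v w, rho v = c ->
      x i ^+ l * v - v * x i ^+ l = h *: w -> c' = rho w.
    have [v ev'] := rho_surj c; have [w e] := comm_all i v.
    exists (rho w) => v' w' e1 e2; apply/eqP; rewrite -subr_eq0 -rmorphB.
    apply/eqP; apply: (rho_stable (i := i) (v := v - v')).
      by rewrite mulrBr mulrBl scalerBr -e -e2 !opprB [LHS](AC (2*2) ((1*4)*(3*2))).
    by rewrite rmorphB ev' e1 subrr.
  by exists d => v w; apply: Hd.
have dD i u v : d i (u + v) = d i u + d i v.
  have [u' <-] := rho_surj u; have [v' <-] := rho_surj v.
  have [w e] := comm_all i u'; have [w' e'] := comm_all i v'.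
  rewrite (Hd _ _ _ e) (Hd _ _ _ e') -!rmorphD; apply: Hd.
  by rewrite mulrDr mulrDl opprD addrACA e e' scalerDr.
have dM i u v : d i (u * v) = d i u * v + u * d i v.
  have [u' <-] := rho_surj u; have [v' <-] := rho_surj v.
  have [w e] := comm_all i u'; have [w' e'] := comm_all i v'.
  rewrite (Hd _ _ _ e) (Hd _ _ _ e') -!rmorphM -rmorphD; apply: Hd.
  by rewrite scalerDr scalerAl scalerAr -e -e' mulrBl mulrBr !mulrA addrA subrK.
have dk i k : d i (scalar_emb k) = 0.
  rewrite scalar_embE -(rmorph0 rho); apply: Hd.
  by rewrite -scalerAl -scalerAr mulr1 mul1r subrr scaler0.
have /choice[D HD] (i : 'I_M) : exists D : Q -> Q, derivation D /\ forall c, D (j c) = j (d i c).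
  exact: (extend_derivation jinj jkap jinv jfrac (dD i) (dM i) (dk i)).
pose X i := j (rho (x i)).
have Xunit (i : 'I_M) : i \in kappa -> exists c, X i * c = 1 /\ c * X i = 1.
  move=> ki; exists (j (rho (x i)^-1)); have ui := hc_unit hc ki.
  by rewrite /X -!rmorphM divrr // mulVr // !rmorph1.
have graphE v a c : graph ev S kappa x X 0 v a c -> c = j (rho a).
  elim=> {v a c}.
  - by [].
  - move=> i v c _ ki _ e1 e2; have ui := hc_unit hc ki.
    have e3 : X i * j (rho (x i)^-1) = 1 by rewrite /X -!rmorphM divrr // !rmorph1.
    by rewrite -[c]mulr1 -e3 mulrA e2 mul1r.
  - by move=> c v _; rewrite rho_scalar jkap.
  - by move=> v a c a' c' _ -> _ ->; rewrite !rmorphD.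
  - by move=> v w u a c a' c' _ -> _ -> _; rewrite !rmorphM.
  - by move=> v; rewrite !rmorph0.
have st : stage h ev eps l S kappa x 0 pred0 X D (fun=> 0) (fun=> 0) (fun=> id).
  split=> //.
  - by move=> i _; apply: Xunit.
  - by move=> v c /graphE->; rewrite !rmorph0.
  - move=> i _; rewrite /X -!rmorphXn.
    exact: (frac_central jinv jfrac (rho_central i)).
  - by move=> i _; case: (HD i).
  - move=> i v u a c w c' _ /graphE-> /graphE-> _ e.
    by rewrite (HD i).2 (Hd _ _ _ e).
have cinv := frac_inv jinj jinv jfrac.
have inA c : alg S kappa 0 pred0 X (fun=> 0) (fun=> 0) (j c).
  have [a <-] := rho_surj c.
  have [c' Hc'] := gr_total ev (X := X) (fun i _ => Xunit i) (hs_all a).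
  by rewrite -(graphE _ _ _ Hc'); apply: ga_graph Hc'.
have [|J [[iJ [r Hr]] Jb]] := nil_prop_all sp hc cinv (leq0n M) st (inA b).
  by exists 2; rewrite -rmorphXn b2 rmorph0.
apply: (prime_nilpotent_ideal primeB (J := fun c => J (j c))) Jb.
  by move=> a c Jc; rewrite rmorphM; apply: (id_Ml iJ).
exists r => t szt Ht; apply: jinj; rewrite rmorph_prod.
rewrite -(big_map j xpredT id); apply: Hr; first by rewrite size_map.
by move=> _ /mapP[a ta ->]; apply: Ht.
Qed.
End Core.

Theorem theorem3p3
  (K : closedFieldType) (charK : [pchar K] =i pred0)
  (C : comUnitRingType) (fs : seq {poly K}) (phi : {rmorphism {poly K} -> C})
  (locC : localization fs phi)
  (R : unitAlgType C) (M : nat) (S : 'M[int]_M) (kappa : {set 'I_M})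
  (x : 'I_M -> R)
  (nqsR : NQS_algebra (phi 'X) S kappa x)
  (tau delta tau' delta' : 'I_M -> R -> R)
  (skewR : NQS_skew_maps (phi 'X) S kappa x tau delta tau' delta')
  (s s' : 'I_M -> int)
  (cn1 : CN1 (phi 'X) kappa x tau delta tau' delta' s s')
  (cn2 : CN2 kappa x tau tau')
  (N_ : 'I_M -> nat) (nilN : nilpotency_bound x delta delta' N_)
  (l : nat) (eps : K) (prim_eps : l.-primitive_root eps)
  (spec_eps : specialisable phi eps)
  (coprime_l : forall i, coprime l `|s i|%N /\ coprime l `|s' i|%N)
  (leNl : (\max_(a < M) N_ a <= l)%N)
  (Re : nzRingType) (pi : {rmorphism R -> Re})
  (quotR : quotient_by (phi ('X - eps%:P)) pi)
  (I : Re -> Prop) (primeI : prime_ideal I)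
  (stableI : D_stable (phi ('X - eps%:P)) pi I) :
  completely_prime I.
Proof.
have [idI I1 prI] := primeI; have [ev evE] := spec_eps; have [pi_surj pi_ker] := quotR.
have sp := specialised_localisation charK locC prim_eps evE.
have hc := nqs_chains sp nqsR skewR cn1 nilN coprime_l leNl.
have [B [f [f_surj f_ker]]] := quotient_ring_exists idI I1.
pose rho : {rmorphism R -> B} := f \o pi.
have rhoE a : rho a = f (pi a) by [].
have rho_surj b : exists a, rho a = b.
  by have [c <-] := f_surj b; have [a <-] := pi_surj c; exists a.
have rho_h w : rho (phi ('X - eps%:P) *: w) = 0.
  by rewrite rhoE (_ : pi _ = 0) ?rmorph0 //; apply/pi_ker; exists w.
have primeB : prime_ideal (fun a : B => a = 0).
  split.
  - split=> //.
    + by move=> a b -> ->; rewrite addr0.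
    + by move=> r a ->; rewrite mulr0.
    + by move=> r a ->; rewrite mul0r.
  - by move/eqP; rewrite oner_eq0.
  move=> J J' iJ iJ' JJ'.
  have pull L : two_sided_ideal L -> two_sided_ideal (fun a => L (f a)).
    move=> iL; split.
    - by rewrite rmorph0; apply: ideal0 iL.
    - by move=> a b La Lb; rewrite rmorphD; apply: (idealD iL).
    - by move=> r a La; rewrite rmorphM; apply: (idealMl iL).
    - by move=> r a La; rewrite rmorphM; apply: (Defs.idealMr iL).
  have [|H|H] := prI _ _ (pull _ iJ) (pull _ iJ').
  - by move=> a b Ja Jb; apply/f_ker; rewrite rmorphM; apply: JJ'.
  - by left=> a; have [c <-] := f_surj a => /H/f_ker.
  - by right=> a; have [c <-] := f_surj a => /H/f_ker.
have rho_stable (i : 'I_M) v w :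
    x i ^+ l * v - v * x i ^+ l = phi ('X - eps%:P) *: w -> rho v = 0 -> rho w = 0.
  move=> e /f_ker Iv; apply/f_ker; apply: (stableI (x i ^+ l) _ _ _ Iv); last by exists v, w.
  move=> c; have [a <-] := pi_surj c; have [w' e'] := comm_all sp hc i a.
  apply/eqP; rewrite -subr_eq0 -!rmorphM -rmorphB; apply/eqP/pi_ker.
  by exists w'.
split=> // a b /f_ker; rewrite rmorphM.
by case/(prime_quotient_domain evE sp hc primeB rho_surj rho_h rho_stable); [left|right]; apply/f_ker.
Qed.
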